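(* Let $V$ be a potential as in the context (twice continuously differentiable on an open interval containing $1$, $V''>0$, $V'(1)=0$), and let $|\cdot|$ be a norm on $\mathbb R^{2\times2}$. There exist $\alpha_0=\alpha_0(V)>0$ and a constant $m_0=m_0(V)\in\mathbb R$ such that for every $\alpha\in(0,\alpha_0)$ and every $l\in(1-\alpha/2,1+\alpha/2)$, $$\lim_{\beta\to\infty}\ \sup_{N\ge 5}\ \sup_{m\ge m_0}\ \sup_{\Delta\in\mathcal T_N}\ E_{P_{\beta,m,N}}\big[\,|\nabla\hat\omega(\Delta)-l\,\mathrm{Id}|^2\,\big]=0 .$$ Here $N$ ranges over integers, $m$ over reals, $\nabla\hat\omega(\Delta)$ is the constant Jacobian matrix of $\hat\omega$ on the triangle $\Delta$, and $P_{\beta,m,N}$ (which also depends on $\alpha,l,V$) is the Gibbs measure defined in the context.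
   Context: Potential. $V$ is a real-valued, twice continuously differentiable function on an open interval containing $1$, with $V''>0$ and $V'(1)=0$. The parameter $\alpha>0$ is always so small that $V$ is defined on $[1-\alpha,1+\alpha]$ (and $\alpha<1$), and $l\in(1-\alpha/2,1+\alpha/2)$. Lattice. Identify $\mathbb C$ with $\mathbb R^2$. Let $\tau=e^{\pi i/3}$, $A_2=\mathbb Z+\tau\mathbb Z$ (triangular lattice), $x\sim y$ iff $|x-y|=1$, and $\mathcal N=\{\tau^j:j\in\mathbb Z\}$ (the six neighbors of $0$). For $N\in\mathbb N$ let $I_N=\{x+\tau^2y:x,y\in\{0,\dots,N-1\}\}$ (representatives of $A_2/NA_2$) and $\Lambda_{lN}=[0,lN)+\tau^2[0,lN)$ (representatives of $\mathbb C/lNA_2$). For $x\in A_2$, $z\in\{1,\tau\}$ let $\Delta_{x,z}=\{x+sz+t\tau z:s,t>0,\ s+t<1\}$ (open triangle with corners $x,x+z,x+\tau z$), $\mathcal T=\{\Delta_{x,z}:x\in A_2,z\in\{1,\tau\}\}$ and $\mathcal T_N=\{\Delta_{x,z}:x\in I_N,z\in\{1,\tau\}\}$. Configurations. Let $\diamond$ be an extra symbol denoting a hole (defect). $\Omega^*_{l,N}$ is the set of $\omega\in(\mathbb C\cup\{\diamond\})^{A_2}$ such that for all $x,z\in A_2$: $\omega(x+Nz)=\omega(x)+lNz$ if $\omega(x)\ne\diamond$, and $\omega(x+Nz)=\diamond$ if $\omega(x)=\diamond$. Such $\omega$ is determined by its restriction to $I_N$, so $\Omega^*_{l,N}$ is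 identified with $(\mathbb C\cup\{\diamond\})^{I_N}$. Two configurations $\omega,\omega'$ are identified if there is $z\in A_2$ with $\omega(x)=\omega'(x+Nz)$ for all $x\in A_2$; $\underline\Omega_{l,N}$ is the quotient, identified with a measurable set of representatives in $\Omega^*_{l,N}$, e.g. those $\omega$ with $\omega(x)\in\Lambda_{lN}$ for the lexicographically smallest $x\in I_N$ with $\omega(x)\ne\diamond$ (together with the constant configuration $\diamond$); the choice is irrelevant. For $x\in A_2$ put $\hat\omega(x)=\omega(x)$ if $\omega(x)\neq\diamond$ and $\hat\omega(x)=\frac16\sum_{z\in\mathcal N}\omega(x+z)$ if $\omega(x)=\diamond$ (used for configurations satisfying (Ω2) below, so that the sum makes sense), and extend $\hat\omega$ to a map $\mathbb C\to\mathbb C$ that is affine linear on the closure of every triangle in $\mathcal T$. For $\Delta\in\mathcal T$, $\nabla\hat\omega(\Delta)\in\mathbb R^{2\times2}$ is the constant value of the Jacobian of $\hat\omega$ on $\Delta$. The set $\Omega_{l,N}$ of allowed configurations consists of all $\omega\in\underline\Omega_{l,N}$ with: (Ω1) $|\omega(x)-\omega(y)|\in(1-\alpha,1+\alpha)$ for all $x\sim y$ in $A_2$ with $\omega(x)\ne\diamond\ne\omega(y)$; (Ω2) for all $x,y\in A_2$, $\omega(x)=\omega(y)=\diamond$ only if $x=y$ or $|x-y|>2$; (Ω3) $\hat\omega:\mathbb C\to\mathbb C$ is bijective; (Ω4) $\operatorname{Im}\big(\frac{\hat\omega(x+\tau z)-\hat\omega(x)}{\hat\omega(x+z)-\hat\omega(x)}\big)>0$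 for all $x\in A_2$, $z\in\mathcal N$. Gibbs measure. For $m\in\mathbb R$ and $\omega\in\Omega_{l,N}$, $$H_{m,N}(\omega)=\tfrac12\sum_{x\in I_N}\sum_{y\in A_2:\,y\sim x}1_{\{\omega(x)\ne\diamond,\ \omega(y)\neq\diamond\}}V(|\omega(x)-\omega(y)|)+m\sum_{x\in I_N}1_{\{\omega(x)=\diamond\}}.$$ Let $\lambda$ be Lebesgue measure on $\mathbb C$; $\mu_N$ is the restriction to $\underline\Omega_{l,N}$ of the product measure $(\lambda+\delta_\diamond)^{I_N}$ on $(\mathbb C\cup\{\diamond\})^{I_N}\cong\Omega^*_{l,N}$. For $\beta>0$, $Z_{\beta,m,N}=\int_{\Omega_{l,N}}e^{-\beta H_{m,N}}\,d\mu_N$ and $P_{\beta,m,N}(d\omega)=Z_{\beta,m,N}^{-1}e^{-\beta H_{m,N}(\omega)}\mu_N(d\omega)$, a probability measure on $\Omega_{l,N}$; $E_{P_{\beta,m,N}}$ is its expectation. *)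

(* Defs.v *)
From HB Require Import structures.
From mathcomp Require Import all_boot all_order all_algebra.
From mathcomp Require Import all_classical all_reals all_analysis.
From mathcomp Require Import complex ring lra zify.

Set Implicit Arguments.
Unset Strict Implicit.
Unset Printing Implicit Defensive.

Import Order.TTheory GRing.Theory Num.Theory.
Import numFieldNormedType.Exports.

Local Open Scope classical_set_scope.
Local Open Scope ring_scope.

Section potential_and_norm.
Context {R : realType}.

Definition potential (I : set R) (V : R -> R) : Prop :=
  [/\ [/\ open I, is_interval I & I 1],
      forall x, I x -> derivable V x 1,
      forall x, I x -> derivable V^`()%classic x 1,
      forall x, I x -> {for x, continuous V^`(2)%classic} &
      (forall x, I x -> 0 < V^`(2)%classic x) /\ V^`()%classic 1 = 0].

Definition is_norm (nrm : 'M[R]_2 -> R) : Prop :=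
  [/\ forall A, 0 <= nrm A,
      forall A, nrm A = 0 -> A = 0,
      forall a A, nrm (a *: A) = `|a| * nrm A &
      forall A B, nrm (A + B) <= nrm A + nrm B].

End potential_and_norm.

(* The pair (a, b) stands for the lattice point a + b tau. *)
Notation A2 := (int * int)%type.

Definition one2 : A2 := (1, 0).

(* Multiplication by tau: tau ^ 2 = tau - 1. *)
Definition mul_tau (x : A2) : A2 := (- x.2, x.1 + x.2).

(* 1, tau, ..., tau ^ 5; recall that tau ^ 6 = 1. *)
Definition nbrs : seq A2 := traject mul_tau one2 6.

Definition site (x y : int) : A2 := (x, 0) + mul_tau (mul_tau (y, 0)).

(* Listed in the lexicographic order of (x, y). *)
Definition IN (N : nat) : seq A2 :=
  [seq site x%:Z y%:Z | x <- iota 0 N, y <- iota 0 N].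

(* The representative of x in I_N and the q with x = red N x + N q: the
   coordinates of a + b tau in the basis (1, tau ^ 2) are (a + b, b). *)
Definition red (N : nat) (x : A2) : A2 :=
  site ((x.1 + x.2) %% N%:Z)%Z (x.2 %% N%:Z)%Z.
Definition quo (N : nat) (x : A2) : A2 :=
  site ((x.1 + x.2) %/ N%:Z)%Z (x.2 %/ N%:Z)%Z.

(* (x, z) stands for the triangle with corners x, x + z, x + tau z. *)
Definition triangle (D : A2 * A2) : Prop := D.2 = one2 \/ D.2 = mul_tau one2.
Definition triangleN (N : nat) (D : A2 * A2) : Prop :=
  triangle D /\ D.1 \in IN N.

Section model.
Context {R : realType}.
Local Notation C := R[i].

Definition tau : C := (cos (pi / 3) +i* sin (pi / 3))%C.

Definition emb (x : A2) : C := x.1%:~R + x.2%:~R * tau.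

Definition dist (z w : C) : R := Normc.normc (z - w).

Definition adj (x y : A2) : Prop := dist (emb x) (emb y) = 1.

Definition Lambda (L : R) : set C :=
  [set z | exists s t : R,
     [/\ 0 <= s < L, 0 <= t < L & z = s%:C%C + tau ^+ 2 * t%:C%C]].

(* [None] is the hole. *)
Definition spin := option C.
Definition config := A2 -> spin.

Definition Omega_star (l : R) (N : nat) : set config :=
  [set w | forall x z : A2,
     w (x + z *+ N) =
     if w x is Some c then Some (c + (l * N%:R)%:C%C * emb z) else None].

(* The configuration in Omega_star whose restriction to I_N is t. *)
Definition extend (l : R) (N : nat) (t : (size (IN N)).-tuple spin) : config :=
  fun x => omap (fun c => c + (l * N%:R)%:C%C * emb (quo N x))
                (nth None t (index (red N x) (IN N))).

(* A representative system for the configurations modulo N A_2 shifts. *)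
Definition Omega_quot (l : R) (N : nat) : set config :=
  [set w | Omega_star l N w /\
     forall x c, x \in IN N -> w x = Some c ->
       (forall y, y \in IN N -> (index y (IN N) < index x (IN N))%N ->
          w y = None) ->
       Lambda (l * N%:R) c].

(* The default value 0 is irrelevant when holes have no holes as neighbours. *)
Definition hat0 (w : config) (x : A2) : C :=
  if w x is Some c then c else 6^-1 * \sum_(z <- nbrs) odflt 0 (w (x + z)).

(* The affine interpolation on the triangle x, x + z, x + tau z, at the point
   x + s z + t tau z. *)
Definition interp (w : config) (x z : A2) (s t : R) : C :=
  hat0 w x + s%:C%C * (hat0 w (x + z) - hat0 w x)
           + t%:C%C * (hat0 w (x + mul_tau z) - hat0 w x).

(* With p = a + b tau, p lies in the parallelogram with corners x, x + 1,
   x + tau, x + 1 + tau for x = floor a + (floor b) tau; its diagonal from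
   x + 1 to x + tau separates two triangles. *)
Definition hat (w : config) (p : C) : C :=
  let b := complex.Im p / sin (pi / 3) in
  let a := complex.Re p - b * cos (pi / 3) in
  let x : A2 := (Num.floor a, Num.floor b) in
  let s := a - (Num.floor a)%:~R in
  let t := b - (Num.floor b)%:~R in
  if s + t <= 1 then interp w x one2 s t
  else interp w (x + one2) (mul_tau one2) (s + t - 1) (1 - s).

Definition toC (v : 'rV[R]_2) : C := (v 0 0 +i* v 0 1)%C.
Definition ofC (z : C) : 'rV[R]_2 :=
  \row_(j < 2) if j == 0 then complex.Re z else complex.Im z.

Definition barycenter (D : A2 * A2) : C :=
  emb D.1 + 3^-1 * (emb D.2 + emb (mul_tau D.2)).

(* The library's [jacobian] acts on row vectors, hence the transpose.  As [hat]
   is affine on the triangle, any of its points may replace the barycenter. *)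
Definition grad (w : config) (D : A2 * A2) : 'M[R]_2 :=
  (jacobian (fun v => ofC (hat w (toC v))) (ofC (barycenter D)))^T.

Definition Omega (alpha l : R) (N : nat) : set config :=
  [set w | [/\ Omega_quot l N w,
    forall x y c d, adj x y -> w x = Some c -> w y = Some d ->
      1 - alpha < dist c d < 1 + alpha,
    forall x y, w x = None -> w y = None ->
      x = y \/ 2 < dist (emb x) (emb y),
    bijective (hat w) &
    forall x z, z \in nbrs ->
      0 < complex.Im ((hat0 w (x + mul_tau z) - hat0 w x) /
                      (hat0 w (x + z) - hat0 w x))]].

Definition pair_energy (V : R -> R) (u v : spin) : R :=
  if (u, v) is (Some c, Some d) then V (dist c d) else 0.

Definition hamiltonian (V : R -> R) (m : R) (N : nat) (w : config) : R :=
  2^-1 * (\sum_(x <- IN N) \sum_(y \in [set y | adj x y])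
            pair_energy V (w x) (w y))
  + m * \sum_(x <- IN N) (w x == None)%:R.

HB.instance Definition _ := Choice.on spin.
HB.instance Definition _ := isPointed.Build spin None.

Definition of_plane (p : measurableTypeR R * measurableTypeR R) : spin :=
  Some (p.1 +i* p.2)%C.

Definition spin_measurable : set (set spin) :=
  [set A | measurable (of_plane @^-1` A)].

Lemma spin_measurable0 : spin_measurable set0.
Proof. by rewrite /spin_measurable /= preimage_set0. Qed.

Lemma spin_measurableC A : spin_measurable A -> spin_measurable (~` A).
Proof. by rewrite /spin_measurable /= preimage_setC; exact: measurableC. Qed.

Lemma spin_measurable_bigcup (F : (set spin)^nat) :
  (forall i, spin_measurable (F i)) -> spin_measurable (\bigcup_i F i).
Proof.
rewrite /spin_measurable /= preimage_bigcup => mF.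
exact: bigcupT_measurable.
Qed.

HB.instance Definition _ := isMeasurable.Build default_measure_display spin
  spin_measurable0 spin_measurableC spin_measurable_bigcup.

Lemma measurable_of_plane : measurable_fun setT of_plane.
Proof. by move=> _ A mA; rewrite setTI. Qed.

Lemma measurable_hole : measurable [set None : spin].
Proof.
rewrite /measurable /= /spin_measurable /=.
by rewrite (_ : _ @^-1` _ = set0)//; apply/seteqP; split.
Qed.

(* Lebesgue measure on C plus a unit mass at the hole. *)
Definition spin_measure : set spin -> \bar R := fun A =>
  (pushforward (lebesgue_measure \x lebesgue_measure) of_plane A
   + \d_(None : spin) A)%E.

Let spin_measureE : spin_measure =
  measure_add (measure_function_pushforward__canonical__measure_function_Measure
    (lebesgue_measure \x lebesgue_measure)%E measurable_of_plane)
    \d_(None : spin).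
Proof. by apply/funext => A; rewrite measure_addE. Qed.

Let spin_measure0 : spin_measure set0 = 0%E.
Proof. by rewrite spin_measureE; exact: measure0. Qed.

Let spin_measure_ge0 A : (0 <= spin_measure A)%E.
Proof. by rewrite spin_measureE; exact: measure_ge0. Qed.

Let spin_measure_sigma_additive : semi_sigma_additive spin_measure.
Proof. by rewrite spin_measureE; exact: measure_semi_sigma_additive. Qed.

HB.instance Definition _ := isMeasure.Build _ _ _ spin_measure
  spin_measure0 spin_measure_ge0 spin_measure_sigma_additive.

Let spin_measure_sigma_finite : sigma_finite setT spin_measure.
Proof.
have /sigma_finiteP[F [TF ndF Foo]] := sigma_finiteT (@lebesgue_measure R).
pose S k : set spin := [set s | if s is Some c
  then F k (complex.Re c) /\ F k (complex.Im c) else True].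
have SE k : of_plane @^-1` S k = F k `*` F k by [].
exists S => [|k].
  apply/esym/seteqP; split=> // -[[a b]|] _; last by exists 0%N.
  have : setT a by []. have : setT b by [].
  rewrite TF => -[m _ Fb] [n _ Fa]; exists (maxn m n) => //; split=> /=.
    by move: Fa; exact/subsetPset/ndF/leq_maxr.
  by move: Fb; exact/subsetPset/ndF/leq_maxl.
have [mF Fk] := Foo k; split.
  by rewrite /measurable /= /spin_measurable /= SE; exact: measurableX.
rewrite /spin_measure /pushforward SE lte_add_pinfty//.
  by rewrite product_measure1E// lte_mul_pinfty// ge0_fin_numE.
by rewrite diracE; case: (_ \in _); rewrite /= ltry.
Qed.

HB.instance Definition _ := Measure_isSigmaFinite.Build _ _ _
  spin_measure spin_measure_sigma_finite.

End model.

Arguments extend {R} l N t.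

Section facts.
Context {R : realType}.

Lemma sin_pi3_gt0 : 0 < sin (pi / 3) :> R.
Proof. by apply: sin_gt0_pi; have := pi_gt0 R; lra. Qed.

Lemma cos_pi3 : cos (pi / 3) = 2^-1 :> R.
Proof.
set c := cos _.
have c0 : 0 < c by apply: cos_gt0_pihalf; have := pi_gt0 R; lra.
have : cos (pi / 3 *+ 2 + pi / 3) = - 1 :> R.
  by rewrite -cospi; congr cos; field.
rewrite cosD cos_mulr2n sin_mulr2n -/c.
set s := sin _ => E.
have s2 : s ^+ 2 = 1 - c ^+ 2 by rewrite /s sin2cos2.
have : (c + 1) * (c *+ 2 - 1) ^+ 2 = 0.
  have -> : (c + 1) * (c *+ 2 - 1) ^+ 2
    = (c ^+ 2 *+ 2 - 1) * c - (c * s) *+ 2 * s + 1 + (c *+ 2) * (s ^+ 2 - (1 - c ^+ 2)) by ring.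
  by rewrite E s2; ring.
by move/eqP; rewrite mulf_eq0 sqrf_eq0 => /orP[]/eqP; lra.
Qed.

Lemma tauE : tau ^+ 2 = tau - 1 :> R[i].
Proof.
rewrite /tau; set s := sin _; have := cos2Dsin2 (pi / 3 : R).
rewrite -/s cos_pi3 => s2.
rewrite expr2; apply/eqP; rewrite eq_complex /=; apply/andP; split; apply/eqP; last by field.
have -> : s * s = s ^+ 2 by []. lra.
Qed.

Lemma emb_mul_tau x : emb (mul_tau x) = tau * emb x :> R[i].
Proof.
rewrite /emb /= rmorphN rmorphD /= mulrDr.
have -> : tau * (x.2%:~R * tau) = x.2%:~R * tau ^+ 2 :> R[i] by ring.
rewrite tauE; ring.
Qed.

Lemma embD x y : emb (x + y) = emb x + emb y :> R[i].
Proof. by rewrite /emb /= !rmorphD /=; ring. Qed.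

Lemma embMn x n : emb (x *+ n) = emb x *+ n :> R[i].
Proof. by elim: n => [|n IH]; rewrite ?mulrS ?embD ?IH// /emb /= mulr0z mul0r addr0. Qed.

Lemma siteE x y : emb (site x y) = x%:~R + tau ^+ 2 * y%:~R :> R[i].
Proof. by rewrite /site embD !emb_mul_tau /emb /=; ring. Qed.

Lemma red_quo N x : x = red N x + quo N x *+ N.
Proof.
have MnE (a b : int) : (a, b) *+ N = (a * N%:Z, b * N%:Z) :> A2.
  elim: N => [|n IH]; first by rewrite !mulr0.
  by rewrite mulrS IH; congr pair => /=; lia.
case: x => a b; rewrite /red /quo /site /= MnE.
have E1 := divz_eq (a + b) N; have E2 := divz_eq b N.
congr pair => /=; lia.
Qed.

Lemma red_IN N x : (0 < N)%N -> red N x \in IN N.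
Proof.
move=> N0; have mod_nat (a : int) : exists2 k, (k < N)%N & (a %% N%:Z)%Z = k%:Z.
  have Nn : N%:Z != 0 by lia.
  have := modz_ge0 a Nn; have := ltz_mod a Nn.
  case: (_ %% _)%Z => // k kN _; exists k => //; lia.
have [i iN Ei] := mod_nat (x.1 + x.2); have [j jN Ej] := mod_nat x.2.
rewrite /red Ei Ej; apply/allpairsP; exists (i, j); split => //; rewrite mem_iota add0n /= ?iN ?jN//.
Qed.

Lemma uniq_IN N : uniq (IN N).
Proof.
apply: allpairs_uniq; rewrite ?iota_uniq// => -[a b] [c d] _ _ /=.
by rewrite /site /= => -[E1 E2]; congr pair; lia.
Qed.

Lemma redK N x : x \in IN N -> red N x = x /\ quo N x = 0.
Proof.
move=> /allpairsP[[i j] [/= ]]; rewrite !mem_iota !add0n /= => iN jN ->.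
have siteD (u v : int) : (site u v).1 + (site u v).2 = u by rewrite /site /=; ring.
have site2 (u v : int) : (site u v).2 = v by rewrite /site /=; ring.
by rewrite /red /quo siteD site2 !modz_small ?divz_small.
Qed.

Lemma red_shift N x z : (0 < N)%N ->
  red N (x + z *+ N) = red N x /\
  emb (quo N (x + z *+ N)) = emb (quo N x) + emb z :> R[i].
Proof.
move=> N0.
have MnE (a b : int) : (a, b) *+ N = (a * N%:Z, b * N%:Z) :> A2.
  elim: N {N0} => [|n IH]; first by rewrite !mulr0.
  by rewrite mulrS IH; congr pair => /=; lia.
case: x z => a b [c d]; rewrite MnE /red /quo.
have -> : ((a, b) + (c * N%:Z, d * N%:Z)).1 + ((a, b) + (c * N%:Z, d * N%:Z)).2 =
  (c + d) * N%:Z + (a + b) by rewrite /=; ring.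
have -> : ((a, b) + (c * N%:Z, d * N%:Z)).2 = d * N%:Z + b by rewrite /=; ring.
have Nn : N%:Z != 0 by lia.
rewrite !modzMDl !divzMDl//=; split=> //.
by rewrite -embD; congr emb; rewrite /site; congr pair => /=; ring.
Qed.

Lemma extend_Omega_star (l : R) N t : (0 < N)%N -> Omega_star l N (extend l N t).
Proof.
move=> N0 x z; rewrite /extend; have [-> ->] := red_shift x z N0.
by case: nth => //= c; rewrite mulrDr addrA.
Qed.

Lemma extend_restr (l : R) N t : map (extend l N t) (IN N) = t.
Proof.
apply: (@eq_from_nth _ None); rewrite size_map ?size_tuple// => i iN.
rewrite (nth_map 0)// /extend; have [-> ->] := redK (mem_nth 0 iN).
rewrite index_uniq ?uniq_IN//; case: nth => //= c.
by rewrite /emb /= !mul0r addr0 mulr0 addr0.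
Qed.

Lemma Omega_star_extend (l : R) N w : (0 < N)%N -> Omega_star l N w ->
  extend l N (map_tuple w (in_tuple (IN N))) = w.
Proof.
move=> N0 wO; apply/funext => x; rewrite {2}(red_quo N x) wO /extend.
by rewrite (nth_map 0) ?index_mem ?red_IN// nth_index ?red_IN//; case: (w _).
Qed.

Lemma hat_at (w : @config R) (k1 k2 : int) (r1 r2 : R) :
  0 <= r1 < 1 -> 0 <= r2 < 1 ->
  hat w ((k1%:~R + r1)%:C%C + (k2%:~R + r2)%:C%C * tau) =
  if r1 + r2 <= 1 then interp w (k1, k2) one2 r1 r2
  else interp w ((k1, k2) + one2) (mul_tau one2) (r1 + r2 - 1) (1 - r1).
Proof.
move=> r1P r2P; have s0 := sin_pi3_gt0.
have fl (k : int) (r : R) : 0 <= r < 1 -> Num.floor (k%:~R + r) = k.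
  by move=> rP; apply: floor_def; rewrite rmorphD /=; lra.
rewrite /hat; set p := (_ + _ : R[i]).
have bE : complex.Im p / sin (pi / 3) = k2%:~R + r2.
  by rewrite /p /tau /= mul0r addr0 add0r mulfK// lt0r_neq0.
have aE : complex.Re p - (k2%:~R + r2) * cos (pi / 3) = k1%:~R + r1.
  by rewrite /p /tau /= mul0r subr0 addrK.
rewrite bE aE !fl//.
by have add_sub (k r : R) : k + r - k = r by [ring]; rewrite !add_sub.
Qed.

Lemma hat_interp (w : @config R) x z s t :
  triangle (x, z) -> 0 <= s -> 0 <= t -> s + t <= 1 ->
  hat w (emb x + s%:C%C * emb z + t%:C%C * emb (mul_tau z)) = interp w x z s t.
Proof.
have RC (k : int) : k%:~R = (k%:~R : R)%:C%C :> R[i].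
  by rewrite (rmorph_int (real_complex R)).
case: x => a b; case=> /= -> s0 t0 st.
  have -> : emb (a, b) + s%:C%C * emb one2 + t%:C%C * emb (mul_tau one2)
     = (a%:~R + s)%:C%C + (b%:~R + t)%:C%C * tau.
    by rewrite emb_mul_tau /emb /= !RC !rmorphD /=; ring.
  have [s1|s1] := ltP s 1.
    have [t1|t1] := ltP t 1; first by rewrite hat_at ?s0 ?t0// st.
    have {t1 s1} [-> ->] : s = 0 /\ t = 1 by lra.
    have -> : b%:~R + 1 = (b + 1)%:~R + 0 :> R by rewrite rmorphD /= addr0.
    rewrite hat_at ?lexx ?ltr01// addr0 ler01 /interp !mul0r !mul1r !addr0.
    by rewrite [RHS]addrC subrK; congr (hat0 w _); congr pair; rewrite /=; ring.
  have {s1} [-> ->] : s = 1 /\ t = 0 by lra.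
  have -> : a%:~R + 1 = (a + 1)%:~R + 0 :> R by rewrite rmorphD /= addr0.
  rewrite hat_at ?lexx ?ltr01// addr0 ler01 /interp !mul0r !mul1r !addr0.
  by rewrite [RHS]addrC subrK; congr (hat0 w _); congr pair; rewrite /=; ring.
have -> : emb (a, b) + s%:C%C * emb (mul_tau one2) + t%:C%C * emb (mul_tau (mul_tau one2))
     = (a%:~R - t)%:C%C + (b%:~R + (s + t))%:C%C * tau.
  rewrite !emb_mul_tau /emb /= !RC !rmorphB !rmorphD /=.
  rewrite mul0r addr0 mulr1 -[tau * tau]/(tau ^+ 2) tauE; ring.
have [->|t_neq0] := eqVneq t 0.
  rewrite subr0 !addr0.
  have [s1|s1] := ltP s 1.
    have -> : a%:~R = a%:~R + 0 :> R by rewrite addr0.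
    by rewrite hat_at ?s0 ?lexx ?ltr01// add0r ltW// /interp !mul0r !addr0.
  have {s1} -> : s = 1 by lra.
  have -> : a%:~R = a%:~R + 0 :> R by rewrite addr0.
  have -> : b%:~R + 1 = (b + 1)%:~R + 0 :> R by rewrite rmorphD /= addr0.
  rewrite hat_at ?lexx ?ltr01// addr0 ler01 /interp !mul0r !mul1r !addr0.
  by rewrite [RHS]addrC subrK; congr (hat0 w _); congr pair; rewrite /=; ring.
have tpos : 0 < t by rewrite lt0r t_neq0.
have -> : a%:~R - t = (a - 1)%:~R + (1 - t) :> R by rewrite rmorphB /=; ring.
have [st1|st1] := ltP (s + t) 1.
  rewrite hat_at ?subr_ge0; [|lra|lra].
  have -> : (a - 1, b) + one2 = (a, b) by congr pair; rewrite /=; ring.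
  case: ifP => [s1|_]; last by congr interp; ring.
  have -> : s = 0 by lra.
  rewrite /interp.
  have -> : (a - 1, b) + one2 = (a, b) by congr pair; rewrite /=; ring.
  have -> : (a - 1, b) + mul_tau one2 = (a, b) + mul_tau (mul_tau one2).
    by congr pair; rewrite /=; ring.
  by rewrite !rmorphB /= rmorphD /=; ring.
have -> : s + t = 1 by lra.
have -> : s = 1 - t by lra.
have -> : b%:~R + 1 = (b + 1)%:~R + 0 :> R by rewrite rmorphD /= addr0.
rewrite hat_at; [|lra|lra].
rewrite ifT; last lra.
rewrite /interp.
have -> : (a - 1, b + 1) + one2 = (a, b) + mul_tau one2.
  by congr pair; rewrite /=; ring.
have -> : (a - 1, b + 1) = (a, b) + mul_tau (mul_tau one2).
  by congr pair; rewrite /=; ring.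
by rewrite !rmorphB /=; ring.
Qed.

End facts.

Section power_measure.
Context {d} {T : measurableType d} {R : realType}.
Variable mu : set T -> \bar R.
Local Open Scope ereal_scope.

Fixpoint power_measure (n : nat) : set (n.-tuple T) -> \bar R :=
  match n with
  | 0 => \d_([tuple] : 0.-tuple T)
  | n'.+1 => pushforward (mu \x @power_measure n')
               (fun p => [the n'.+1.-tuple T of p.1 :: p.2])
  end.

End power_measure.
Arguments power_measure {d T R} mu n.

Section power_measure_theory.
Context {d} {T : measurableType d} {R : realType}.
Variable mu : {sigma_finite_measure set T -> \bar R}.
Local Open Scope ereal_scope.

Let prod_sigma_finite d' (T' : measurableType d')
    (nu : {sigma_finite_measure set T' -> \bar R}) :
  sigma_finite setT (mu \x nu).
Proof.
have /sigma_finiteP[F [TF ndF Foo]] := sigma_finiteT mu.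
have /sigma_finiteP[G [TG ndG Goo]] := sigma_finiteT nu.
exists (fun n => F n `*` G n).
  rewrite -setXTT TF TG predeqE => -[x y]; split.
    move=> [/= [n _ Fnx] [k _ Gky]]; exists (maxn n k) => //; split.
    - by move: x Fnx; exact/subsetPset/ndF/leq_maxl.
    - by move: y Gky; exact/subsetPset/ndG/leq_maxr.
  by move=> [n _ []/= ? ?]; split; exists n.
move=> k; have [? ?] := Foo k; have [? ?] := Goo k.
split; first exact: measurableX.
by rewrite product_measure1E// lte_mul_pinfty// ge0_fin_numE.
Qed.

Let tcons n (p : T * n.-tuple T) := [the n.+1.-tuple T of p.1 :: p.2].

Let measurable_tcons n : measurable_fun [set: T * n.-tuple T] (@tcons n).
Proof. exact: measurable_cons. Qed.

Let power_measure_ex n :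
  exists nu : {sigma_finite_measure set (n.-tuple T) -> \bar R},
    power_measure mu n = nu.
Proof.
elim: n => [|n [nu IH]]; first by exists (\d_([tuple] : 0.-tuple T)).
rewrite /= IH.
pose g := fun t : n.+1.-tuple T => (thead t, [tuple of behead t]).
have mg : measurable_fun setT g.
  apply/measurable_fun_pairP; split; first exact: measurable_tnth.
  exact: measurable_behead.
have gK : cancel (@tcons n) g.
  by move=> [x t]; rewrite /g /tcons /=; congr pair; exact/val_inj.
pose nu1 := measure_function_pushforward__canonical__measure_function_Measure
  (mu \x nu) (@measurable_tcons n).
have sf : sigma_finite setT nu1.
  have [F TF mF] := prod_sigma_finite nu.
  exists (fun k => g @^-1` F k).
    by rewrite -preimage_bigcup -TF preimage_setT.
  move=> k; split.
    by rewrite -[X in measurable X]setTI; apply: mg => //; exact: (mF k).1.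
  rewrite /= /pushforward -comp_preimage (_ : g \o _ = id) ?(mF k).2//.
  by apply/funext => p; exact: gK.
pose nu2 := HB.pack_for {sigma_finite_measure set (n.+1.-tuple T) -> \bar R}
  (nu1 : set _ -> \bar R) (Measure.on nu1)
  (Measure_isSigmaFinite.Build _ _ _ (nu1 : set _ -> \bar R) sf).
by exists nu2.
Qed.

Section instance.
Variable n : nat.

Let power_measure0 : power_measure mu n set0 = 0.
Proof. by have [nu ->] := power_measure_ex n; exact: measure0. Qed.

Let power_measure_ge0 A : 0 <= power_measure mu n A.
Proof. by have [nu ->] := power_measure_ex n; exact: measure_ge0. Qed.

Let power_measure_sigma_additive : semi_sigma_additive (power_measure mu n).
Proof.
by have [nu ->] := power_measure_ex n; exact: measure_semi_sigma_additive.
Qed.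

HB.instance Definition _ := isMeasure.Build _ _ _ (power_measure mu n)
  power_measure0 power_measure_ge0 power_measure_sigma_additive.

Let power_measure_sigma_finite : sigma_finite setT (power_measure mu n).
Proof. by have [nu ->] := power_measure_ex n; exact: sigma_finiteT. Qed.

HB.instance Definition _ := Measure_isSigmaFinite.Build _ _ _
  (power_measure mu n) power_measure_sigma_finite.

End instance.

Lemma power_measure_box n (A : 'I_n -> set T) :
  (forall i, measurable (A i)) ->
  power_measure mu n [set t | forall i, A i (tnth t i)] = \prod_(i < n) mu (A i).
Proof.
elim: n A => [|n IH] A mA.
  rewrite big_ord0 /= diracE mem_set//; by case.
rewrite big_ord_recl -IH; last by move=> i; exact: mA.
have mB : measurable [set t : n.-tuple T | forall i, A (lift ord0 i) (tnth t i)].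
  rewrite (_ : [set _ | _] =
      \bigcap_(i in [set: 'I_n]) ((fun t => tnth t i) @^-1` A (lift ord0 i))).
    apply: fin_bigcap_measurable; first exact: finite_finset.
    move=> i _; rewrite -[X in measurable X]setTI.
    exact: measurable_tnth.
  by apply/seteqP; split=> t /= tA i => [_|]; exact: tA.
rewrite -product_measure1E// /= /pushforward; congr (_ _).
apply/seteqP; split=> -[x t] /=.
  move=> tA; split; first exact: (tA ord0).
  by move=> i; have := tA (lift ord0 i); rewrite tnthS.
move=> [xA tA] i; case: (unliftP ord0 i) => [j ->|-> //].
by rewrite tnthS.
Qed.

End power_measure_theory.

Section gibbs.
Context {R : realType}.
Local Open Scope ereal_scope.
Variables (V : R -> R) (alpha l beta m : R) (N : nat).

(* (C u {hole}) ^ I_N, the restrictions of the configurations to I_N. *)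
Local Notation restr := ((size (IN N)).-tuple (@spin R)).

Definition mu_prod : set restr -> \bar R :=
  power_measure spin_measure (size (IN N)).

Definition allowed : set restr := extend l N @^-1` Omega alpha l N.

Definition weight (t : restr) : R :=
  expR (- (beta * hamiltonian V m N (extend l N t))).

Definition partition_function : \bar R :=
  \int[mu_prod]_(t in allowed) (weight t)%:E.

Definition gibbs : set restr -> \bar R := fun A =>
  ((fine partition_function)^-1)%:E *
  \int[mu_prod]_(t in A `&` allowed) (weight t)%:E.

Definition gibbs_expectation (X : config -> R) : \bar R :=
  \int[gibbs]_(t in allowed) (X (extend l N t))%:E.

End gibbs.

Arguments gibbs_expectation {R} V alpha l beta m N X.

(* Main.v *)
Require Import Defs.
From HB Require Import structures.
From mathcomp Require Import all_boot all_order all_algebra.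
From mathcomp Require Import all_classical all_reals all_analysis.
From mathcomp Require Import complex ring lra zify measurable_realfun.

Set Implicit Arguments.
Unset Strict Implicit.
Unset Printing Implicit Defensive.

Import Order.TTheory GRing.Theory Num.Theory.
Import numFieldNormedType.Exports.

Local Open Scope classical_set_scope.
Local Open Scope ring_scope.

(* For a configuration w let u x = hat w x - l x, a periodic function, and let S be
   the sum over I_N and the six directions z of |u (x + z) - u x| ^ 2. Summing over
   the torus makes cross terms vanish, and gives the discrete rigidity identity
   2/3 sum |d_(tau z) u - tau d_z u| ^ 2 = S; the left hand side measures how much
   the triangles of w deviate from equilateral ones, hence is bounded by the sum of
   (|w x - w y| - l) ^ 2 over the edges, plus a constant per hole. By convexity of V,
   and since a large m makes every hole pay for its neighbourhood, the excess energy
   K = H - 3 N^2 V(l) is at least c S. All this needs no local control, as S is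
   translation invariant: the expectation of |u (x + z) - u x| ^ 2 is at most that
   of S / N^2, hence of K / (c N^2).
   Finally K e^(-beta K) <= a N^2 e^(-beta K) + e^(-beta a N^2 / 2) / beta. The first
   term contributes a to the average of K / N^2. In the second one the volume of
   the regular configurations modulo translations is at most C^(N^2), while
   configurations within 1 / beta of the standard one give
   Z >= e^(-3 beta N^2 V(l)) (c / beta ^ 2)^(N^2); so e^(-beta a N^2 / 2) wins,
   uniformly in N, as soon as beta is large. *)

(** * Sums over the torus and discrete rigidity *)

(** Two obstacles shape the argument. As l need not be 1, the term V'(l) (r - l) survives in the
    expansion of V at l and is only of first order in the strain. It is traded for V'(l) (r^2 - l^2)
    / (2 l) at the cost of a quadratic error. The sum of r^2 - l^2 over the edges of the
    interpolated configuration is exactly S, so this term is harmless once V'(l) is small compared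
    with the convexity constant; this is what fixes the size of alpha. The other obstacle is
    measurability: bijectivity of the interpolation is not visibly a measurable condition. The Gibbs
    object is therefore treated as a set function, and its integral of a nonnegative function as a
    supremum over simple functions. Each of these lives on a measurable set of allowed
    configurations, which is closed up under lattice translations before averaging. Since
    translations leave the chosen system of representatives, invariance is obtained by unfolding one
    fundamental domain into another. Bijectivity has to be proved from scratch only near the
    standard configuration, where it follows from a contraction argument. *)

Lemma nbrsE : nbrs = [:: (1, 0); (0, 1); (-1, 1); (-1, 0); (0, -1); (1, -1)].
Proof. by []. Qed.

Lemma sum_nbrs (V : nmodType) (F : A2 -> V) :
  \sum_(z <- nbrs) F z =
  F (1, 0) + (F (0, 1) + (F (-1, 1) + (F (-1, 0) + (F (0, -1) + F (1, -1))))).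
Proof. by rewrite nbrsE !big_cons big_nil addr0. Qed.

Lemma sum_nbrs_tau (V : nmodType) (F : A2 -> V) :
  \sum_(z <- nbrs) F (mul_tau z) = \sum_(z <- nbrs) F z.
Proof. by rewrite !sum_nbrs /mul_tau /= !addrA addrC !addrA. Qed.

Lemma sum_nbrsN (V : nmodType) (F : A2 -> V) :
  \sum_(z <- nbrs) F (- z) = \sum_(z <- nbrs) F z.
Proof.
have E (z : A2) : - z = mul_tau (mul_tau (mul_tau z)).
  by case: z => a b; congr pair => /=; lia.
rewrite -(sum_nbrs_tau F) -(sum_nbrs_tau (F \o mul_tau)).
rewrite -(sum_nbrs_tau (F \o mul_tau \o mul_tau)) /=.
by apply: eq_bigr => z _; rewrite E.
Qed.

Lemma nbrs_tau z : (mul_tau z \in nbrs) = (z \in nbrs).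
Proof.
rewrite nbrsE !inE; case: z => a b; rewrite /mul_tau /= !xpair_eqE.
by apply/idP/idP; lia.
Qed.

Lemma nbrsN z : (- z \in nbrs) = (z \in nbrs).
Proof.
rewrite nbrsE !inE; case: z => a b; rewrite !xpair_eqE /=.
by apply/idP/idP; lia.
Qed.

Definition lat_periodic (T : Type) N (f : A2 -> T) := forall x z, f (x + z *+ N) = f x.

Lemma red_periodic N : lat_periodic N (red N).
Proof.
have MnE (a b : int) : (a, b) *+ N = (a * N%:Z, b * N%:Z) :> A2.
  elim: N => [|n IH]; first by rewrite !mulr0.
  by rewrite mulrS IH; congr pair => /=; lia.
move=> [a b] [c d]; rewrite MnE /red /=.
have -> : a + c * N%:Z + (b + d * N%:Z) = (c + d) * N%:Z + (a + b) by ring.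
by rewrite [b + _]addrC !modzMDl.
Qed.

Lemma sum_IN_shift (V : nmodType) N (f : A2 -> V) v : (0 < N)%N ->
  lat_periodic N f -> \sum_(x <- IN N) f (x + v) = \sum_(x <- IN N) f x.
Proof.
move=> N0 fP.
have fr x : f (red N x) = f x by rewrite [in RHS](red_quo N x) fP.
under eq_bigr do rewrite -fr.
rewrite -(big_map (fun x => red N (x + v)) xpredT f).
apply: perm_big.
have inj : {in IN N &, injective (fun x => red N (x + v))}.
  move=> x y xN yN /= E.
  have := red_quo N (x + v); rewrite E => Ex; have Ey := red_quo N (y + v).
  have zE (a b r : A2) : x + v = r + a -> y + v = r + b -> x = y + (a - b).
    move=> xr yr; have -> : x = r + a - v by rewrite -xr addrK.
    have -> : y = r + b - v by rewrite -yr addrK.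
    by rewrite -!addrA; congr (_ + _); rewrite [RHS]addrC -!addrA addNr addr0 addrC.
  have xE : x = y + (quo N (x + v) - quo N (y + v)) *+ N.
    by rewrite mulrnBl; exact: zE Ex Ey.
  by rewrite -[LHS](redK xN).1 xE red_periodic (redK yN).1.
have uq : uniq (map (fun x => red N (x + v)) (IN N)).
  by rewrite map_inj_in_uniq// uniq_IN.
apply: uniq_perm => //; first exact: uniq_IN.
have sb : {subset map (fun x => red N (x + v)) (IN N) <= IN N}.
  by move=> _ /mapP[x _ ->]; exact: red_IN.
by have [] := uniq_min_size uq sb; rewrite ?size_map.
Qed.

Lemma size_IN N : size (IN N) = (N * N)%N.
Proof. by rewrite size_allpairs !size_iota. Qed.

(** The shift may depend on the direction: after exchanging the sums, each direction is summed over
    the torus separately. *)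
Lemma sum_IN_nbrs_shift (V : nmodType) N (f : A2 -> A2 -> V) g : (0 < N)%N ->
  (forall z, lat_periodic N (f ^~ z)) ->
  \sum_(x <- IN N) \sum_(z <- nbrs) f (x + g z) z =
  \sum_(x <- IN N) \sum_(z <- nbrs) f x z.
Proof.
move=> N0 fP; rewrite exchange_big [RHS]exchange_big.
by apply: eq_bigr => z _; exact: (sum_IN_shift (g z) N0 (fP z)).
Qed.

Section plane.
Context {R : realType}.
Local Notation C := R[i].
Implicit Types (p q : C) (u : A2 -> C).

Definition sqn (z : C) : R := complex.Re z ^+ 2 + complex.Im z ^+ 2.

Definition cross (z w : C) : R :=
  complex.Re z * complex.Im w - complex.Im z * complex.Re w.

Lemma sqn_ge0 (z : C) : 0 <= sqn z.
Proof. by rewrite addr_ge0 ?sqr_ge0. Qed.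

Lemma distE (z w : C) : dist z w = Num.sqrt (sqn (z - w)).
Proof. by rewrite /dist; case: (z - w). Qed.

Lemma dist_ge0 (z w : C) : 0 <= dist z w.
Proof. by rewrite distE sqrtr_ge0. Qed.

Lemma dist_sqr (z w : C) : dist z w ^+ 2 = sqn (z - w).
Proof. by rewrite distE sqr_sqrtr// sqn_ge0. Qed.

Lemma distC (z w : C) : dist z w = dist w z.
Proof. by rewrite !distE; congr Num.sqrt; case: z w => a b [c d]; rewrite /sqn /=; ring. Qed.

Lemma sinpi3_sqr : sin (pi / 3) ^+ 2 = 3 / 4 :> R.
Proof. by have := cos2Dsin2 (pi / 3 : R); rewrite cos_pi3; lra. Qed.

Lemma tau_mulE (z : C) : tau * z =
  ((complex.Re z / 2 - sin (pi / 3) * complex.Im z) +i*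
   (complex.Im z / 2 + sin (pi / 3) * complex.Re z))%C.
Proof. by case: z => a b; rewrite /tau /= cos_pi3; congr (_ +i* _)%C; field. Qed.

Lemma sqn_tau (z : C) : sqn (tau * z) = sqn z.
Proof.
rewrite tau_mulE; case: z => a b; rewrite /sqn /=.
have := sinpi3_sqr; set s := sin _ => s2.
have -> : (a / 2 - s * b) ^+ 2 + (b / 2 + s * a) ^+ 2 = (1 / 4 + s ^+ 2) * (a ^+ 2 + b ^+ 2) by field.
by rewrite s2; field.
Qed.

(** Half the Weitzenboeck deficit of the triangle 0, p, q: half the sum of the squared sides minus 2
    sqrt 3 times the signed area, as [cross q p] is minus twice that area. *)
Lemma sqn_conformal p q : sqn (q - tau * p) =
  2^-1 * (sqn p + sqn q + sqn (q - p)) + 2 * sin (pi / 3) * cross q p.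
Proof.
rewrite tau_mulE; case: p q => a b [c d]; rewrite /sqn /cross /=.
have := sinpi3_sqr; set s := sin _ => s2.
rewrite (_ : _ + _ = c ^+ 2 + d ^+ 2 + (1 / 4 + s ^+ 2) * (a ^+ 2 + b ^+ 2)
   - c * a - d * b + 2 * s * (c * b - d * a)); last by field.
by rewrite s2; field.
Qed.

Section rigidity.
Variables (N : nat) (u : A2 -> C).
Hypotheses (N0 : (0 < N)%N) (uP : lat_periodic N u).

Let shiftP (z : A2) : lat_periodic N (fun x => u (x + z)).
Proof. by move=> x y; rewrite addrAC uP. Qed.

(* cross is antisymmetric and every edge is counted in both directions *)
Lemma sum_cross : \sum_(x <- IN N) \sum_(z <- nbrs) cross (u x) (u (x + z)) = 0.
Proof.
set T := LHS; suff : T = - T by lra.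
rewrite {1}/T -(@sum_IN_nbrs_shift _ N _ -%R)//; last first.
  by move=> z x y; rewrite uP shiftP.
rewrite {1}/T -sumrN; apply: eq_bigr => x _; rewrite -sumrN -sum_nbrsN.
apply: eq_bigr => z _; rewrite opprK addrK; case: (u _) (u _) => a b [c d].
by rewrite /cross /=; ring.
Qed.

(** By [sqn_conformal] the left side consists of squared sides and signed areas. Rotating the
    direction lets every edge play each of the three roles in a triangle, whence the factor 3 / 2.
    The signed area is a null Lagrangian: it is a sum of terms [cross] along the boundary, and
    [sum_cross] removes it. *)
Lemma rigidity :
  \sum_(x <- IN N) \sum_(z <- nbrs)
    sqn (u (x + mul_tau z) - u x - tau * (u (x + z) - u x)) =
  3 / 2 * \sum_(x <- IN N) \sum_(z <- nbrs) sqn (u (x + z) - u x).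
Proof.
set S := (X in _ = _ * X).
pose f1 x z := sqn (u (x + z) - u x).
pose f2 x z := cross (u x) (u (x + z)).
have f1P z : lat_periodic N (f1 ^~ z) by move=> x y; rewrite /f1 uP shiftP.
have f2P z : lat_periodic N (f2 ^~ z) by move=> x y; rewrite /f2 uP shiftP.
(* The area of the image triangle is written as a boundary sum over its three edges, the third one
   running from x + z in the direction tau^2 z. *)
have E x z : sqn (u (x + mul_tau z) - u x - tau * (u (x + z) - u x)) =
    2^-1 * (f1 x z + f1 x (mul_tau z) + f1 (x + z) (mul_tau (mul_tau z)))
    + 2 * sin (pi / 3) *
      (f2 x (mul_tau z) - f2 x z - f2 (x + z) (mul_tau (mul_tau z))).
  rewrite sqn_conformal /f1 /f2.
  have -> : x + z + mul_tau (mul_tau z) = x + mul_tau z.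
    by case: x z => a b [c d]; rewrite /mul_tau; congr pair => /=; ring.
  congr (_ * (_ + sqn _) + _ * _); first by ring.
  by case: (u x) (u (x + z)) (u (x + mul_tau z)) => a b [c d] [e f]; rewrite /cross /=; ring.
under eq_bigr do under eq_bigr do rewrite E.
have D (f : A2 -> A2 -> R) : (forall z, lat_periodic N (f ^~ z)) ->
  let T := \sum_(x <- IN N) \sum_(z <- nbrs) f x z in
  \sum_(x <- IN N) \sum_(z <- nbrs) f x (mul_tau z) = T /\
  \sum_(x <- IN N) \sum_(z <- nbrs) f (x + z) (mul_tau (mul_tau z)) = T.
  move=> fP T; split; first by apply: eq_bigr => x _; exact: sum_nbrs_tau.
  rewrite (@sum_IN_nbrs_shift _ N (fun x z => f x (mul_tau (mul_tau z))) id N0).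
    apply: eq_bigr => x _; rewrite (sum_nbrs_tau (fun z => f x (mul_tau z))).
    exact: sum_nbrs_tau.
  by move=> z x y; rewrite fP.
have [D11 D12] := D _ f1P; have [D21 D22] := D _ f2P.
have split6 (h k : R) (g1 g2 g3 g4 g5 g6 : A2 -> A2 -> R) :
    let Sm (g : A2 -> A2 -> R) := \sum_(x <- IN N) \sum_(z <- nbrs) g x z in
    \sum_(x <- IN N) \sum_(z <- nbrs)
      (h * (g1 x z + g2 x z + g3 x z) + k * (g4 x z - g5 x z - g6 x z)) =
    h * (Sm g1 + Sm g2 + Sm g3) + k * (Sm g4 - Sm g5 - Sm g6).
  move=> Sm; under eq_bigr do rewrite big_split /= -!mulr_sumr !sumrB !big_split /=.
  rewrite big_split /= -!mulr_sumr; congr (_ * _ + _ * _).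
    by rewrite !big_split.
  by rewrite !sumrB.
rewrite (split6 _ _ f1 _ _ _ f2 _) D11 D12 D21 D22.
by rewrite sum_cross -/S; field.
Qed.

Lemma sum_diff0 (e : A2 -> C) :
  \sum_(x <- IN N) \sum_(z <- nbrs) e z * (u (x + z) - u x) = 0.
Proof.
rewrite exchange_big big1// => z _; rewrite -mulr_sumr sumrB.
by rewrite (sum_IN_shift z N0 uP) subrr mulr0.
Qed.

End rigidity.
End plane.

(** * Energy of a configuration *)

(** Near 1, V'' stays above V''(1) / 2, which gives the quadratic lower bound with k = V''(1) / 4,
    while V'(1) = 0 makes V' as small as desired. The quantifiers put k before eta because eta is
    later chosen in terms of k. *)
Lemma potential_near1 (R : realType) (I : set R) (V : R -> R) : potential I V ->
  exists2 k : R, 0 < k & forall eta : R, 0 < eta -> exists2 a : R, 0 < a &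
    (forall r, `|r - 1| <= a -> I r) /\
    exists dV : R -> R, forall l r, `|l - 1| <= a -> `|r - 1| <= a ->
      [/\ `|dV l| <= eta, V l + dV l * (r - l) + k * (r - l) ^+ 2 <= V r &
          `|V r - V l| <= eta * `|r - l|].
Proof.
move=> [[oI iI I1] dV ddV cddV [V2 V1]].
pose k := V^`(2)%classic 1; have k0 : 0 < k by exact: V2.
exists (k / 4) => [|eta eta0]; first lra.
have nI : \forall x \near (1 : R), I x by exact: open_nbhs_nbhs.
have nV2 : \forall x \near (1 : R), k / 2 <= V^`(2)%classic x.
  have := cddV 1 I1 => /cvgr_dist_lt /(_ (k / 2)).
  have k20 : 0 < k / 2 by lra.
  move=> /(_ k20); apply: filterS => x /=; rewrite -[X in `|X - _|]/k; move: (_ x) => v.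
  by rewrite ltr_norml => /andP[_ ?]; lra.
clearbody k.
have nV1 : \forall x \near (1 : R), `|V^`()%classic x| <= eta.
  have : {for 1, continuous V^`()%classic}.
    exact/differentiable_continuous/derivable1_diffP/ddV.
  move=> /cvgr_dist_lt /(_ _ eta0); apply: filterS => x /=.
  by rewrite V1 sub0r normrN => /ltW.
have [a /= a0 aP] := filterI nI (filterI nV2 nV1).
exists (a / 2); first lra.
have near1 r : `|r - 1| <= a / 2 -> [/\ I r, k / 2 <= V^`(2)%classic r & `|V^`()%classic r| <= eta].
  move=> ra; have ra' : ball_ Num.norm 1 a r by rewrite /ball_ /= distrC; lra.
  by have [? []] := aP r ra'.
split=> [r /near1 []//|].
exists V^`()%classic => l r la ra.
have mid x : x \in `[Num.min l r, Num.max l r] -> `|x - 1| <= a / 2.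
  rewrite in_itv /= ge_min le_max; move: la ra; rewrite !ler_norml.
  move=> /andP[l1 l2] /andP[r1 r2] /andP[x1 x2]; apply/andP.
  by split; case/orP: x1 => x1; case/orP: x2 => x2; lra.
have isD x : `|x - 1| <= a / 2 -> is_derive x 1 V (V^`()%classic x).
  move=> /near1[Ix _ _]; rewrite derive1E; apply: DeriveDef => //; exact: dV.
have isDD x : `|x - 1| <= a / 2 -> is_derive x 1 V^`()%classic (V^`(2)%classic x).
  move=> /near1[Ix _ _]; have -> : V^`(2)%classic x = 'D_1 V^`()%classic x by rewrite -derive1E.
  by apply: DeriveDef => //; exact: ddV.
have isC (f df : R -> R) x y : x <= y -> `|x - 1| <= a / 2 -> `|y - 1| <= a / 2 ->
    (forall z, `|z - 1| <= a / 2 -> is_derive z 1 f (df z)) ->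
    exists2 z, x <= z <= y & f y - f x = df z * (y - x).
  move=> xy xa ya fD.
  have za z : z \in `[x, y] -> `|z - 1| <= a / 2.
    rewrite in_itv /= => /andP[xz zy]; move: xa ya; rewrite !ler_norml.
    by move=> /andP[? _] /andP[_ ?]; apply/andP; split; lra.
  have [z||z zxy ->] := @MVT_segment _ f df x y xy.
  - by move=> zxy; apply/fD/za/subset_itv_oo_cc.
  - apply: derivable_within_continuous => z /za za'.
    by have [] := fD _ za'.
  - by exists z => //; rewrite in_itv in zxy.
split; first by have [] := near1 l la.
- have [lr|rl] := leP l r.
  (* Here [k] still denotes V''(1); the exported constant is [k / 4]. As V'' is at least k / 2 on
     the segment, the mean value theorem for V' makes [dg] nonnegative to the right of l, and the
     one for [g] concludes. The next branch is the mirror case. *)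
  + pose g x := V x - V^`()%classic l * x - (k / 4) * (x - l) ^+ 2.
    pose dg x := V^`()%classic x - V^`()%classic l - (k / 2) * (x - l).
    have gD z : `|z - 1| <= a / 2 -> is_derive z 1 g (dg z).
      by move=> /isD Dz; apply: is_derive_eq; rewrite /dg /GRing.scale /=; field.
    have [z /andP[lz zr]] := isC g dg l r lr la ra gD.
    have za : `|z - 1| <= a / 2 by apply: mid; rewrite in_itv /= ge_min lz le_max zr orbT.
    have [y /andP[ly yz] Ey] := isC _ _ l z lz la za isDD.
    have ya : `|y - 1| <= a / 2 by apply: mid; rewrite in_itv /= ge_min ly le_max (le_trans yz zr) orbT.
    have [_ y2 _] := near1 y ya.
    have : 0 <= dg z by rewrite /dg Ey; nra.
    by rewrite /g => dg0 E; nra.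
  + pose g x := V x - V^`()%classic l * x - (k / 4) * (x - l) ^+ 2.
    pose dg x := V^`()%classic x - V^`()%classic l - (k / 2) * (x - l).
    have gD z : `|z - 1| <= a / 2 -> is_derive z 1 g (dg z).
      by move=> /isD Dz; apply: is_derive_eq; rewrite /dg /GRing.scale /=; field.
    have [z /andP[lz zr]] := isC g dg r l (ltW rl) ra la gD.
    have za : `|z - 1| <= a / 2 by apply: mid; rewrite in_itv /= ge_min lz orbT le_max zr.
    have [y /andP[ly yz] Ey] := isC _ _ z l zr za la isDD.
    have ya : `|y - 1| <= a / 2 by apply: mid; rewrite in_itv /= ge_min (le_trans lz ly) orbT le_max yz.
    have [_ y2 _] := near1 y ya.
    have : dg z <= 0 by rewrite /dg; nra.
    by rewrite /g => dg0 E; nra.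
- wlog lr : l r la ra mid / l <= r.
    move=> H; have [lr|/ltW rl] := leP l r; first exact: H.
    rewrite distrC [`|r - l|]distrC; apply: H => // x.
    by rewrite minC maxC; exact: mid.
  have [z /andP[lz zr] ->] := isC _ _ l r lr la ra isD.
  have za : `|z - 1| <= a / 2 by apply: mid; rewrite in_itv /= ge_min lz le_max zr orbT.
  have [_ _ z1] := near1 z za.
  by rewrite normrM ler_wpM2r.
Qed.

(** * The metric of the triangular lattice *)

Section lattice_geometry.
Context {R : realType}.
Local Notation C := R[i].

Lemma sqn_emb (x : A2) : sqn (emb x : C) = (x.1 ^+ 2 + x.1 * x.2 + x.2 ^+ 2)%:~R.
Proof.
case: x => a b; rewrite /sqn /emb.
have RC (k : int) : k%:~R = (k%:~R : R)%:C%C :> C by rewrite (rmorph_int (real_complex R)).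
rewrite !RC /tau cos_pi3 /= !rmorphD /= !rmorphXn /= rmorphM /=.
have := @sinpi3_sqr R; set s := sin _ => s2.
move: (a%:~R : R) (b%:~R : R) => {}a {}b.
rewrite (_ : _ + _ = a ^+ 2 + a * b + (1 / 4 + s ^+ 2) * b ^+ 2); last by field.
by rewrite s2; field.
Qed.

Lemma embB (x y : A2) : emb (x - y) = emb x - emb y :> C.
Proof. by apply/eqP; rewrite eq_sym subr_eq -embD subrK. Qed.

Lemma adjE (x y : A2) : adj (R := R) x y <-> y - x \in nbrs.
Proof.
rewrite /adj distE -embB.
have -> : sqn (emb (x - y) : C) = sqn (emb (y - x) : C).
  by rewrite !sqn_emb; congr _%:~R; case: x y => a b [c d] /=; ring.
have mem (z : A2) : (z \in nbrs) = (z.1 ^+ 2 + z.1 * z.2 + z.2 ^+ 2 == 1).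
  case: z => a b; rewrite nbrsE !inE !xpair_eqE /=.
  apply/idP/eqP => [|E].
    by do ![case/orP] => /andP[/eqP-> /eqP->]; rewrite /=; ring.
  (* As 4 (a^2 + a b + b^2) = 3 a^2 + (a + 2 b)^2, and likewise for b, only finitely many pairs
     remain. *)
  have : 3 * a ^+ 2 <= 4 by nia.
  have : 3 * b ^+ 2 <= 4 by nia.
  move=> b4 a4; have a1 : -1 <= a <= 1 by nia.
  have b1 : -1 <= b <= 1 by nia.
  have : a = -1 \/ a = 0 \/ a = 1 by lia.
  have : b = -1 \/ b = 0 \/ b = 1 by lia.
  by move=> [|[|]] bE [|[|]] aE; subst a b; move: E; rewrite /=; lia.
rewrite mem sqn_emb; split=> [/(congr1 (fun r => r ^+ 2))|/eqP->].
  rewrite sqr_sqrtr; last by rewrite -sqn_emb sqn_ge0.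
  by rewrite expr1n => /eqP; rewrite -[1]/(1%:~R) eqr_int.
by rewrite sqrtr1.
Qed.

Lemma adj_nbrs (x z : A2) : z \in nbrs -> adj (R := R) x (x + z).
Proof. by move=> zn; apply/adjE; rewrite addrAC subrr add0r. Qed.

Lemma sum_adj (F : A2 -> R) (x : A2) :
  \sum_(y \in [set y | adj (R := R) x y]) F y = \sum_(z <- nbrs) F (x + z).
Proof.
have U : uniq [seq x + z | z <- nbrs] by rewrite map_inj_uniq//; exact: addrI.
rewrite -(big_map (fun z => x + z) xpredT F) (fsbig_seq _ _ U).
apply: eq_fsbigl; apply/seteqP; split=> [y /adjE yx|y /mapP[z zn ->]].
  suff : y \in [seq x + z | z <- nbrs] by [].
  by apply/mapP; exists (y - x) => //; rewrite addrC subrK.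
exact: adj_nbrs.
Qed.

End lattice_geometry.

(** * Deviation of a triangle from an equilateral one *)

Section triangles.
Context {R : realType}.
Local Notation C := R[i].
Implicit Types p q : C.

Lemma cross_gt0 p q : 0 < complex.Im (q / p) -> 0 < cross p q.
Proof.
case: p q => a b [c d] /=; rewrite /cross /= => H.
have E : c * (- b / (a ^+ 2 + b ^+ 2)) + d * (a / (a ^+ 2 + b ^+ 2)) =
  (a * d - b * c) / (a ^+ 2 + b ^+ 2) by rewrite !mulrA -mulrDl; congr (_ / _); ring.
have D0 : 0 <= (a ^+ 2 + b ^+ 2)^-1 by rewrite invr_ge0 addr_ge0 ?sqr_ge0.
rewrite ltNge; apply: contraTN H => H; rewrite -leNgt.
rewrite (_ : _ + _ = (a * d - b * c) / (a ^+ 2 + b ^+ 2)); last by rewrite -E; ring.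
by rewrite mulr_le0_ge0.
Qed.

Lemma crossC p q : cross q p = - cross p q.
Proof. by case: p q => a b [c d]; rewrite /cross /=; ring. Qed.

(* Heron's formula. *)
Lemma cross_sqr p q : 4 * cross p q ^+ 2 =
  2 * (sqn p * sqn q + sqn q * sqn (q - p) + sqn (q - p) * sqn p)
  - sqn p ^+ 2 - sqn q ^+ 2 - sqn (q - p) ^+ 2.
Proof. by case: p q => a b [c d]; rewrite /sqn /cross /=; ring. Qed.

(** With A half the sum of the squared sides and t twice the area, the defect is X = A - 2 s t.
    Heron's formula turns X (A + 2 s t) into half the sum of the squared differences of squared
    sides. Positive orientation makes the second factor at least A >= 3 / 8, and each squared
    difference is at most 32 times the two squared strains involved, so X <= 4 / 3 times 64 times
    the sum; 86 rounds up 256 / 3. *)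
Lemma triangle_defect (l rp rq rr : R) p q :
  0 < cross p q -> 0 < l ->
  rp ^+ 2 = sqn p -> rq ^+ 2 = sqn q -> rr ^+ 2 = sqn (q - p) ->
  1 / 2 <= rp <= 2 -> 1 / 2 <= rq <= 2 -> 1 / 2 <= rr <= 2 ->
  sqn (q - tau * p) <=
    86 * ((rp - l) ^+ 2 + (rq - l) ^+ 2 + (rr - l) ^+ 2).
Proof.
move=> t0 l0 pE qE rE /andP[p1 p3] /andP[q1 q3] /andP[r1 r3].
set X := sqn _; have X0 : 0 <= X by exact: sqn_ge0.
pose A := 2^-1 * (rp ^+ 2 + rq ^+ 2 + rr ^+ 2).
have s0 := @sin_pi3_gt0 R; have s2 := @sinpi3_sqr R.
set s := sin _ in s0 s2; set t := cross p q in t0.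
have XE : X = A - 2 * s * t.
  rewrite /X sqn_conformal /A pE qE rE -/s; congr (_ + _).
  by rewrite crossC -/t mulrN.
pose Dp := (rp ^+ 2 - rq ^+ 2) ^+ 2 + (rq ^+ 2 - rr ^+ 2) ^+ 2 + (rr ^+ 2 - rp ^+ 2) ^+ 2.
have t2 : 4 * t ^+ 2 = 2 * (rp ^+ 2 * rq ^+ 2 + rq ^+ 2 * rr ^+ 2 + rr ^+ 2 * rp ^+ 2)
    - (rp ^+ 2) ^+ 2 - (rq ^+ 2) ^+ 2 - (rr ^+ 2) ^+ 2.
  by rewrite pE qE rE; exact: cross_sqr.
have E : X * (A + 2 * s * t) = Dp / 2.
  rewrite XE (_ : _ * _ = A ^+ 2 - s ^+ 2 * (4 * t ^+ 2)); last by ring.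
  by rewrite s2 t2 /A /Dp; field.
have A0 : 3 / 8 <= A by rewrite /A; nra.
have XA : X * A <= Dp / 2.
  rewrite -E ler_wpM2l// lerDl !mulr_ge0// ltW//.
have d2 (x y : R) : 1 / 2 <= x -> x <= 2 -> 1 / 2 <= y -> y <= 2 ->
    (x ^+ 2 - y ^+ 2) ^+ 2 <= 32 * ((x - l) ^+ 2 + (y - l) ^+ 2).
  move=> x1 x2 y1 y2.
  rewrite (_ : _ - _ = (x - y) * (x + y)); last by ring.
  rewrite exprMn.
  have h1 : (x + y) ^+ 2 <= 16 by nra.
  have h2 : (x - y) ^+ 2 <= 2 * ((x - l) ^+ 2 + (y - l) ^+ 2).
    by rewrite -subr_ge0 (_ : _ - _ = (x + y - 2 * l) ^+ 2) ?sqr_ge0//; ring.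
  have := sqr_ge0 (x - y); have := sqr_ge0 (x + y); nra.
have := d2 _ _ p1 p3 q1 q3; have := d2 _ _ q1 q3 r1 r3; have := d2 _ _ r1 r3 p1 p3.
rewrite -/(Dp); set P := (rp - l) ^+ 2; set Q := (rq - l) ^+ 2; set S := (rr - l) ^+ 2.
move=> h1 h2 h3; have DpE : Dp <= 64 * (P + Q + S) by rewrite /Dp; lra.
have : 3 / 8 * X <= Dp / 2 by rewrite (le_trans _ XA)// mulrC ler_wpM2l.
have := sqr_ge0 (rp - l); have := sqr_ge0 (rq - l); have := sqr_ge0 (rr - l).
rewrite -/P -/Q -/S; lra.
Qed.

Lemma sqn_sub_tau p q : sqn (q - tau * p) <= 2 * (sqn q + sqn p).
Proof.
rewrite -[sqn p]sqn_tau; move: (tau * p) => p'.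
case: p' q => a b [c d]; rewrite /sqn /=.
have := sqr_ge0 (c + a); have := sqr_ge0 (d + b); nra.
Qed.

Lemma sqn_dist_lt p q (r : R) : dist p q < r ->
  `|complex.Re p - complex.Re q| < r /\ `|complex.Im p - complex.Im q| < r.
Proof.
rewrite distE; case: p q => a b [c d]; rewrite /sqn /= => H.
have r0 : 0 < r by apply: le_lt_trans H; exact: sqrtr_ge0.
have {}H : (a - c) ^+ 2 + (b - d) ^+ 2 < r ^+ 2.
  by rewrite -[ltLHS]sqr_sqrtr ?addr_ge0 ?sqr_ge0// ltrXn2r// ?nnegrE ?sqrtr_ge0// ltW.
have a0 := sqr_ge0 (a - c); have b0 := sqr_ge0 (b - d).
by rewrite !ltr_norml; split; apply/andP; split; nra.
Qed.

End triangles.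

(** Five steps of length below 3 keep each of six points within 15 / 2 of their mean; 10 rounds this
    up. *)
Lemma ring_average {R : realType} (a0 a1 a2 a3 a4 a5 : R) :
  `|a0 - a1| < 3 -> `|a1 - a2| < 3 -> `|a2 - a3| < 3 -> `|a3 - a4| < 3 ->
  `|a4 - a5| < 3 ->
  let m := 6^-1 * (a0 + (a1 + (a2 + (a3 + (a4 + a5))))) in
  [/\ `|a0 - m| <= 10, `|a1 - m| <= 10, `|a2 - m| <= 10 &
      [/\ `|a3 - m| <= 10, `|a4 - m| <= 10 & `|a5 - m| <= 10]].
Proof.
rewrite !ltr_norml => /andP[? ?] /andP[? ?] /andP[? ?] /andP[? ?] /andP[? ?] m.
by rewrite !ler_norml /m; split; [..|split]; apply/andP; split; lra.
Qed.

Section regular.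
Context {R : realType}.
Local Notation C := R[i].
Variables (alpha l : R) (N : nat) (w : @config R).

(* Membership in [Omega] without the choice of a representative modulo N A_2
   and without bijectivity. *)
Definition regular : Prop :=
  [/\ Omega_star l N w,
    forall x y c d, adj (R := R) x y -> w x = Some c -> w y = Some d ->
      1 - alpha < dist c d < 1 + alpha,
    forall x y, w x = None -> w y = None ->
      x = y \/ 2 < dist (emb x : C) (emb y) &
    forall x z, z \in nbrs ->
      0 < complex.Im ((hat0 w (x + mul_tau z) - hat0 w x) /
                      (hat0 w (x + z) - hat0 w x))].

Definition displacement (x : A2) : C := hat0 w x - l%:C%C * emb x.

Definition hole (x : A2) : R := (w x == None)%:R.

Definition strain (x z : A2) : R :=
  if (w x, w (x + z)) is (Some c, Some d) then (dist c d - l) ^+ 2 else 0.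

Hypotheses (wr : regular) (a2 : alpha <= 1 / 2) (l0 : 0 < l).

Lemma hole_nbr x z : w x = None -> z \in nbrs -> w (x + z) <> None.
Proof.
move=> wx zn wxz; have [_ _ /(_ _ _ wx wxz)[xE|d2] _] := wr; last first.
  by move: d2; have := adj_nbrs (R := R) x zn; rewrite /adj => ->; lra.
move: zn; have -> : z = 0 by apply: (@addrI _ x); rewrite addr0 -xE.
by rewrite nbrsE.
Qed.

Lemma mul_tau2 (z : A2) : z + mul_tau (mul_tau z) = mul_tau z.
Proof. by case: z => a b; rewrite /mul_tau; congr pair => /=; ring. Qed.

Lemma hat0_occ x c : w x = Some c -> hat0 w x = c.
Proof. by rewrite /hat0 => ->. Qed.

Lemma hat0_edge_occ x y : adj (R := R) x y -> w x <> None -> w y <> None ->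
  1 / 2 <= dist (hat0 w x) (hat0 w y) <= 2.
Proof.
move=> xy; case wx : (w x) => [c|//] _; case wy : (w y) => [d|//] _.
rewrite (hat0_occ wx) (hat0_occ wy).
by have [_ /(_ _ _ _ _ xy wx wy)/andP[h1 h2] _ _] := wr; move: (dist _ _) h1 h2 => r h1 h2; move: a2 => a2'; apply/andP; split; lra.
Qed.

(** Holes are isolated, so successive neighbours of a hole are adjacent occupied sites, at distance
    at most 2; the hole is interpolated at their mean, and [ring_average] applies to each
    coordinate. *)
Lemma hat0_edge_hole x z : w x = None -> z \in nbrs ->
  `|complex.Re (hat0 w (x + z) - hat0 w x)| <= 10 /\
  `|complex.Im (hat0 w (x + z) - hat0 w x)| <= 10.
Proof.
move=> wx zn.
have occ y : y \in nbrs -> odflt 0 (w (x + y)) = hat0 w (x + y).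
  by move=> yn; have := hole_nbr wx yn; rewrite /hat0; case: (w (x + y)).
have ring y : y \in nbrs ->
    `|complex.Re (hat0 w (x + y)) - complex.Re (hat0 w (x + mul_tau y))| < 3 /\
    `|complex.Im (hat0 w (x + y)) - complex.Im (hat0 w (x + mul_tau y))| < 3.
  move=> yn; apply: sqn_dist_lt.
  have tyn : mul_tau y \in nbrs by rewrite nbrs_tau.
  have /andP[_] : 1 / 2 <= dist (hat0 w (x + y)) (hat0 w (x + mul_tau y)) <= 2.
    apply: hat0_edge_occ; [|exact: hole_nbr|exact: hole_nbr].
    by rewrite -(mul_tau2 y) addrA; apply: adj_nbrs; rewrite !nbrs_tau.
  lra.
have E : hat0 w x = 6^-1 * \sum_(z <- nbrs) hat0 w (x + z).
  rewrite {1}/hat0 wx; congr (_ * _); rewrite !sum_nbrs.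
  by rewrite !occ.
have n0 : ((1, 0) : A2) \in nbrs by [].
have n1 : ((0, 1) : A2) \in nbrs by [].
have n2 : ((-1, 1) : A2) \in nbrs by [].
have n3 : ((-1, 0) : A2) \in nbrs by [].
have n4 : ((0, -1) : A2) \in nbrs by [].
have [r0 i0] := ring _ n0; have [r1 i1] := ring _ n1; have [r2 i2] := ring _ n2.
have [r3 i3] := ring _ n3; have [r4 i4] := ring _ n4.
move: r0 i0 r1 i1 r2 i2 r3 i3 r4 i4; rewrite {}E sum_nbrs /mul_tau /=.
have tE (a b : int) : (- b, a + b) = (- b, a + b) :> A2 by [].
rewrite !(oppr0, addr0, add0r, opprK, addNr).
have -> : (6^-1 : C) = (6^-1 : R)%:C%C by rewrite fmorphV rmorph_nat.
move: zn; rewrite nbrsE !inE; do ![case/orP]; move=> /eqP->.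
all: case: (hat0 w (x + (1, 0))) (hat0 w (x + (0, 1))) => [a0 b0] [a1 b1].
all: case: (hat0 w (x + (-1, 1))) (hat0 w (x + (-1, 0))) => [a2' b2] [a3 b3].
all: case: (hat0 w (x + (0, -1))) (hat0 w (x + (1, -1))) => [a4 b4] [a5 b5] /=.
all: move=> a01 b01 a12 b12 a23 b23 a34 b34 a45 b45; rewrite !(mul0r, addr0, subr0).
all: have [? ? ? [? ? ?]] := ring_average a01 a12 a23 a34 a45.
all: by have [? ? ? [? ? ?]] := ring_average b01 b12 b23 b34 b45; split.
Qed.

(** The bound 10^2 + 10^2 comes from edges at a hole; an edge between occupied sites has length at
    most 2. *)
Lemma sqn_hat0_edge x z : z \in nbrs -> sqn (hat0 w (x + z) - hat0 w x) <= 200.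
Proof.
move=> zn.
have sq (p : C) : `|complex.Re p| <= 10 /\ `|complex.Im p| <= 10 -> sqn p <= 200.
  case: p => a b /= [a10 b10]; rewrite /sqn /= -(real_normK (num_real a)) -(real_normK (num_real b)).
  by have := normr_ge0 a; have := normr_ge0 b; nra.
have sC (p q : C) : sqn (p - q) = sqn (q - p).
  by case: p q => a b [c d]; rewrite /sqn /=; ring.
have [wx|wx] := pselect (w x = None); first exact/sq/hat0_edge_hole.
have [wxz|wxz] := pselect (w (x + z) = None).
  have := hat0_edge_hole wxz (z := - z); rewrite nbrsN addrK => /(_ zn)/sq.
  by rewrite sC.
have := hat0_edge_occ (adj_nbrs x zn) wx wxz; rewrite sC -dist_sqr.
by have := dist_ge0 (hat0 w x) (hat0 w (x + z)); nra.
Qed.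

Lemma hole_ge0 x : 0 <= hole x. Proof. by rewrite /hole ler0n. Qed.

Lemma hole1 x : w x = None -> hole x = 1. Proof. by rewrite /hole => ->. Qed.

Lemma strain_ge0 x z : 0 <= strain x z.
Proof. by rewrite /strain; case: (w x) => [c|//]; case: (w _) => [d|//]; exact: sqr_ge0. Qed.

Lemma strainE x z : w x <> None -> w (x + z) <> None ->
  strain x z = (dist (hat0 w x) (hat0 w (x + z)) - l) ^+ 2.
Proof. by rewrite /strain /hat0; case: (w x) (w (x + z)) => [c|] [d|]. Qed.

(** A triangle without hole falls under [triangle_defect], its orientation being given by the last
    condition on regular configurations. If a corner is a hole, the crude bound 2 (200 + 200) = 800
    is charged to that hole. *)
Lemma defect_le x z : z \in nbrs ->
  sqn (hat0 w (x + mul_tau z) - hat0 w x - tau * (hat0 w (x + z) - hat0 w x)) <=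
  86 * (strain x z + strain x (mul_tau z) + strain (x + z) (mul_tau (mul_tau z)))
  + 800 * (hole x + hole (x + z) + hole (x + mul_tau z)).
Proof.
move=> zn; have tzn : mul_tau z \in nbrs by rewrite nbrs_tau.
have ttzn : mul_tau (mul_tau z) \in nbrs by rewrite !nbrs_tau.
have s1 := strain_ge0 x z; have s2 := strain_ge0 x (mul_tau z).
have s3 := strain_ge0 (x + z) (mul_tau (mul_tau z)).
have h1 := hole_ge0 x; have h2 := hole_ge0 (x + z); have h3 := hole_ge0 (x + mul_tau z).
have hol : 1 <= hole x + hole (x + z) + hole (x + mul_tau z) ->
    sqn (hat0 w (x + mul_tau z) - hat0 w x - tau * (hat0 w (x + z) - hat0 w x)) <=
    86 * (strain x z + strain x (mul_tau z) + strain (x + z) (mul_tau (mul_tau z)))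
    + 800 * (hole x + hole (x + z) + hole (x + mul_tau z)).
  move=> H; apply: le_trans (sqn_sub_tau _ _) _.
  by have := sqn_hat0_edge x zn; have := sqn_hat0_edge x tzn; lra.
have [/hole1 wx|wx] := pselect (w x = None); first by apply: hol; lra.
have [/hole1 wxz|wxz] := pselect (w (x + z) = None); first by apply: hol; lra.
have [/hole1 wxt|wxt] := pselect (w (x + mul_tau z) = None); first by apply: hol; lra.
have xtE : x + z + mul_tau (mul_tau z) = x + mul_tau z by rewrite -addrA mul_tau2.
rewrite (strainE wx wxz) (strainE wx wxt) (strainE wxz); last by rewrite xtE.
rewrite xtE; set D := sqn _; set P := _ + _ + _; set H := _ + _ + _ => //.
suff : D <= 86 * P by have : 0 <= H by [rewrite !addr_ge0]; move=> h0 DP; lra.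
have sC (p q : C) : sqn (p - q) = sqn (q - p).
  by case: p q => b c [d e]; rewrite /sqn /=; ring.
apply: triangle_defect; rewrite ?dist_sqr ?[sqn (hat0 w x - _)]sC//.
- by apply: cross_gt0; have [_ _ _] := wr; apply.
- by rewrite sC; congr sqn; ring.
- by apply: hat0_edge_occ => //; exact: adj_nbrs.
- by apply: hat0_edge_occ => //; exact: adj_nbrs.
- by apply: hat0_edge_occ => //; rewrite -xtE; exact: adj_nbrs.
Qed.

End regular.

Lemma norm_div_double (R : realType) (d l : R) : 1 / 2 <= l -> `|d / (2 * l)| <= `|d|.
Proof.
move=> l1; have l2 : 1 <= 2 * l by lra.
rewrite normrM normfV [`|2 * l|]ger0_norm; last lra.
by rewrite ler_piMr// invf_le1//; lra.
Qed.

Section energy.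
Context {R : realType}.
Local Notation C := R[i].
Variables (V : R -> R) (k alpha l m : R) (N : nat) (w : @config R) (dVl : R).
Hypotheses (wr : regular alpha l N w) (N0 : (0 < N)%N).

Local Notation u := (displacement l w).
Local Notation h := (hole w).
Local Notation g := (strain l w).

Definition dirichlet : R := \sum_(x <- IN N) \sum_(z <- nbrs) sqn (u (x + z) - u x).

Lemma hole_periodic : lat_periodic N h.
Proof. by move=> x z; have [wO _ _ _] := wr; rewrite /hole wO; case: (w x). Qed.

Lemma hat0_shift x z :
  hat0 w (x + z *+ N) = hat0 w x + (l * N%:R)%:C%C * emb z.
Proof.
have [wO _ _ _] := wr; rewrite /hat0 wO; case wx : (w x) => [//|].
have E y : y \in nbrs -> odflt 0 (w (x + z *+ N + y)) =
    odflt 0 (w (x + y)) + (l * N%:R)%:C%C * emb z.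
  move=> yn; rewrite addrAC wO; have := hole_nbr wr wx yn.
  by case: (w (x + y)).
by rewrite !sum_nbrs !E //; field.
Qed.

Lemma displacement_periodic : lat_periodic N u.
Proof.
move=> x z; rewrite /displacement hat0_shift embD embMn rmorphM /=.
rewrite (_ : (N%:R)%:C%C = N%:R); last by rewrite (rmorph_nat (real_complex R)).
by rewrite -mulr_natr; ring.
Qed.

Lemma strain_periodic z : lat_periodic N (g ^~ z).
Proof.
move=> x y; have [wO _ _ _] := wr; rewrite /strain addrAC !wO.
case: (w x) => [c|//]; case: (w (x + z)) => [d|//].
by congr ((_ - _) ^+ 2); rewrite /dist; congr Normc.normc; ring.
Qed.

Lemma displacementB x z :
  u (x + z) - u x = hat0 w (x + z) - hat0 w x - l%:C%C * emb z.
Proof. by rewrite /displacement embD; ring. Qed.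

Let sum_DS (f : A2 -> A2 -> R) : (forall z, lat_periodic N (f ^~ z)) ->
  let T := \sum_(x <- IN N) \sum_(z <- nbrs) f x z in
  \sum_(x <- IN N) \sum_(z <- nbrs) f x (mul_tau z) = T /\
  \sum_(x <- IN N) \sum_(z <- nbrs) f (x + z) (mul_tau (mul_tau z)) = T.
Proof.
move=> fP T; split; first by apply: eq_bigr => x _; exact: sum_nbrs_tau.
rewrite (@sum_IN_nbrs_shift _ N (fun x z => f x (mul_tau (mul_tau z))) id N0).
  apply: eq_bigr => x _; rewrite (sum_nbrs_tau (fun z => f x (mul_tau z))).
  exact: sum_nbrs_tau.
by move=> z x y; rewrite fP.
Qed.

Let sum_cst_nbrs (c : R) : \sum_(z <- nbrs) c = 6 * c.
Proof. by rewrite sum_nbrs; ring. Qed.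

Let holes : R := \sum_(x <- IN N) h x.

Let sum_h (e : A2 -> A2) : \sum_(x <- IN N) \sum_(z <- nbrs) h (x + e z) = 6 * holes.
Proof.
rewrite (@sum_IN_nbrs_shift _ N (fun x _ => h x) e N0); last by move=> _; exact: hole_periodic.
by rewrite /holes mulr_sumr; apply: eq_bigr => x _; rewrite sum_cst_nbrs.
Qed.

Let G : R := \sum_(x <- IN N) \sum_(z <- nbrs) g x z.

(** Multiplication by tau commutes with the affine part l x, so [hat0] and the displacement have the
    same defect and [rigidity] applies. In the sum of [defect_le] every edge has three roles, whence
    258 = 3 times 86, and every hole is met by 3 corners and 6 directions, whence 14400 = 18 times
    800. *)
Lemma dirichlet_le : alpha <= 1 / 2 -> 0 < l ->
  3 / 2 * dirichlet <= 258 * G + 14400 * holes.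
Proof.
move=> a2 l0; rewrite -rigidity//; last exact: displacement_periodic.
have E x z : u (x + mul_tau z) - u x - tau * (u (x + z) - u x) =
    hat0 w (x + mul_tau z) - hat0 w x - tau * (hat0 w (x + z) - hat0 w x).
  by rewrite !displacementB emb_mul_tau; ring.
pose F x z := 86 * (g x z + g x (mul_tau z) + g (x + z) (mul_tau (mul_tau z)))
  + 800 * (h (x + 0) + h (x + z) + h (x + mul_tau z)).
apply: (@le_trans _ _ (\sum_(x <- IN N) \sum_(z <- nbrs) F x z)).
  apply: ler_sum => x _; rewrite big_seq [leRHS]big_seq; apply: ler_sum => z zn.
  by rewrite E /F addr0; exact: (defect_le wr a2 l0 x zn).
have [D1 D2] := sum_DS strain_periodic.
under eq_bigr do rewrite big_split /= -!mulr_sumr !big_split /=.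
rewrite big_split /= -!mulr_sumr !big_split /= D1 D2 !sum_h -/G.
lra.
Qed.

(** Expanding the square of l z plus the increment of the displacement, the mixed term is linear in
    the increment and telescopes on the torus. Thus a first order quantity, the excess of squared
    lengths, has an exactly quadratic sum. *)
Lemma sum_sqn_edges :
  \sum_(x <- IN N) \sum_(z <- nbrs) (sqn (hat0 w (x + z) - hat0 w x) - l ^+ 2) =
  dirichlet.
Proof.
have E x z : z \in nbrs -> sqn (hat0 w (x + z) - hat0 w x) - l ^+ 2 =
    sqn (u (x + z) - u x) + 2 * l * complex.Re ((emb z)^*%C * (u (x + z) - u x)).
  move=> zn; have e1 : sqn (emb z : C) = 1.
    have := adj_nbrs (R := R) 0 zn; rewrite /adj => /(congr1 (fun r => r ^+ 2)).
    rewrite dist_sqr add0r -embB sub0r expr1n -[X in _ = X]/1 => <-.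
    by rewrite !sqn_emb; congr _%:~R; case: z {zn} => b c /=; ring.
  rewrite displacementB; move: e1; move: (hat0 w (x + z) - hat0 w x) (emb z) => [b c] [d e].
  rewrite /sqn /= => e1; have -> : l ^+ 2 = l ^+ 2 * (d ^+ 2 + e ^+ 2) by rewrite e1 mulr1.
  by ring.
under eq_bigr do rewrite (eq_big_seq _ (E _)) big_split /= -mulr_sumr.
rewrite big_split /= -mulr_sumr.
set X := \sum_(x <- IN N) \sum_(z <- nbrs) complex.Re _.
suff -> : X = 0 by rewrite mulr0 addr0.
have := sum_diff0 N0 displacement_periodic (fun z => (emb z)^*%C).
move=> /(congr1 (@complex.Re R)); rewrite raddf_sum /= => <-.
by apply: eq_bigr => x _; rewrite raddf_sum.
Qed.

Lemma hamiltonianE : hamiltonian V m N w =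
  2^-1 * (\sum_(x <- IN N) \sum_(z <- nbrs) pair_energy V (w x) (w (x + z)))
  + m * holes.
Proof.
rewrite /hamiltonian; congr (_ * _ + _).
by apply: eq_bigr => x _; rewrite sum_adj.
Qed.

(** With b = V'(l) / (2 l) one has V'(l) (r - l) = b (r^2 - l^2) - b (r - l)^2, and half of the
    convexity constant absorbs the last term. An edge at a hole has energy 0; there the hole terms
    dominate, since the squared length differs from l^2 by at most 200 + 4. *)
Lemma pair_energy_ge x z : z \in nbrs -> alpha <= 1 / 2 -> 1 / 2 <= l <= 2 ->
  (forall r, `|r - 1| <= alpha -> V l + dVl * (r - l) + k * (r - l) ^+ 2 <= V r) ->
  `|dVl| <= 1 -> `|dVl| <= k / 2 ->
  V l + dVl / (2 * l) * (sqn (hat0 w (x + z) - hat0 w x) - l ^+ 2) + k / 2 * g x z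
    - (`|V l| + 204) * (h x + h (x + z)) <= pair_energy V (w x) (w (x + z)).
Proof.
move=> zn a2 /andP[l1 l2] Vr dV1 dVk.
have sq0 := sqn_ge0 (hat0 w (x + z) - hat0 w x).
have sq1 := sqn_hat0_edge wr a2 x zn.
set b := dVl / (2 * l); have dVE : dVl = 2 * l * b by rewrite /b; field; apply: lt0r_neq0; lra.
have bE : `|b| <= `|dVl| by exact: norm_div_double.
clearbody b.
have b0 := normr_ge0 b; have V0 := normr_ge0 (V l).
have hx := hole_ge0 w x; have hxz := hole_ge0 w (x + z).
have bl := ler_norm b; have nbl := ler_norm (- b); rewrite normrN in nbl.
have Vl := ler_norm (V l).
have hol : 1 <= h x + h (x + z) -> g x z = 0 ->
    V l + b * (sqn (hat0 w (x + z) - hat0 w x) - l ^+ 2) + k / 2 * g x z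
      - (`|V l| + 204) * (h x + h (x + z)) <= 0.
  move: (sqn _) sq0 sq1 => q q0 q1 H ->.
  have : b * (q - l ^+ 2) <= 204.
    apply: le_trans (ler_norm _) _; rewrite normrM -[leRHS]mul1r ler_pM//; first lra.
    by rewrite ler_norml; apply/andP; split; nra.
  by move: (h x + h (x + z)) H => y H; nra.
have [wx|wx] := pselect (w x = None).
  by rewrite wx /= hol ?(hole1 wx) ?lerDl// /strain wx.
have [wxz|wxz] := pselect (w (x + z) = None).
  have E : g x z = 0 by rewrite /strain wxz; case: (w x).
  have -> : pair_energy V (w x) (w (x + z)) = 0 by rewrite wxz /pair_energy; case: (w x).
  by rewrite hol// (hole1 wxz) lerDr.
have hx0 : h x = 0 by move: wx; rewrite /hole; case: (w x).
have hz0 : h (x + z) = 0 by move: wxz; rewrite /hole; case: (w _).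
rewrite hx0 hz0 addr0 mulr0 subr0 (strainE _ wx wxz).
have [_ /(_ x (x + z)) W _ _] := wr.
move: W wx wxz; rewrite /hat0; case wx : (w x) => [c|//]; case wxz : (w (x + z)) => [d|//].
move=> /(_ _ _ (adj_nbrs x zn) erefl erefl) /andP[d1 d2] _ _.
rewrite -dist_sqr distC /pair_energy; set r := dist c d in d1 d2 *.
have ra : `|r - 1| <= alpha by rewrite ler_norml; apply/andP; split; lra.
apply: le_trans (Vr r ra); rewrite -subr_ge0 dVE.
rewrite (_ : _ - _ = (k / 2 - b) * (r - l) ^+ 2); last by field.
by rewrite mulr_ge0 ?sqr_ge0//; lra.
Qed.

(** Summing [pair_energy_ge] and halving, the excess is at least b / 2 times the Dirichlet sum D,
    plus k / 4 times the strain, plus m - 6 (|V(l)| + 204) per hole. By [dirichlet_le] the strain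
    term is at least k D / 688 minus 14400 k / 1032 per hole; the latter is paid by the part 14 k of
    m, and the bound on [dVl] lets the linear term consume at most half of k D / 688. *)
Lemma energy_lower : alpha <= 1 / 2 -> 1 / 2 <= l <= 2 -> 0 < k ->
  (forall r, `|r - 1| <= alpha -> V l + dVl * (r - l) + k * (r - l) ^+ 2 <= V r) ->
  `|dVl| <= 1 -> `|dVl| <= k / 688 -> 6 * (`|V l| + 204) + 14 * k <= m ->
  k / 1376 * dirichlet <= hamiltonian V m N w - 3 * (N * N)%:R * V l.
Proof.
move=> a2 l12 k0 Vr dV1 dVk mM; have /andP[l1 l2] := l12.
have dVk2 : `|dVl| <= k / 2 by lra.
have hol0 : 0 <= holes by apply: sumr_ge0 => x _; exact: hole_ge0.
have D0 : 0 <= dirichlet.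
  by apply: sumr_ge0 => x _; apply: sumr_ge0 => z _; exact: sqn_ge0.
have DG : 3 / 2 * dirichlet <= 258 * G + 14400 * holes by apply: dirichlet_le; lra.
rewrite hamiltonianE; set P := \sum_(x <- _) _.
set b := dVl / (2 * l); set M := `|V l| + 204 in mM *.
have PE : 6 * (N * N)%:R * V l + b * dirichlet + k / 2 * G - 12 * M * holes <= P.
  pose F x z := V l + b * (sqn (hat0 w (x + z) - hat0 w x) - l ^+ 2) + k / 2 * g x z
    - M * (h (x + 0) + h (x + z)).
  have : \sum_(x <- IN N) \sum_(z <- nbrs) F x z <= P.
    apply: ler_sum => x _; rewrite big_seq [leRHS]big_seq; apply: ler_sum => z zn.
    by rewrite /F addr0; exact: pair_energy_ge.
  apply: le_trans.
  have split (c0 c1 c2 c3 : R) (f1 f2 f3 f4 : A2 -> A2 -> R) :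
      let Sm (f : A2 -> A2 -> R) := \sum_(x <- IN N) \sum_(z <- nbrs) f x z in
      \sum_(x <- IN N) \sum_(z <- nbrs)
        (c0 + c1 * f1 x z + c2 * f2 x z - c3 * (f3 x z + f4 x z)) =
      6 * (N * N)%:R * c0 + c1 * Sm f1 + c2 * Sm f2 - c3 * (Sm f3 + Sm f4).
    move=> Sm; under eq_bigr do rewrite sumrB !big_split /= -!mulr_sumr sum_cst_nbrs big_split /=.
    rewrite sumrB !big_split /= -!mulr_sumr big_split /=; congr (_ + _ + _ - _).
    by rewrite big_const_seq iter_addr_0 count_predT size_IN -mulr_natr; ring.
  rewrite (split _ _ _ _ (fun x z => sqn (hat0 w (x + z) - hat0 w x) - l ^+ 2)
    (fun x z => g x z) (fun x z => h (x + 0)) (fun x z => h (x + z))).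
  by rewrite sum_sqn_edges !sum_h -/G; lra.
have bE : `|b| <= `|dVl| by exact: norm_div_double.
have : - (k / 688) * dirichlet <= b * dirichlet.
  by rewrite ler_wpM2r// lerNl; apply: le_trans (ler_norm _) _; rewrite normrN (le_trans bE).
have : k * (3 / 2 * dirichlet) <= k * (258 * G + 14400 * holes) by rewrite ler_pM2l.
have : (6 * M + 14 * k) * holes <= m * holes by rewrite ler_wpM2r.
have : 0 <= k * holes by rewrite mulr_ge0// ltW.
move: (N * N)%:R PE => q; nra.
Qed.

End energy.

(** * Gradient of the interpolation *)

Section gradient.
Context {R : realType}.
Local Notation C := R[i].

Lemma ofCK (z : C) : toC (ofC z) = z.
Proof. by rewrite /toC /ofC !mxE /=; case: z. Qed.

Lemma jacobian_affine_near (f : 'rV[R]_2 -> 'rV[R]_2) (p : 'rV[R]_2) (M : 'M[R]_2) :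
  (\forall v \near (0 : 'rV[R]_2), f (v + p) = f p + v *m M) -> jacobian f p = M.
Proof.
move=> fM; have mE : mulmxr M = (fun v : 'rV[R]_2 => v 0 0 *: row 0 M + v 0 1 *: row 1 M).
  apply/funext => v; apply/rowP => j; rewrite !mxE !big_ord_recl big_ord0 addr0.
  by rewrite (_ : lift ord0 ord0 = 1)//; apply/val_inj.
have cM : continuous (mulmxr M : 'rV[R]_2 -> 'rV[R]_2).
  rewrite mE => v.
  have h0 : (fun v : 'rV[R]_2 => v 0 0) @ v --> v 0 0 by exact: coord_continuous.
  have h1 : (fun v : 'rV[R]_2 => v 0 1) @ v --> v 0 1 by exact: coord_continuous.
  apply: cvgD; first exact: (nbhs_filter v).
    exact: (@cvgZr_tmp R _ _ _ (nbhs_filter v) _ _ (row 0 M) h0).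
  exact: (@cvgZr_tmp R _ _ _ (nbhs_filter v) _ _ (row 1 M) h1).
have dE : 'd f p = mulmxr M :> ('rV[R]_2 -> 'rV[R]_2).
  apply: diff_unique => //; apply/eqaddoP => eps eps0.
  near=> v; have -> : (f \o shift p - (cst (f p) + mulmxr M)) v = 0.
    rewrite /= /GRing.opp /= /GRing.add /=.
    by apply/eqP; rewrite subr_eq0; apply/eqP; near: v.
  by rewrite normr0 mulr_ge0// ltW.
apply/row_matrixP => i; rewrite /jacobian rowE mul_rV_lin1.
by rewrite -[LHS]/(('d f p : _ -> _) _) dE /= -rowE.
Unshelve. all: by end_near. Qed.

Lemma toCD (v w : 'rV[R]_2) : toC (v + w) = toC v + toC w.
Proof. by rewrite /toC !mxE. Qed.

Lemma triangle_nbrs (D : A2 * A2) : triangle D -> D.2 \in nbrs.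
Proof. by move=> [->|->]. Qed.

Lemma sqn_emb_nbrs z : z \in nbrs -> sqn (emb z : C) = 1.
Proof.
rewrite nbrsE !inE sqn_emb.
by do ![case/orP] => /eqP-> /=; rewrite -[X in _ = X]/1%:~R; congr _%:~R; ring.
Qed.

(* The coordinates of [v] in the basis [e], [tau * e]. *)
Definition coord1 (e : C) (v : 'rV[R]_2) : R :=
  complex.Re e * v 0 0 + complex.Im e * v 0 1
  - (complex.Re e * v 0 1 - complex.Im e * v 0 0) / sin (pi / 3) / 2.

Definition coord2 (e : C) (v : 'rV[R]_2) : R :=
  (complex.Re e * v 0 1 - complex.Im e * v 0 0) / sin (pi / 3).

Lemma coordK (e : C) v : sqn e = 1 ->
  toC v = (coord1 e v)%:C%C * e + (coord2 e v)%:C%C * (tau * e).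
Proof.
rewrite tau_mulE /toC /coord1 /coord2; case: e => a b; rewrite /sqn /=.
have s0 := @sin_pi3_gt0 R; have := @sinpi3_sqr R; set s := sin _ in s0 * => s2 e1.
move: (v 0 0) (v 0 1) => X Y.
have sn : s != 0 by rewrite gt_eqF.
apply/eqP; rewrite eq_complex /=; apply/andP; split; apply/eqP.
  by transitivity (X * (a ^+ 2 + b ^+ 2)); [rewrite e1 mulr1|field].
by transitivity (Y * (a ^+ 2 + b ^+ 2)); [rewrite e1 mulr1|field].
Qed.

Lemma coord2_le (e : C) v : sqn e = 1 ->
  `|coord1 e v| <= 4 * (`|v 0 0| + `|v 0 1|) /\
  `|coord2 e v| <= 4 * (`|v 0 0| + `|v 0 1|).
Proof.
rewrite /coord1 /coord2; case: e => a b; rewrite /sqn /= => e1.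
have s0 := @sin_pi3_gt0 R; have s2 := @sinpi3_sqr R.
set s := sin _ in s0 s2 *; have s1 : 1 / 2 <= s by nra.
move: (v 0 0) (v 0 1) => X Y.
have a1 : `|a| <= 1 by rewrite ler_norml; apply/andP; split; nra.
have b1 : `|b| <= 1 by rewrite ler_norml; apply/andP; split; nra.
have n1 (p q x y : R) : `|p| <= 1 -> `|q| <= 1 -> `|p * x + q * y| <= `|x| + `|y|.
  move=> p1 q1; apply: le_trans (ler_normD _ _) _; rewrite !normrM.
  by apply: lerD; rewrite ler_piMl.
have h1 := n1 a b X Y a1 b1.
have h2 : `|a * Y - b * X| <= `|X| + `|Y|.
  rewrite [leRHS]addrC (_ : _ - _ = a * Y + (- b) * X); last by ring.
  by apply: n1; rewrite ?normrN.
have h3 : `|(a * Y - b * X) / s| <= 2 * (`|X| + `|Y|).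
  rewrite normrM normfV (gtr0_norm s0) ler_pdivrMr//.
  have := normr_ge0 X; have := normr_ge0 Y; nra.
have := normr_ge0 X; have := normr_ge0 Y => Y0 X0; split; last by lra.
apply: le_trans (ler_normB _ _) _; rewrite [`|_ / 2|]normrM.
rewrite (_ : `|2^-1| = 2^-1 :> R); last by rewrite ger0_norm.
by lra.
Qed.

Lemma hat_barycenter (w : @config R) (D : A2 * A2) (v : 'rV[R]_2) : triangle D ->
  `|v 0 0| <= 1 / 100 -> `|v 0 1| <= 1 / 100 ->
  hat w (toC (v + ofC (barycenter D))) = hat w (toC (ofC (barycenter D))) +
    ((coord1 (emb D.2) v)%:C%C * (hat0 w (D.1 + D.2) - hat0 w D.1)
     + (coord2 (emb D.2) v)%:C%C * (hat0 w (D.1 + mul_tau D.2) - hat0 w D.1)).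
Proof.
move=> tD v0 v1; have zn := triangle_nbrs tD.
have e1 := sqn_emb_nbrs zn.
have [c1 c2] := coord2_le v e1.
rewrite toCD !ofCK (coordK v e1) /barycenter.
case: D tD zn e1 c1 c2 => x z /= tD _ e1; move: (coord1 _ _) (coord2 _ _) => s t s1 t1.
(* The barycentric coordinates 1 / 3 move by at most 4 (1 / 100 + 1 / 100), hence stay inside the
   triangle. *)
have {}s1 : `|s| <= 8 / 100 by lra.
have {}t1 : `|t| <= 8 / 100 by lra.
move: s1 t1; rewrite !ler_norml => /andP[s1 s2] /andP[t1 t2].
have third : (3^-1 : C) = (3^-1 : R)%:C%C by rewrite fmorphV rmorph_nat.
rewrite -emb_mul_tau.
have -> : s%:C%C * emb z + t%:C%C * emb (mul_tau z) + (emb x + 3^-1 * (emb z + emb (mul_tau z)))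
   = emb x + (3^-1 + s)%:C%C * emb z + (3^-1 + t)%:C%C * emb (mul_tau z) :> C.
  by rewrite !rmorphD /= third; ring.
have -> : emb x + 3^-1 * (emb z + emb (mul_tau z))
   = emb x + (3^-1)%:C%C * emb z + (3^-1)%:C%C * emb (mul_tau z) :> C.
  by rewrite third; ring.
rewrite !hat_interp ?invr_ge0//; [|lra..].
by rewrite /interp !rmorphD /=; ring.
Qed.

Lemma gradE (w : @config R) (D : A2 * A2) : triangle D ->
  (grad w D)^T = \matrix_(i, j) ofC
    ((coord1 (emb D.2) (delta_mx 0 i))%:C%C * (hat0 w (D.1 + D.2) - hat0 w D.1)
     + (coord2 (emb D.2) (delta_mx 0 i))%:C%C
       * (hat0 w (D.1 + mul_tau D.2) - hat0 w D.1)) 0 j.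
Proof.
move=> tD; rewrite /grad trmxK; apply: jacobian_affine_near.
have n0 : \forall v \near (0 : 'rV[R]_2), `|(v : 'rV[R]_2) 0 0| <= 1 / 100.
  have := @coord_continuous R 1 2 0 0 (0 : 'rV[R]_2) => /cvgr_dist_le.
  move=> /(_ (1 / 100)); rewrite mxE => /(_ ltac:(lra)); apply: filterS => v.
  by rewrite sub0r normrN.
have n1 : \forall v \near (0 : 'rV[R]_2), `|(v : 'rV[R]_2) 0 1| <= 1 / 100.
  have := @coord_continuous R 1 2 0 1 (0 : 'rV[R]_2) => /cvgr_dist_le.
  move=> /(_ (1 / 100)); rewrite mxE => /(_ ltac:(lra)); apply: filterS => v.
  by rewrite sub0r normrN.
near=> v; rewrite hat_barycenter//; [|by near: v..].
apply/rowP => j; rewrite !mxE !big_ord_recl big_ord0 addr0 !mxE.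
rewrite (_ : lift ord0 ord0 = 1); last exact/val_inj.
rewrite /coord1 /coord2 !mxE /=.
move: (hat0 w (_ + _) - _) (hat0 w (_ + _) - _) => [a b] [c d].
case: (hat w _) => x y; rewrite (_ : ord0 = 0 :> 'I_2)//.
by case: eqP => _ /=; rewrite !(mul0r, subr0, addr0, mulr1, mulr0); ring.
Unshelve. all: by end_near. Qed.

Lemma norm_le_entries (nrm : 'M[R]_2 -> R) : is_norm nrm -> exists2 K : R, 0 <= K &
  forall (A : 'M[R]_2) (B : R), (forall i j, `|A i j| <= B) -> nrm A <= K * B.
Proof.
move=> [n0 _ nZ nD]; exists (\sum_i \sum_j nrm (delta_mx i j)).
  by apply: sumr_ge0 => i _; apply: sumr_ge0.
have nrm0 : nrm 0 = 0 by rewrite -(scale0r 0) nZ normr0 mul0r.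
have nS (I : finType) (F : I -> 'M[R]_2) : nrm (\sum_i F i) <= \sum_i nrm (F i).
  elim/big_ind2 : _ => [|A a B b Aa Bb|//]; first by rewrite nrm0.
  exact: le_trans (nD _ _) (lerD Aa Bb).
move=> A B AB; rewrite {1}(matrix_sum_delta A) mulr_suml.
apply: le_trans (nS _ _) _; apply: ler_sum => i _; rewrite mulr_suml.
apply: le_trans (nS _ _) _; apply: ler_sum => j _.
by rewrite nZ mulrC ler_wpM2l.
Qed.

(** The map l x has gradient l Id, so the difference is the gradient of the displacement, whose
    columns combine the increments along two sides. The coefficients, coordinates of unit vectors in
    the basis e, tau e, are at most 4 in absolute value, whence 32 = 2 times 4^2. The constant
    depends on the norm alone. *)
Lemma gradB_le (nrm : 'M[R]_2 -> R) : is_norm nrm -> exists2 K : R, 0 <= K &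
  forall (l : R) (w : @config R) D, triangle D ->
    nrm (grad w D - l%:M) ^+ 2 <= K *
      (sqn (displacement l w (D.1 + D.2) - displacement l w D.1) +
       sqn (displacement l w (D.1 + mul_tau D.2) - displacement l w D.1)).
Proof.
move=> nn; have [K K0 nK] := norm_le_entries nn; have [nrm0 _ _ _] := nn.
exists (K ^+ 2 * 32) => [|l w D tD]; first by rewrite mulr_ge0 ?sqr_ge0.
set a := displacement l w (_ + D.2) - _; set b := _ - displacement l w D.1.
have e1 := sqn_emb_nbrs (triangle_nbrs tD).
have a0 := sqn_ge0 a; have b0 := sqn_ge0 b.
suff E : forall i j, (grad w D - l%:M) i j ^+ 2 <= 32 * (sqn a + sqn b).
  have /nK : forall i j, `|(grad w D - l%:M) i j| <= Num.sqrt (32 * (sqn a + sqn b)).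
    by move=> i j; rewrite -sqrtr_sqr; apply: ler_wsqrtr; exact: E.
  have s0 : 0 <= 32 * (sqn a + sqn b) by lra.
  move=> H; rewrite -mulrA -[32 * _](sqr_sqrtr s0) -exprMn.
  by rewrite lerXn2r// nnegrE ?nrm0 ?mulr_ge0 ?sqrtr_ge0.
move=> i j; pose v : 'rV[R]_2 := delta_mx 0 j.
have gE : (grad w D - l%:M) i j =
    ofC ((coord1 (emb D.2) v)%:C%C * a + (coord2 (emb D.2) v)%:C%C * b) 0 i.
  have gr : grad w D i j = ofC
      ((coord1 (emb D.2) v)%:C%C * (hat0 w (D.1 + D.2) - hat0 w D.1)
       + (coord2 (emb D.2) v)%:C%C * (hat0 w (D.1 + mul_tau D.2) - hat0 w D.1)) 0 i.
    by rewrite -[grad w D]trmxK gradE// mxE mxE.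
  have id : (l%:M : 'M[R]_2) i j = ofC (l%:C%C * toC v) 0 i.
    rewrite !mxE /v /toC !mxE /=.
    by case: i j {v gr} => [[|[|//]] ?] [[|[|//]] ?] /=; rewrite !(mulr1, mulr0, mul0r, subr0, addr0, mulr1n, mulr0n).
  rewrite mxE gr [(- l%:M) i j]mxE id (coordK v e1) /a /b !displacementB emb_mul_tau.
  have ofCB (x y : C) : ofC x 0 i - ofC y 0 i = ofC (x - y) 0 i.
    by rewrite !mxE; case: x y => ? ? [? ?]; case: eqP.
  by rewrite ofCB; congr (ofC _ 0 i); ring.
rewrite {}gE.
have [c1 c2] := coord2_le v e1.
have v1 : `|v 0 0| + `|v 0 1| = 1.
  by rewrite /v !mxE /=; case: j {v c1 c2} => [[|[|//]] ?] /=; rewrite !(normr1, normr0, addr0, add0r).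
move: c1 c2; rewrite v1 mulr1; move: (coord1 _ _) (coord2 _ _) => c d.
rewrite !ler_norml => /andP[c1 c2] /andP[d1 d2].
have sq (x y : R) : (c * x + d * y) ^+ 2 <= 32 * (x ^+ 2 + y ^+ 2).
  have c3 : c ^+ 2 <= 16 by nra.
  have d3 : d ^+ 2 <= 16 by nra.
  have := sqr_ge0 (c * x - d * y); have := sqr_ge0 x; have := sqr_ge0 y; nra.
rewrite mxE; case: a b {a0 b0} => a1 a2 [b1 b2]; rewrite /sqn /=.
have := sqr_ge0 a1; have := sqr_ge0 a2; have := sqr_ge0 b1; have := sqr_ge0 b2.
move=> ? ? ? ?; case: eqP => _; rewrite !(mul0r, subr0, addr0).
  by have := sq a1 b1; lra.
by have := sq a2 b2; lra.
Qed.

End gradient.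

(** * Perturbations of the standard configuration *)

Lemma row_fixed_point (R : realType) (f : 'rV[R]_2 -> 'rV[R]_2) (q : R) : 0 <= q < 1 ->
  (forall x y, `|f x - f y| <= q * `|x - y|) -> exists p, p = f p.
Proof.
move=> /andP[q0 q1] fq.
pose X := HB.pack_for (completeNormedModType R) 'rV[R]_2
  (Complete.on 'rV[R]_2) (NormedModule.on 'rV[R]_2).
have fT : @set_fun X X [set: X] [set: X] f by [].
pose F := @mkfun_fun X X [set: X] [set: X] f fT.
have [||//|p _ pE] := @banach_fixed_point R X setT F.
- exists (NngNum q0); split=> //= -[x y] _; exact: fq.
- exact: closedT.
- by exists 0.
by exists p.
Qed.

(** * The interpolation as a sum of tents *)

Section hat_function.
Context {R : realType}.
Local Notation C := R[i].
Implicit Types a b s t : R.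

(* The piecewise affine function on the plane, in the coordinates of the basis
   (1, tau), which is 1 at the origin and 0 at the other lattice points. *)
Definition tent s t : R := Num.max 0 (1 - Num.max (Num.max `|s| `|t|) `|s + t|).

Definition cell a b : seq A2 :=
  let i := Num.floor a in let j := Num.floor b in
  [:: (i, j); (i + 1, j); (i, j + 1); (i + 1, j + 1)].

(** The full lattice sum is locally finite. An explicit list of sites keeps it finite and allows two
    points to be compared over the union of their cells. *)
Definition tent_sum (g : A2 -> C) (S : seq A2) a b : C :=
  \sum_(x <- S) (tent (a - x.1%:~R) (b - x.2%:~R))%:C%C * g x.

Lemma tent_lipschitz s t s' t' :
  `|tent s t - tent s' t'| <= `|s - s'| + `|t - t'|.
Proof.
rewrite /tent; set M := Num.max (Num.max _ _) _; set M' := Num.max (Num.max `|s'| _) _.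
have M1 : M <= M' + (`|s - s'| + `|t - t'|).
  have := ler_normD (s - s') s'; have := ler_normD (t - t') t'.
  have := ler_normD (s - s' + (t - t')) (s' + t'); have := ler_normD (s - s') (t - t').
  rewrite !subrK (_ : s - s' + (t - t') + (s' + t') = s + t); last by ring.
  have := normr_ge0 (s - s'); have := normr_ge0 (t - t').
  rewrite /M !ge_max; have : `|s'| <= M' by rewrite /M' !le_max lexx.
  have : `|t'| <= M' by rewrite /M' !le_max lexx orbT.
  have : `|s' + t'| <= M' by rewrite /M' !le_max lexx !orbT.
  by move=> *; rewrite -andbA; apply/and3P; split; lra.
have M2 : M' <= M + (`|s - s'| + `|t - t'|).
  have := ler_normD (s' - s) s; have := ler_normD (t' - t) t.
  have := ler_normD (s' - s + (t' - t)) (s + t); have := ler_normD (s' - s) (t' - t).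
  rewrite !subrK (_ : s' - s + (t' - t) + (s + t) = s' + t'); last by ring.
  rewrite ![`|s' - _|]distrC ![`|t' - _|]distrC.
  have := normr_ge0 (s - s'); have := normr_ge0 (t - t').
  rewrite /M' !ge_max; have : `|s| <= M by rewrite /M !le_max lexx.
  have : `|t| <= M by rewrite /M !le_max lexx orbT.
  have : `|s + t| <= M by rewrite /M !le_max lexx !orbT.
  by move=> *; rewrite -andbA; apply/and3P; split; lra.
move: M M' M1 M2 => M M' M1 M2; rewrite ler_norml; apply/andP.
by split; case: (leP 0 (1 - M)); case: (leP 0 (1 - M')) => *; lra.
Qed.

Lemma cell_uniq a b : uniq (cell a b).
Proof.
rewrite /cell /= !inE !xpair_eqE !negb_or.
by move: (Num.floor a) (Num.floor b) => i j; apply/and4P; split=> //; lia.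
Qed.

Lemma tent_notin_cell a b x : x \notin cell a b ->
  tent (a - x.1%:~R) (b - x.2%:~R) = 0.
Proof.
case: x => i j /=; rewrite /cell !inE !xpair_eqE /= => H.
have far (c : R) (k : int) : k != Num.floor c -> k != Num.floor c + 1 -> 1 <= `|c - k%:~R|.
  have /andP[k1 k2] := floor_itv c => n1 n2.
  have : k + 1 <= Num.floor c \/ Num.floor c + 2 <= k by lia.
  rewrite rmorphD /= in k2.
  rewrite ler_normr => -[]; rewrite -(ler_int R) rmorphD /= => k3; apply/orP; [left|right].
    lra.
  by rewrite (_ : 2%:~R = 2 :> R) // in k3; lra.
suff H1 : 1 <= `|a - i%:~R| \/ 1 <= `|b - j%:~R|.
  rewrite /tent; apply: max_idPl; rewrite subr_le0 !le_max.
  by case: H1 => ->; rewrite ?orbT.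
have [ai|ai] := boolP ((i == Num.floor a) || (i == Num.floor a + 1)).
  by right; apply: far; apply/negP => /eqP jE; move/negP: H; apply; lia.
by left; apply: far; lia.
Qed.

Lemma tent_sum_cell g S a b : uniq S -> {subset cell a b <= S} ->
  tent_sum g S a b = tent_sum g (cell a b) a b.
Proof.
move=> uS cS; rewrite /tent_sum (bigID (mem (cell a b))) /=.
rewrite [X in _ + X]big1 ?addr0; last by move=> x /tent_notin_cell ->; rewrite mul0r.
rewrite -big_filter; apply: perm_big; apply: uniq_perm.
- exact: filter_uniq.
- exact: cell_uniq.
by move=> x; rewrite mem_filter; apply/andP/idP => [[]//|xc]; split=> //; exact: cS.
Qed.

Lemma tentE s t m : `|s| <= m -> `|t| <= m -> `|s + t| <= m ->
  [\/ m = `|s|, m = `|t| | m = `|s + t|] -> tent s t = Num.max 0 (1 - m).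
Proof.
move=> h1 h2 h3 mE; rewrite /tent; congr (Num.max _ (_ - _)); apply: le_anti.
rewrite !ge_max h1 h2 h3 /= !le_max.
by case: mE => ->; rewrite lexx ?orbT.
Qed.

Lemma tentE1 s t m : m <= 1 -> `|s| <= m -> `|t| <= m -> `|s + t| <= m ->
  [\/ m = `|s|, m = `|t| | m = `|s + t|] -> tent s t = 1 - m.
Proof.
by move=> m1 h1 h2 h3 h4; rewrite (tentE h1 h2 h3 h4); apply/max_idPr; rewrite subr_ge0.
Qed.

Lemma tentE0 s t : 1 <= `|s + t| -> tent s t = 0.
Proof. by move=> m1; apply/max_idPl; rewrite subr_le0 le_max m1 orbT. Qed.

Definition fractional a : R := a - (Num.floor a)%:~R.

Lemma frac_itv a : 0 <= fractional a < 1.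
Proof.
have /andP[h1 h2] := floor_itv a; rewrite rmorphD /= in h2.
by rewrite /fractional; apply/andP; split; lra.
Qed.

Lemma tent_sumE g a b : tent_sum g (cell a b) a b =
  let i := Num.floor a in let j := Num.floor b in
  let s := fractional a in let t := fractional b in
  if s + t <= 1 then
    (1 - s - t)%:C%C * g (i, j) + s%:C%C * g (i + 1, j) + t%:C%C * g (i, j + 1)
  else (1 - t)%:C%C * g (i + 1, j) + (1 - s)%:C%C * g (i, j + 1)
    + (s + t - 1)%:C%C * g (i + 1, j + 1).
Proof.
have sub1 (c : R) : c - (Num.floor c + 1)%:~R = fractional c - 1.
  by rewrite rmorphD /fractional /=; ring.
rewrite /tent_sum /cell !big_cons big_nil /= !sub1 -/(fractional a) -/(fractional b) addr0.
have /andP[] := frac_itv a; have /andP[] := frac_itv b.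
move: (fractional a) (fractional b) => s t t0 t1 s0 s1.
have ns : `|s| = s by rewrite ger0_norm.
have nt : `|t| = t by rewrite ger0_norm.
have ns1 : `|s - 1| = 1 - s by rewrite ltr0_norm; lra.
have nt1 : `|t - 1| = 1 - t by rewrite ltr0_norm; lra.
have nst : `|s + t| = s + t by rewrite ger0_norm; lra.
have nst2 : `|s - 1 + (t - 1)| = 2 - s - t by rewrite ltr0_norm; lra.
case: leP => st.
  have n1 : `|s - 1 + t| = 1 - s - t by rewrite ler0_norm; lra.
  have n2 : `|s + (t - 1)| = 1 - s - t by rewrite ler0_norm; lra.
  have -> : tent s t = 1 - (s + t).
    by apply: tentE1; rewrite ?ns ?nt ?nst; [lra..|exact: Or33].
  have -> : tent (s - 1) t = 1 - (1 - s).
    by apply: tentE1; rewrite ?ns1 ?nt ?n1; [lra..|exact: Or31].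
  have -> : tent s (t - 1) = 1 - (1 - t).
    by apply: tentE1; rewrite ?ns ?nt1 ?n2; [lra..|exact: Or32].
  rewrite tentE0; last by rewrite nst2; lra.
  have -> : 1 - (s + t) = 1 - s - t by ring.
  have -> : 1 - (1 - s) = s by ring.
  have -> : 1 - (1 - t) = t by ring.
  ring.
have n1 : `|s - 1 + t| = s + t - 1 by rewrite ger0_norm; lra.
have n2 : `|s + (t - 1)| = s + t - 1 by rewrite ger0_norm; lra.
have -> : tent (s - 1) t = 1 - t.
  by apply: tentE1; rewrite ?ns1 ?nt ?n1; [lra..|exact: Or32].
have -> : tent s (t - 1) = 1 - s.
  by apply: tentE1; rewrite ?ns ?nt1 ?n2; [lra..|exact: Or31].
have -> : tent (s - 1) (t - 1) = 1 - (2 - s - t).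
  by apply: tentE1; rewrite ?ns1 ?nt1 ?nst2; [lra..|exact: Or33].
rewrite tentE0; last by rewrite nst; lra.
have -> : 1 - (2 - s - t) = s + t - 1 by ring.
ring.
Qed.

Definition lat1 (p : C) : R := complex.Re p - complex.Im p / sin (pi / 3) * cos (pi / 3).

Definition lat2 (p : C) : R := complex.Im p / sin (pi / 3).

Lemma hat_tent_sum w p :
  hat w p = tent_sum (hat0 w) (cell (lat1 p) (lat2 p)) (lat1 p) (lat2 p).
Proof.
rewrite tent_sumE /hat -!/(lat2 p) -!/(lat1 p) -!/(fractional _) /=.
case: ifP => _; rewrite /interp.
  rewrite (_ : (_, _) + mul_tau one2 = (Num.floor (lat1 p), Num.floor (lat2 p) + 1)); last first.
    by congr pair; rewrite /= ?addr0.
  rewrite (_ : (_, _) + one2 = (Num.floor (lat1 p) + 1, Num.floor (lat2 p))); last first.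
    by congr pair; rewrite /= ?addr0.
  by rewrite !rmorphB /=; ring.
rewrite (_ : _ + one2 + mul_tau one2 = (Num.floor (lat1 p) + 1, Num.floor (lat2 p) + 1)); last first.
  by congr pair; rewrite /=; ring.
rewrite (_ : _ + one2 + _ = (Num.floor (lat1 p), Num.floor (lat2 p) + 1)); last first.
  by congr pair; rewrite /=; ring.
rewrite (_ : _ + one2 = (Num.floor (lat1 p) + 1, Num.floor (lat2 p))); last first.
  by congr pair; rewrite /= ?addr0.
by rewrite !rmorphB /= !rmorphD /=; ring.
Qed.

Lemma latK p : (lat1 p)%:C%C + (lat2 p)%:C%C * tau = p.
Proof.
have s0 := @sin_pi3_gt0 R; rewrite /lat1 /lat2 /tau; case: p => x y /=.
have sn : sin (pi / 3) != 0 :> R by rewrite gt_eqF.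
by apply/eqP; rewrite eq_complex /=; apply/andP; split; apply/eqP; field.
Qed.

(** Tents form a partition of unity that reproduces affine functions, so interpolation acts on the
    perturbation [g] alone. *)
Lemma tent_sum_affine (k c : C) (g : A2 -> C) a b :
  tent_sum (fun x => k * emb x + c + g x) (cell a b) a b =
  k * (a%:C%C + b%:C%C * tau) + c + tent_sum g (cell a b) a b.
Proof.
rewrite !tent_sumE /=.
have aE : a = (Num.floor a)%:~R + fractional a by rewrite /fractional; ring.
have bE : b = (Num.floor b)%:~R + fractional b by rewrite /fractional; ring.
rewrite [in RHS](_ : a%:C%C + b%:C%C * tau = ((Num.floor a)%:~R + fractional a)%:C%C
  + ((Num.floor b)%:~R + fractional b)%:C%C * tau); last by rewrite -aE -bE.
move: (Num.floor a) (Num.floor b) (fractional a) (fractional b) => i j s t.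
have RC (n : int) : n%:~R = (n%:~R : R)%:C%C :> C by rewrite (rmorph_int (real_complex R)).
rewrite /emb /= !RC; move: (g _) (g _) (g _) (g _) => g1 g2 g3 g4.
by case: ifP => _; rewrite !(rmorphB, rmorphD) /=; ring.
Qed.

(** Only the tents at the corners of the two cells matter, at most 8 of them, and each is
    1-Lipschitz in the sum of the two coordinate differences. The estimate is global: the points
    need not lie in the same cell. *)
Lemma tent_sum_lipschitz (g : A2 -> C) (r : R) (a b a' b' : R) :
  (forall x, `|complex.Re (g x)| <= r /\ `|complex.Im (g x)| <= r) ->
  let d := tent_sum g (cell a b) a b - tent_sum g (cell a' b') a' b' in
  let e := 8 * r * (`|a - a'| + `|b - b'|) in
  `|complex.Re d| <= e /\ `|complex.Im d| <= e.
Proof.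
move=> gr d e; pose S := undup (cell a b ++ cell a' b').
have uS : uniq S by exact: undup_uniq.
have cS : {subset cell a b <= S} by move=> x xc; rewrite mem_undup mem_cat xc.
have cS' : {subset cell a' b' <= S} by move=> x xc; rewrite mem_undup mem_cat xc orbT.
pose D x := tent (a - x.1%:~R) (b - x.2%:~R) - tent (a' - x.1%:~R) (b' - x.2%:~R).
have r0 : 0 <= r by have [h _] := gr 0; exact: le_trans h.
have sS : ((size S)%:R <= 8 :> R) by rewrite ler_nat; exact: size_undup.
have ab0 : 0 <= `|a - a'| + `|b - b'| by rewrite addr_ge0.
have DL x : `|D x| <= `|a - a'| + `|b - b'|.
  apply: le_trans (tent_lipschitz _ _ _ _) _.
  have -> : a - x.1%:~R - (a' - x.1%:~R) = a - a' by ring.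
  by have -> : b - x.2%:~R - (b' - x.2%:~R) = b - b' by ring.
have bound (h : A2 -> R) : (forall x, `|h x| <= r) -> `|\sum_(x <- S) D x * h x| <= e.
  move=> hr; apply: le_trans (ler_norm_sum _ _ _) _.
  apply: (@le_trans _ _ (\sum_(x <- S) r * (`|a - a'| + `|b - b'|))).
    by apply: ler_sum => x _; rewrite normrM mulrC ler_pM.
  rewrite big_const_seq iter_addr_0 count_predT -mulr_natl /e -mulrA.
  by rewrite ler_wpM2r// mulr_ge0.
have dE : d = \sum_(x <- S) (D x)%:C%C * g x.
  rewrite /d -(tent_sum_cell g uS cS) -(tent_sum_cell g uS cS') /tent_sum -sumrB.
  by apply: eq_bigr => x _; rewrite -mulrBl rmorphB.
rewrite dE !raddf_sum /=; split.
  rewrite (eq_bigr (fun x => D x * complex.Re (g x))).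
    by apply: bound => x; have [] := gr x.
  by move=> x _; case: (g x) => x1 x2 /=; rewrite mul0r subr0.
rewrite (eq_bigr (fun x => D x * complex.Im (g x))).
  by apply: bound => x; have [] := gr x.
by move=> x _; case: (g x) => x1 x2 /=; rewrite mul0r addr0.
Qed.

Section near_standard.
Variables (w : @config R) (l r : R) (c : C) (g : A2 -> C).
Hypothesis wE : forall x, w x = Some (l%:C%C * emb x + c + g x).
Hypothesis gr : forall x, `|complex.Re (g x)| <= r /\ `|complex.Im (g x)| <= r.
Hypotheses (r0 : 0 <= r) (rl : 64 * r < l).

Let U (p : C) := tent_sum g (cell (lat1 p) (lat2 p)) (lat1 p) (lat2 p).

Lemma hat_near_standard p : hat w p = l%:C%C * p + c + U p.
Proof.
rewrite hat_tent_sum (_ : hat0 w = fun x => l%:C%C * emb x + c + g x).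
  by rewrite tent_sum_affine latK.
by apply/funext => x; rewrite /hat0 wE.
Qed.

Let U_lipschitz p q :
  let e := 8 * r * (`|complex.Re (p - q)| + 3 * `|complex.Im (p - q)|) in
  `|complex.Re (U p - U q)| <= e /\ `|complex.Im (U p - U q)| <= e.
Proof.
have [h1 h2] := tent_sum_lipschitz (lat1 p) (lat2 p) (lat1 q) (lat2 q) gr.
move=> e; suff le : 8 * r * (`|lat1 p - lat1 q| + `|lat2 p - lat2 q|) <= e.
  by split; [exact: le_trans h1 le|exact: le_trans h2 le].
rewrite /e ler_wpM2l ?mulr_ge0//.
have s0 := @sin_pi3_gt0 R; have s2 := @sinpi3_sqr R.
rewrite /lat1 /lat2 cos_pi3; set s := sin _ in s0 s2 *.
have s1 : 1 / 2 <= s by nra.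
rewrite [complex.Re (p - q)]raddfB [complex.Im (p - q)]raddfB /=; move: (complex.Re p) (complex.Re q) (complex.Im p) (complex.Im q).
move=> x x' y y'.
have -> : x - y / s * 2^-1 - (x' - y' / s * 2^-1) = (x - x') - (y - y') / s / 2 by ring.
have -> : y / s - y' / s = (y - y') / s by ring.
have h3 : `|(y - y') / s| <= 2 * `|y - y'|.
  by rewrite normrM normfV (gtr0_norm s0) ler_pdivrMr//; have := normr_ge0 (y - y'); nra.
have := ler_normB (x - x') ((y - y') / s / 2); rewrite [`|_ / 2|]normrM.
by rewrite (_ : `|2^-1| = 2^-1 :> R); [lra|rewrite ger0_norm].
Qed.

(** The interpolation is l times the identity plus a constant plus a map U of small Lipschitz
    constant. Injectivity needs 48 r < l, as adding the bounds for both coordinates shows. A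
    preimage of y is a fixed point of p -> (y - c - U p) / l, which contracts with factor 32 r / l
    <= 1 / 2 in the sup norm; hence 64 r < l. *)
Lemma bijective_near_standard : bijective (hat w).
Proof.
have l0 : 0 < l by have := r0; have := rl; lra.
have rl' := rl; have r0' := r0.
have inj : injective (hat w).
  move=> p q; rewrite !hat_near_standard => E.
  have {}E : l%:C%C * (p - q) = - (U p - U q).
    transitivity (l%:C%C * p + c + U p - l%:C%C * q - c - U p); first by ring.
    by rewrite E; ring.
  have [h1 h2] := U_lipschitz p q; apply/eqP; rewrite -subr_eq0; apply/eqP.
  move: E h1 h2; move: (p - q) (U p - U q) => [x y] [x' y'] /= [Ex Ey].
  rewrite mul0r subr0 in Ex; rewrite mul0r addr0 in Ey.
  rewrite -normrN -Ex -[`|y'|]normrN -Ey !normrM (gtr0_norm l0) => h1 h2.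
  have nx := normr_ge0 x; have ny := normr_ge0 y.
  have : l * (`|x| + `|y|) <= 48 * r * (`|x| + `|y|) by nra.
  move=> H; have : `|x| + `|y| <= 0 by nra.
  move=> xy; have x0 : `|x| = 0 by lra.
  have y0 : `|y| = 0 by lra.
  by move/eqP: x0; move/eqP: y0; rewrite !normr_eq0 => /eqP -> /eqP ->.
have sur y : exists p, hat w p = y.
  pose f (v : 'rV[R]_2) := ofC ((l^-1)%:C%C * (y - c - U (toC v))).
  have [||v vE] := @row_fixed_point R f (1 / 2).
  - by apply/andP; split; lra.
  - move=> v v'.
    have le_entry (M : 'rV[R]_2) i : `|M 0 i| <= `|M|.
      by rewrite [`|M|]mx_normrE; exact: (le_bigmax _ (fun ij : 'I_1 * 'I_2 => `|M ij.1 ij.2|) (0, i)).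
    have [h1 h2] := U_lipschitz (toC v') (toC v).
    rewrite [`|f v - f v'|]mx_normrE; apply: bigmax_le; first by rewrite mulr_ge0//; lra.
    move=> [i j] _ /=; rewrite ord1 {i}.
    have fE : (f v - f v') 0 j = l^-1 * (if j == 0 then complex.Re (U (toC v') - U (toC v))
        else complex.Im (U (toC v') - U (toC v))).
      rewrite !mxE; case: (y - c) => y1 y2; case: (U (toC v)) => a1 a2; case: (U (toC v')) => b1 b2.
      by case: eqP => _ /=; ring.
    rewrite fE normrM normfV (gtr0_norm l0) ler_pdivrMl//.
    have e0 := le_entry (v' - v) 0; have e1 := le_entry (v' - v) 1.
    rewrite [`|v' - v|]distrC in e0 e1.
    have reE : complex.Re (toC v' - toC v) = (v' - v) 0 0 by rewrite /toC !mxE.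
    have imE : complex.Im (toC v' - toC v) = (v' - v) 0 1 by rewrite /toC !mxE.
    rewrite reE imE in h1 h2.
    have n1 := normr_ge0 ((v' - v) 0 0); have n2 := normr_ge0 ((v' - v) 0 1).
    have : `|if j == 0 then complex.Re (U (toC v') - U (toC v))
        else complex.Im (U (toC v') - U (toC v))| <=
        8 * r * (`|(v' - v) 0 0| + 3 * `|(v' - v) 0 1|) by case: eqP.
    move=> h; apply: le_trans h _; move: `|v - v'| e0 e1 n1 n2 => d.
    move: `|_| `|_| => x1 x2; nra.
  exists (toC v); rewrite hat_near_standard {1}vE ofCK.
  rewrite mulrA -rmorphM /= mulfV ?gt_eqF// mul1r; ring.
pose f y := sval (cid (sur y)).
have fK : cancel f (hat w) by move=> y; rewrite /f; case: cid.
by exists f => // x; apply: inj; rewrite fK.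
Qed.

End near_standard.

End hat_function.

Section near_standard.
Context {R : realType}.
Local Notation C := R[i].
Variables (w : @config R) (alpha l r : R) (N : nat) (g : A2 -> C).
Hypothesis wE : forall x, w x = Some (l%:C%C * emb x + tau + g x).
Hypothesis gr : forall x, `|complex.Re (g x)| <= r /\ `|complex.Im (g x)| <= r.
Hypotheses (r0 : 0 <= r) (r1 : r <= 1 / 16) (rl : 64 * r < l) (ra : 20 * r < alpha).
Hypotheses (la : `|l - 1| < alpha / 2) (l12 : 1 / 2 <= l) (N5 : (5 <= N)%N) (wO : Omega_star l N w).

Let hat0E x : hat0 w x = l%:C%C * emb x + tau + g x.
Proof. by rewrite /hat0 wE. Qed.

Let edgeE x z : hat0 w (x + z) - hat0 w x = l%:C%C * emb z + (g (x + z) - g x).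
Proof. by rewrite !hat0E embD; ring. Qed.

Let gB x y : `|complex.Re (g y - g x)| <= 2 * r /\ `|complex.Im (g y - g x)| <= 2 * r.
Proof.
rewrite !raddfB /=; have [h1 h2] := gr x; have [h3 h4] := gr y.
by split; apply: le_trans (ler_normB _ _) _; lra.
Qed.

Lemma unit_coord (e : C) : sqn e = 1 -> `|complex.Re e| <= 1 /\ `|complex.Im e| <= 1.
Proof.
case: e => a b; rewrite /sqn /= => e1; rewrite !ler_norml.
by split; apply/andP; split; nra.
Qed.

Let small_mul (a b B : R) : `|a| <= 1 -> `|b| <= B -> - B <= a * b <= B.
Proof.
move=> a1 bB; rewrite -ler_norml normrM; apply: le_trans bB.
by rewrite ler_piMl.
Qed.

Lemma dist_near_standard x z : z \in nbrs ->
  `|dist (hat0 w x) (hat0 w (x + z)) - l| <= 10 * r.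
Proof.
move=> zn; have r0' := r0; have rl' := rl.
have e1 := sqn_emb_nbrs (R := R) zn.
have [a1 b1] := unit_coord e1; have [d1 d2] := gB x (x + z).
rewrite distC distE edgeE.
move: (emb z : C) (g (x + z) - g x) e1 a1 b1 d1 d2 => [a b] [c d]; rewrite /sqn /=.
rewrite !(mul0r, subr0, addr0) => e1 a1 b1 d1 d2.
have := small_mul a1 d1; have := small_mul b1 d2 => /andP[h1 h2] /andP[h3 h4].
have c4 : c ^+ 2 <= 4 * r ^+ 2.
  by rewrite -(real_normK (num_real c)); have := normr_ge0 c; nra.
have d4 : d ^+ 2 <= 4 * r ^+ 2.
  by rewrite -(real_normK (num_real d)); have := normr_ge0 d; nra.
have E : (l * a + c) ^+ 2 + (l * b + d) ^+ 2 =
  l ^+ 2 * (a ^+ 2 + b ^+ 2) + 2 * l * (a * c + b * d) + (c ^+ 2 + d ^+ 2) by ring.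
rewrite {}E e1 mulr1; set m := a * c + b * d in h1 h2 h3 h4 *.
have m1 : - (4 * r) <= m by rewrite /m; lra.
have m2 : m <= 4 * r by rewrite /m; lra.
have cd0 : 0 <= c ^+ 2 + d ^+ 2 by rewrite addr_ge0 ?sqr_ge0.
set X := _ + _ + _; have X1 : (l - 10 * r) ^+ 2 <= X by rewrite /X; nra.
have X2 : X <= (l + 10 * r) ^+ 2 by rewrite /X; nra.
have := ler_wsqrtr X1; have := ler_wsqrtr X2.
rewrite !sqrtr_sqr ger0_norm; last lra.
rewrite ger0_norm; last lra.
by rewrite ler_norml => ? ?; apply/andP; split; lra.
Qed.

Lemma cross_near_standard x z : z \in nbrs ->
  0 < cross (hat0 w (x + z) - hat0 w x) (hat0 w (x + mul_tau z) - hat0 w x).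
Proof.
move=> zn; have r0' := r0; have rl' := rl; have l12' := l12.
have zn' : mul_tau z \in nbrs by rewrite nbrs_tau.
have e1 := sqn_emb_nbrs (R := R) zn; have e1' := sqn_emb_nbrs (R := R) zn'.
have [a1 b1] := unit_coord e1; have [a1' b1'] := unit_coord e1'.
have [d1 d2] := gB x (x + z); have [d1' d2'] := gB x (x + mul_tau z).
have ct : cross (emb z : C) (emb (mul_tau z)) = sin (pi / 3).
  rewrite emb_mul_tau tau_mulE; case: (emb z) e1 => a b; rewrite /sqn /cross /= => e1.
  by rewrite -[RHS]mulr1 -e1; ring.
rewrite !edgeE; move: ct e1 e1' a1 b1 d1 d2 a1' b1' d1' d2'.
move: (emb z : C) (g (x + z) - g x) (emb (mul_tau z) : C) (g (x + mul_tau z) - g x).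
move=> [a b] [c d] [a' b'] [c' d']; rewrite /cross /sqn /= !(mul0r, subr0, addr0).
move=> ct _ _ a1 b1 c1 d1 a1' b1' c1' d1'.
have s0 := @sin_pi3_gt0 R; have s2 := @sinpi3_sqr R.
have {}s2 : 1 / 2 <= sin (pi / 3) :> R by nra.
have E : (l * a + c) * (l * b' + d') - (l * b + d) * (l * a' + c') =
   l ^+ 2 * (a * b' - b * a') + l * (a * d' - b * c' + (b' * c - a' * d)) + (c * d' - d * c') by ring.
rewrite {}E ct.
have /andP[h1 _] := small_mul a1 d1'; have /andP[_ h2] := small_mul b1 c1'.
have /andP[h3 _] := small_mul b1' c1; have /andP[_ h4] := small_mul a1' d1.
have prod u v : `|u| <= 2 * r -> `|v| <= 2 * r -> - (4 * r ^+ 2) <= u * v <= 4 * r ^+ 2.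
  move=> u1 v1; rewrite -ler_norml normrM.
  by rewrite (_ : 4 * r ^+ 2 = (2 * r) * (2 * r)); [apply: ler_pM|ring].
have /andP[h5 _] := prod _ _ c1 d1'; have /andP[_ h6] := prod _ _ d1 c1'.
set m := a * d' - b * c' + (b' * c - a' * d).
have m1 : - (8 * r) <= m by rewrite /m; lra.
set k := c * d' - d * c'; have k1 : - (8 * r ^+ 2) <= k by rewrite /k; lra.
have lm : l * m >= l * - (8 * r) by rewrite ler_wpM2l//; lra.
have : l ^+ 2 * (1 / 2) <= l ^+ 2 * sin (pi / 3) by rewrite ler_wpM2l ?sqr_ge0.
nra.
Qed.

Lemma Im_div_gt0 (p q : C) : 0 < cross p q -> 0 < complex.Im (q / p).
Proof.
case: p q => a b [c d] /=; rewrite /cross /= => H.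
have D0 : 0 < a ^+ 2 + b ^+ 2.
  rewrite lt0r addr_ge0 ?sqr_ge0// andbT paddr_eq0 ?sqr_ge0// !sqrf_eq0.
  by apply: contraTN H => /andP[/eqP -> /eqP ->]; rewrite !mul0r subr0 ltxx.
rewrite (_ : _ + _ = (a * d - b * c) / (a ^+ 2 + b ^+ 2)); first by rewrite divr_gt0.
by field; rewrite gt_eqF.
Qed.

Lemma near_standard_regular : regular alpha l N w.
Proof.
have ra' := ra; split=> //.
- move=> x y c d xy wx wy; have /adjE yx := xy.
  have := dist_near_standard x yx; rewrite (_ : x + (y - x) = y); last by rewrite addrC subrK.
  rewrite (hat0_occ wx) (hat0_occ wy); move: la => la'.
  move: la'; rewrite ltr_norml ler_norml => /andP[l1 l2] /andP[d1 d2].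
  by apply/andP; split; lra.
- by move=> x y; rewrite wE.
- by move=> x z zn; apply/Im_div_gt0/cross_near_standard.
Qed.

(** The offset tau = 1 + tau^2 serves the choice of representatives: the first site of I_N is 0, its
    image has coordinates near (1, 1) in the basis (1, tau^2), and perturbations of size 1 / 16 keep
    it inside the fundamental cell because l N >= 5 / 2. *)
Lemma near_standard_Omega : Omega alpha l N w.
Proof.
have [_ O1 O2 O4] := near_standard_regular.
split=> //; last exact: (bijective_near_standard wE gr).
split=> // x c xI wx xmin.
have N0 : (0 < N)%N by exact: leq_trans N5.
have IN0 : nth 0 (IN N) 0 = 0 by case: N N0.
have x0 : x = 0.
  have [/eqP|i0] := eqVneq (index x (IN N)) 0%N.
    by move=> /eqP i0; rewrite -(nth_index 0 xI) i0.
  have s0 : (0 < size (IN N))%N by rewrite size_IN muln_gt0 N0.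
  have := xmin _ (mem_nth 0 s0); rewrite index_uniq ?uniq_IN//.
  by rewrite lt0n i0 wE => /(_ isT).
move: wx; rewrite x0 wE => -[<-] {x0 xmin xI x c}.
have [g1 g2] := gr 0; rewrite (_ : emb 0 = 0 :> C); last by rewrite /emb /= mul0r addr0.
rewrite mulr0 add0r.
have s0 := @sin_pi3_gt0 R; have s2 := @sinpi3_sqr R.
have t2 : tau ^+ 2 = ((- (1 / 2)) +i* sin (pi / 3))%C :> C.
  rewrite tauE /tau cos_pi3 /=; apply/eqP; rewrite eq_complex /=; apply/andP.
  by split; apply/eqP; [field|rewrite subr0].
set s := sin _ in s0 s2 t2.
case: (g 0) g1 g2 => a b /=; have rl' := rl; have l12' := l12; have r0' := r0.
rewrite !ler_norml => /andP[a1 a2] /andP[b1 b2].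
have s1 : 1 / 2 <= s by nra.
have lN : 5 / 2 <= l * N%:R.
  have : (5 <= N%:R :> R) by rewrite (ler_nat R 5 N).
  nra.
have ra' := ra; have la' := la; rewrite ltr_norml in la'; case/andP: la' => la1 la2.
have r64 := r1.
have bs : - (1 / 8) <= b / s <= 1 / 8.
  by rewrite ler_pdivlMr// ler_pdivrMr//; apply/andP; split; nra.
case/andP: bs => bs1 bs2.
exists (1 + a + b / s / 2), (1 + b / s); split; [by apply/andP; split; lra..|].
rewrite t2 /tau cos_pi3 -/s; apply/eqP; rewrite eq_complex /=; apply/andP.
have sn : s != 0 by rewrite gt_eqF.
by split; apply/eqP; field.
Qed.

(** There are 3 edges per site, each with length within 10 r of l, and V is 1-Lipschitz about l;
    hence 30 r. *)
Lemma hamiltonian_near_standard (V : R -> R) (m : R) :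
  (forall s, `|s - 1| <= alpha -> `|V s - V l| <= `|s - l|) ->
  hamiltonian V m N w <= (N * N)%:R * (3 * V l + 30 * r).
Proof.
move=> Vl; rewrite hamiltonianE.
rewrite [X in m * X]big1 ?mulr0 ?addr0; last by move=> x _; rewrite /hole wE.
have ra' := ra; have la' := la; rewrite ltr_norml in la'; case/andP: la' => la1 la2.
rewrite -ler_pdivlMl ?invr_gt0// invrK.
apply: (@le_trans _ _ (\sum_(x <- IN N) (6 * (V l + 10 * r)))).
  apply: ler_sum => x _.
  apply: (@le_trans _ _ (\sum_(z <- nbrs) (V l + 10 * r))); last by rewrite sum_nbrs; lra.
  rewrite big_seq [leRHS]big_seq; apply: ler_sum => z zn.
  rewrite !wE -!hat0E /pair_energy; have := dist_near_standard x zn.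
  move: (dist _ _) => d dl.
  have d1 : `|d - 1| <= alpha.
    by move: dl; rewrite !ler_norml => /andP[? ?]; apply/andP; split; lra.
  by have := le_trans (Vl _ d1) dl; rewrite ler_norml => /andP[_ ?]; lra.
rewrite big_const_seq iter_addr_0 count_predT size_IN -[leLHS]mulr_natl.
by move: (N * N)%:R => q; rewrite [leRHS](_ : _ = q * (6 * (V l + 10 * r)))//; ring.
Qed.

End near_standard.

(** * Translations and the reference measure *)

Notation pushforward_meas mu mf :=
  (measure_function_pushforward__canonical__measure_function_Measure mu mf).

Section tuple_measure.
Context {d} {T : measurableType d} {R : realType}.
Variable mu : {sigma_finite_measure set T -> \bar R}.
Variable n : nat.
Local Open Scope ereal_scope.

Definition box (A : 'I_n -> set T) : set (n.-tuple T) :=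
  [set t | forall i, A i (tnth t i)].

Lemma measurable_box A : (forall i, measurable (A i)) -> measurable (box A).
Proof.
move=> mA; rewrite (_ : box A = \bigcap_(i in [set: 'I_n]) ((fun t => tnth t i) @^-1` A i)).
  apply: fin_bigcap_measurable; first exact: finite_finset.
  move=> i _; rewrite -[X in measurable X]setTI; exact: measurable_tnth.
by apply/seteqP; split=> t /= tA i => [_|]; exact: tA.
Qed.

Let boxes : set (set (n.-tuple T)) :=
  [set B | exists2 A, (forall i, measurable (A i)) & B = box A].

Let measurable_boxes : measurable = <<s boxes >> :> set (set (n.-tuple T)).
Proof.
apply/seteqP; split; last first.
  apply: smallest_sub; first exact: sigma_algebra_measurable.
  by move=> _ [A mA ->]; exact: measurable_box.
apply: smallest_sub; first exact: smallest_sigma_algebra.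
move=> B; rewrite -bigcup_seq /= => -[i _ [A mA <-]].
apply: sub_sigma_algebra; exists (fun j => if j == i then A else setT).
  by move=> j; case: ifP.
rewrite setTI; apply/seteqP; split=> t /=; first by move=> tA j; case: eqP => // ->.
by move=> /(_ i); rewrite eqxx.
Qed.

(** Boxes form a pi-system that generates the product sigma-algebra and contains an exhaustion by
    sets of finite measure. *)
Lemma power_measure_unique (nu : {measure set (n.-tuple T) -> \bar R}) :
  (forall A, (forall i, measurable (A i)) -> nu (box A) = \prod_(i < n) mu (A i)) ->
  forall B, measurable B -> nu B = power_measure mu n B.
Proof.
move=> nuE; have /sigma_finiteP[F [TF ndF Foo]] := sigma_finiteT mu.
have bE (A : 'I_n -> set T) : (forall i, measurable (A i)) ->
    power_measure mu n (box A) = \prod_(i < n) mu (A i).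
  exact: power_measure_box.
apply: (measure_unique boxes (fun k => box (fun=> F k))).
- exact: measurable_boxes.
- move=> _ _ [A mA ->] [B mB ->]; exists (fun i => A i `&` B i).
    by move=> i; exact: measurableI.
  by apply/seteqP; split=> t /= => [[h1 h2] i|h]; [split|split=> i; have [] := h i].
- by move=> k; exists (fun=> F k) => // i; have [] := Foo k.
- apply/seteqP; split=> // t _.
  have tF i : exists k, F k (tnth t i).
    by have : setT (tnth t i) by []; rewrite TF => -[k _ ?]; exists k.
  have [k kE] := choice tF.
  exists (\max_(i < n) k i)%N => // i; have := kE i.
  exact/subsetPset/ndF/leq_bigmax.
- by move=> _ [A mA ->]; rewrite nuE//; exact/esym/bE.
- move=> k; rewrite nuE; last by move=> i; have [] := Foo k.
  elim: n => [|m IH]; first by rewrite big_ord0 ltry.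
  rewrite big_ord_recl /= lte_mul_pinfty//; have [_ Fk] := Foo k => //.
  by rewrite ge0_fin_numE.
Qed.

Variables (f : 'I_n -> T -> T) (p p' : 'I_n -> 'I_n).
Hypotheses (pK : cancel p p') (p'K : cancel p' p).
Hypothesis mf : forall i, measurable_fun setT (f i).
Hypothesis muf : forall i A, measurable A -> mu (f i @^-1` A) = mu A.

(** Lattice translations act in this form on configurations restricted to I_N: the sites are
    permuted, and each spin is moved by a period. *)
Definition perm_tuple (t : n.-tuple T) : n.-tuple T := [tuple f i (tnth t (p i)) | i < n].

Lemma measurable_perm_tuple : measurable_fun setT perm_tuple.
Proof.
apply/measurable_fun_tnthP => i.
rewrite (_ : _ \o _ = f i \o (fun t => tnth t (p i))).
  by apply: measurableT_comp => //; exact: measurable_tnth.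
by apply/funext => t /=; rewrite tnth_mktuple.
Qed.

Lemma power_measure_perm B : measurable B ->
  power_measure mu n (perm_tuple @^-1` B) = power_measure mu n B.
Proof.
move=> mB.
rewrite -[LHS]/(pushforward_meas (power_measure mu n) measurable_perm_tuple B).
apply: power_measure_unique => // A mA /=; rewrite /pushforward.
have -> : perm_tuple @^-1` box A = box (fun j => f (p' j) @^-1` A (p' j)).
  apply/seteqP; split=> t /= tA i.
    by have := tA (p' i); rewrite tnth_mktuple p'K.
  by have := tA (p i); rewrite tnth_mktuple pK.
rewrite power_measure_box; last by move=> i; rewrite -[X in measurable X]setTI; exact: mf.
rewrite (reindex p) /=; last by apply: onW_bij; exists p'.
by apply: eq_bigr => i _; rewrite pK muf.
Qed.

End tuple_measure.

Section spin_shift.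
Context {R : realType}.
Local Notation C := R[i].

Lemma lebesgue_measure_shift (c : R) (A : set (measurableTypeR R)) : measurable A ->
  lebesgue_measure ((fun x => x + c) @^-1` A) = lebesgue_measure A.
Proof.
move=> mA; have mc : measurable_fun setT (fun x : measurableTypeR R => x + c : measurableTypeR R).
  exact: measurable_funD.
apply/esym/(lebesgue_measure_unique (mu := pushforward_meas lebesgue_measure mc)) => //= _ [[a b]] _ <-.
rewrite /pushforward (_ : _ @^-1` _ = `]a - c, b - c]%classic).
  rewrite !lebesgue_measure_itv/= !lte_fin ltrD2r.
  by case: ifP => // _; rewrite -!EFinD; congr EFin; ring.
by apply/seteqP; split=> x /=; rewrite !in_itv /= ltrBlDr lerBrDr.
Qed.

Definition shift_plane (c : C) (p : measurableTypeR R * measurableTypeR R) :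
    measurableTypeR R * measurableTypeR R :=
  (p.1 + complex.Re c, p.2 + complex.Im c).

Lemma measurable_shift_plane c : measurable_fun setT (shift_plane c).
Proof.
apply/measurable_fun_pairP; split; rewrite /comp /=.
  by apply: measurable_funD => //; exact: measurable_fst.
by apply: measurable_funD => //; exact: measurable_snd.
Qed.

Definition shift_spin (c : C) : @spin R -> @spin R := omap (fun a => a + c).

Lemma shift_spin_of_plane c p : shift_spin c (of_plane p) = of_plane (shift_plane c p).
Proof. by case: c => a b; rewrite /shift_spin /of_plane /=. Qed.

Lemma preimage_shift_spin c A : of_plane @^-1` (shift_spin c @^-1` A) =
  shift_plane c @^-1` (of_plane @^-1` A).
Proof.
rewrite -[LHS]/((shift_spin c \o of_plane) @^-1` A).
rewrite (_ : shift_spin c \o of_plane = of_plane \o shift_plane c)//.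
by apply/funext => p; exact: shift_spin_of_plane.
Qed.

Lemma measurable_shift_spin c : measurable_fun setT (shift_spin c).
Proof.
move=> _ A mA; rewrite setTI /measurable /= /spin_measurable /=.
rewrite (_ : _ @^-1` _ = shift_plane c @^-1` (of_plane @^-1` A)).
  by rewrite -[X in measurable X]setTI; exact: measurable_shift_plane.
exact: preimage_shift_spin.
Qed.

Lemma spin_measure_shift c A : measurable A ->
  spin_measure (shift_spin c @^-1` A) = spin_measure A.
Proof.
move=> mA; rewrite /spin_measure /pushforward; congr (_ + _)%E.
rewrite preimage_shift_spin.
have mB : measurable (of_plane @^-1` A) by exact: mA.
rewrite [RHS](@product_measure_unique _ _ _ _ _ lebesgue_measure lebesgue_measure
  (pushforward_meas (lebesgue_measure \x lebesgue_measure)%E (measurable_shift_plane c)))//.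
move=> X Y mX mY; rewrite /= /pushforward.
rewrite (_ : _ @^-1` _ = ((fun x => x + complex.Re c) @^-1` X) `*` ((fun x => x + complex.Im c) @^-1` Y)) //.
have mc (b : R) (Z : set (measurableTypeR R)) : measurable Z ->
    measurable ((fun x => x + b) @^-1` Z : set (measurableTypeR R)).
  by move=> mZ; rewrite -[X in measurable X]setTI; apply: measurable_funD.
rewrite product_measure1E; [|exact: mc..].
by congr (_ * _)%E; exact: lebesgue_measure_shift.
Qed.

End spin_shift.

(** * Unfolding one fundamental domain into another *)

Section fundamental_domain.
Context {d} {T : measurableType d} {R : realType} (mu : {measure set T -> \bar R}).
Local Notation Z := A2.
Variable Q : Z -> T -> T.
Hypothesis mQ : forall z, measurable_fun setT (Q z).
Hypothesis muQ : forall z A, measurable A -> mu (Q z @^-1` A) = mu A.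
Hypothesis QN : forall z t, Q z (Q (- z)%R t) = t.
Local Open Scope ereal_scope.

Lemma integral_preserving (h : T -> T) (B : set T) (g : T -> \bar R) :
  measurable_fun setT h -> (forall A, measurable A -> mu (h @^-1` A) = mu A) ->
  measurable B -> measurable_fun setT g -> (forall t, 0 <= g t) ->
  \int[mu]_(t in h @^-1` B) g (h t) = \int[mu]_(t in B) g t.
Proof.
move=> mh muh mB mg g0.
rewrite -(ge0_integral_pushforward mh mu mB)//; last exact: measurable_funS mg.
apply: eq_measure_integral => /= A mA _; exact: muh.
Qed.

Variables (E : set T) (g : T -> \bar R).
Hypotheses (mE : measurable E) (EQ : forall z t, E (Q z t) <-> E t).
Hypotheses (mg : measurable_fun setT g) (g0 : forall t, 0 <= g t).
Hypotheses (gQ : forall z t, g (Q z t) = g t) (gE : forall t, ~ E t -> g t = 0).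

(** Uniqueness is demanded only on the invariant set E, outside which the integrand vanishes. *)
Definition fundamental (D : set T) :=
  measurable D /\ forall t, E t -> exists! z, D (Q z t).

Let enum_ok (e : nat -> option Z) :=
  (forall z, exists n, e n = Some z) /\
  (forall m n z, e m = Some z -> e n = Some z -> m = n).

Let piece (D D' : set T) (z : option Z) : set T :=
  if z is Some z then D `&` (Q z @^-1` D') `&` E else set0.

Let mpiece D D' z : measurable D -> measurable D' -> measurable (piece D D' z).
Proof.
move=> mD mD'; case: z => [z|] //=; apply: measurableI => //; apply: measurableI => //.
by rewrite -[X in measurable X]setTI; exact: mQ.
Qed.

Let split_integral e D D' : enum_ok e -> measurable D -> fundamental D' ->
  \int[mu]_(t in D) g t = \sum_(n <oo) \int[mu]_(t in piece D D' (e n)) g t.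
Proof.
move=> [e1 e2] mD [mD' fD'].
rewrite -ge0_integral_bigcup//; last 3 first.
- by move=> n; exact: mpiece.
- exact: measurable_funS mg.
- move=> m n _ _ [t []]; rewrite /piece.
  case em : (e m) => [z|//]; case en : (e n) => [z'|//].
  move=> [[_ h1] Et] [[_ h2] _]; have [y [_ uy]] := fD' t Et.
  have zz : z = z' by rewrite -(uy _ h1) -(uy _ h2).
  by apply: (e2 _ _ _ em); rewrite zz.
have -> : \bigcup_n piece D D' (e n) = D `&` E.
  apply/seteqP; split=> [t [n _]|t [Dt Et]].
    by rewrite /piece; case: (e n) => [z [[]]|].
  have [z [zD' _]] := fD' t Et; have [n en] := e1 z.
  by exists n => //; rewrite /piece en.
rewrite integral_mkcond [RHS]integral_mkcond; apply: eq_integral => t _.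
rewrite !patchE in_setI; case: ifPn => //= tD; case: ifPn => // /negP tE.
by rewrite gE// => Et; apply: tE; rewrite inE.
Qed.

(** Cut D into the pieces sent into D' by [Q z], one for each z. Since [Q z] preserves the measure
    and the integrand, the integral over such a piece equals that over the piece of D' sent into D
    by [Q (- z)], and these exhaust D' within E. *)
Lemma integral_fundamental D D' : fundamental D -> fundamental D' ->
  \int[mu]_(t in D) g t = \int[mu]_(t in D') g t.
Proof.
move=> fD fD'; pose e n : option Z := pickle_inv n.
have eok : enum_ok e.
  split=> [z|m n z]; first by exists (pickle z); exact: pickleK_inv.
  have eP k : e k = Some z -> pickle z = k.
    by move=> ek; have := @pickle_invK Z k; rewrite /e in ek; rewrite ek.
  by move=> /eP <- /eP.
(* The pieces of D' are enumerated by the opposite shifts, so that the two series agree term by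
   term. *)
pose e' n := omap (fun z : Z => - z)%R (e n).
have eok' : enum_ok e'.
  split=> [z|m n z]; first by have [n en] := eok.1 (- z)%R; exists n; rewrite /e' en /= opprK.
  rewrite /e'; case em : (e m) => [y|//] [yz]; case en : (e n) => [y'|//] [yz'].
  by apply: (eok.2 _ _ y) => //; rewrite en -[y']opprK yz' -yz opprK.
rewrite (split_integral eok fD.1 fD') (split_integral eok' fD'.1 fD).
apply: eq_eseriesr => n _; rewrite /e'; case: (e n) => [z|//] /=.
have QN' t : Q (- z)%R (Q z t) = t by rewrite -{2}[z]opprK QN.
have setE : Q z @^-1` (D' `&` (Q (- z)%R @^-1` D) `&` E) = D `&` (Q z @^-1` D') `&` E.
  apply/seteqP; split=> t /=.
    move=> [[h1 h2] /EQ h3]; split=> //; split=> //.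
    by move: h2; rewrite QN'.
  move=> [[h1 h2] h3]; split; last exact/EQ.
  by split=> //; rewrite QN'.
rewrite -(@integral_preserving (Q z) (D' `&` (Q (- z)%R @^-1` D) `&` E) g)//; last 2 first.
- exact: muQ.
- exact: (mpiece (Some (- z)%R) fD'.1 fD.1).
by rewrite setE; apply: eq_integral => t _; rewrite gQ.
Qed.

End fundamental_domain.

Lemma red_redD N x z : red N (red N x + z) = red N (x + z).
Proof.
have -> : x + z = red N x + z + quo N x *+ N by rewrite {1}(red_quo N x) addrAC.
by rewrite red_periodic.
Qed.

(** * Action of the lattice on restricted configurations *)

Section translation.
Context {R : realType}.
Local Notation C := R[i].
Variables (l : R) (N : nat).
Hypothesis N0 : (0 < N)%N.
Local Notation n := (size (IN N)).
Local Notation restr := (n.-tuple (@spin R)).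
Local Notation ext := (extend l N).
Implicit Types (t : restr) (v x z : A2).

Lemma extend_inj t t' : ext t =1 ext t' -> t = t'.
Proof.
by move=> E; apply/val_inj; rewrite /= -(extend_restr l t) -(extend_restr l t'); exact: eq_map.
Qed.

Definition translate v t : restr := map_tuple (fun x => ext t (x + v)) (in_tuple (IN N)).

Lemma extend_translate v t x : ext (translate v t) x = ext t (x + v).
Proof.
rewrite /translate Omega_star_extend// => y z.
by rewrite -(extend_Omega_star l t N0) addrAC.
Qed.

Lemma translateD v v' t : translate v (translate v' t) = translate (v + v') t.
Proof. by apply: extend_inj => x; rewrite !extend_translate addrA. Qed.

Lemma translate0 t : translate 0 t = t.
Proof. by apply: extend_inj => x; rewrite extend_translate addr0. Qed.

Lemma red_lt x : (index (red N x) (IN N) < n)%N.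
Proof. by rewrite index_mem red_IN. Qed.

Definition site_index x : 'I_n := Ordinal (red_lt x).

Definition site_of (i : 'I_n) : A2 := nth 0 (IN N) i.

Lemma site_of_IN i : site_of i \in IN N.
Proof. exact/mem_nth/ltn_ord. Qed.

Lemma site_ofK i : site_index (site_of i) = i.
Proof.
apply/val_inj => /=; rewrite (redK (site_of_IN i)).1 index_uniq ?uniq_IN//.
Qed.

Lemma site_indexK x : site_of (site_index x) = red N x.
Proof. by rewrite /site_of nth_index// red_IN. Qed.

Lemma extendE t x :
  ext t x = shift_spin ((l * N%:R)%:C%C * emb (quo N x)) (tnth t (site_index x)).
Proof. by rewrite /extend (tnth_nth None). Qed.

Lemma extend_site t i : ext t (site_of i) = tnth t i.
Proof.
rewrite extendE site_ofK (redK (site_of_IN i)).2.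
rewrite (_ : emb 0 = 0 :> C); last by rewrite /emb /= mul0r addr0.
by rewrite mulr0 /shift_spin; case: (tnth t i) => //= c; rewrite addr0.
Qed.

Lemma translate_perm v : translate v = perm_tuple
  (fun i => shift_spin ((l * N%:R)%:C%C * emb (quo N (site_of i + v))))
  (fun i => site_index (site_of i + v)).
Proof.
apply/funext => t; apply: eq_from_tnth => i; rewrite tnth_mktuple tnth_map.
by rewrite extendE (tnth_nth 0).
Qed.

Lemma site_permK v :
  cancel (fun i => site_index (site_of i + v)) (fun i => site_index (site_of i - v)).
Proof.
move=> i; apply/val_inj => /=.
by rewrite site_indexK red_redD addrK (redK (site_of_IN i)).1 index_uniq ?uniq_IN ?ltn_ord.
Qed.

Local Notation mu := (power_measure (@spin_measure R) n).

Lemma measurable_translate v : measurable_fun setT (translate v).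
Proof.
by rewrite translate_perm; apply: measurable_perm_tuple => i; exact: measurable_shift_spin.
Qed.

Lemma measure_translate v A : measurable A -> mu (translate v @^-1` A) = mu A.
Proof.
move=> mA; rewrite translate_perm.
apply: (power_measure_perm (p' := fun i => site_index (site_of i - v))).
- exact: site_permK.
- by move=> i; have := site_permK (- v) i; rewrite opprK.
- by move=> i; exact: measurable_shift_spin.
- by move=> i B mB; exact: spin_measure_shift.
- exact: mA.
Qed.

Definition fund : set restr := [set t | forall x c, x \in IN N -> ext t x = Some c ->
  (forall y, y \in IN N -> (index y (IN N) < index x (IN N))%N -> ext t y = None) ->
  Lambda (l * N%:R) c].

(** Shifts by periods fix the configuration consisting of holes only, so orbits have a unique
    representative only on this set. *)
Definition occupied : set restr := [set t | exists x, ext t x <> None].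

Lemma measurable_occ (i : 'I_n) : measurable [set t : restr | tnth t i <> None].
Proof.
have := measurable_tnth i measurableT (measurableC (@measurable_hole R)).
by rewrite setTI.
Qed.

Lemma occupiedE : occupied = \bigcup_(i in [set: 'I_n]) [set t | tnth t i <> None].
Proof.
apply/seteqP; split=> [t [x xN]|t [i _ iN]].
  exists (site_index x) => //= E; apply: xN; by rewrite extendE E.
by exists (site_of i); rewrite extend_site.
Qed.

Lemma measurable_occupied : measurable occupied.
Proof.
rewrite occupiedE; apply: fin_bigcup_measurable; first exact: finite_finset.
by move=> i _; exact: measurable_occ.
Qed.

Lemma occupied_translate v t : occupied (translate v t) <-> occupied t.
Proof.
split=> -[x xN]; first by exists (x + v); rewrite -extend_translate.
by exists (x - v); rewrite extend_translate subrK.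
Qed.

Hypothesis l0 : 0 < l.

(** [lam1] and [lam2] are the coordinates in the basis (1, tau^2) that describes the cell
    [Lambda]. *)
Definition lam1 (c : C) : R := complex.Re c + complex.Im c / sin (pi / 3) / 2.
Definition lam2 (c : C) : R := complex.Im c / sin (pi / 3).

Lemma tau2 : tau ^+ 2 = ((- (1 / 2)) +i* sin (pi / 3))%C :> C.
Proof.
rewrite tauE /tau cos_pi3 /=; apply/eqP; rewrite eq_complex /=; apply/andP.
by split; apply/eqP; [field|rewrite subr0].
Qed.

Lemma LambdaE (L : R) (c : C) : Lambda L c <-> 0 <= lam1 c < L /\ 0 <= lam2 c < L.
Proof.
have sn : sin (pi / 3) != 0 :> R by rewrite gt_eqF// sin_pi3_gt0.
rewrite /Lambda /lam1 /lam2 tau2 /=; split=> [[s [t [sL tL ->]]]|[h1 h2]].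
  rewrite /= !(mul0r, mulr0, subr0, addr0, add0r, mul0r).
  rewrite (_ : _ + _ = s); last by field.
  by rewrite (_ : _ / _ = t); last by field.
exists (complex.Re c + complex.Im c / sin (pi / 3) / 2), (complex.Im c / sin (pi / 3)).
split=> //; case: c {h1 h2} => a b /=; apply/eqP; rewrite eq_complex /=; apply/andP.
by split; apply/eqP; field.
Qed.

Lemma measurable_Lambda (L : R) :
  measurable [set s : @spin R | if s is Some c then Lambda L c else True].
Proof.
rewrite /measurable /= /spin_measurable /=.
pose f1 (p : measurableTypeR R * measurableTypeR R) : R := p.1 + p.2 / sin (pi / 3) / 2.
pose f2 (p : measurableTypeR R * measurableTypeR R) : R := p.2 / sin (pi / 3).
rewrite (_ : _ @^-1` _ = (f1 @^-1` `[0, L[) `&` (f2 @^-1` `[0, L[)); last first.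
  apply/seteqP; split=> p /=; rewrite !in_itv /=.
    exact: (LambdaE L (p.1 +i* p.2)%C).1.
  exact: (LambdaE L (p.1 +i* p.2)%C).2.
have mf2 : measurable_fun setT f2.
  by apply: measurable_funM => //; exact: measurable_snd.
have mf1 : measurable_fun setT f1.
  apply: measurable_funD; first exact: measurable_fst.
  by apply: measurable_funM => //.
apply: measurableI; rewrite -[X in measurable X]setTI; [exact: mf1|exact: mf2].
Qed.

Lemma measurable_fund : measurable fund.
Proof.
rewrite (_ : fund = \bigcap_(i in [set: 'I_n])
    ((\bigcup_(j in [set j : 'I_n | (j < i)%N]) [set t : restr | tnth t j <> None]) `|`
     ((fun t : restr => tnth t i) @^-1`
        [set s : @spin R | if s is Some c then Lambda (l * N%:R) c else True]))).
  apply: fin_bigcap_measurable; first exact: finite_finset.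
  move=> i _; apply: measurableU.
    apply: fin_bigcup_measurable; first exact: finite_finset.
    by move=> j _; exact: measurable_occ.
  rewrite -[X in measurable X]setTI; apply: measurable_tnth => //.
  exact: measurable_Lambda.
apply/seteqP; split=> t tF.
  move=> i _; have [[j [ji jN]]|H] := pselect (exists j : 'I_n, (j < i)%N /\ tnth t j <> None).
    by left; exists j.
  right; rewrite /=; case ti : (tnth t i) => [c|//]; apply: (tF (site_of i)).
  - exact: site_of_IN.
  - by rewrite extend_site.
  move=> y yI; rewrite [in X in (_ < X)%N]/site_of index_uniq ?uniq_IN ?ltn_ord// => yi.
  have yE : y = site_of (site_index y) by rewrite site_indexK (redK yI).1.
  apply: contrapT => yN; apply: H; exists (site_index y); split.
    by rewrite /= (redK yI).1.
  by rewrite -extend_site -yE.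
move=> x c xI xc xmin; have xE : x = site_of (site_index x) by rewrite site_indexK (redK xI).1.
have [[j /= jx jN]|] := tF (site_index x) I.
  exfalso; apply: jN; rewrite -extend_site; apply: xmin; first exact: site_of_IN.
  by rewrite /site_of index_uniq ?uniq_IN ?ltn_ord//; move: jx; rewrite (redK xI).1.
by rewrite /= -extend_site -xE xc.
Qed.

Lemma extend_period z t x : ext (translate (z *+ N) t) x =
  omap (fun c => c + (l * N%:R)%:C%C * emb z) (ext t x).
Proof. by rewrite extend_translate extend_Omega_star//; case: (ext t x). Qed.

Lemma Lambda_translate (L : R) (c : C) : 0 < L -> exists! z : A2, Lambda L (c + L%:C%C * emb z).
Proof.
move=> L0; have sn : sin (pi / 3) != 0 :> R by rewrite gt_eqF// sin_pi3_gt0.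
have E z : lam1 (c + L%:C%C * emb z) = lam1 c + L * (z.1 + z.2)%:~R /\
    lam2 (c + L%:C%C * emb z) = lam2 c + L * z.2%:~R.
  rewrite /lam1 /lam2 /emb /tau cos_pi3; case: z => a b /=.
  have RC (k : int) : k%:~R = (k%:~R : R)%:C%C :> C by rewrite (rmorph_int (real_complex R)).
  by rewrite !RC; case: c => c1 c2 /=; rewrite rmorphD /=; split; field.
have itv (r : R) (k : int) : 0 <= r + L * k%:~R < L <-> Num.floor (r / L) = - k.
  have := floor_itv (r / L); set f := Num.floor _.
  rewrite ler_pdivlMr// ltr_pdivrMr// rmorphD /= => /andP[f1 f2].
  split=> [/andP[h1 h2]|fk]; last first.
    by move: f1 f2; rewrite fk rmorphN /= => f1 f2; apply/andP; split; lra.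
  apply: floor_def; rewrite rmorphD rmorphN /= ler_pdivlMr// ltr_pdivrMr//.
  by apply/andP; split; lra.
have P z : Lambda L (c + L%:C%C * emb z) <->
    Num.floor (lam1 c / L) = - (z.1 + z.2) /\ Num.floor (lam2 c / L) = - z.2.
  by rewrite LambdaE (E z).1 (E z).2; split=> -[/itv h1 /itv h2].
exists (- Num.floor (lam1 c / L) + Num.floor (lam2 c / L), - Num.floor (lam2 c / L)).
split; first by apply/P; split; rewrite /=; lia.
by move=> [a b] /P[/= h1 h2]; congr pair; lia.
Qed.

(** The first occupied site of I_N is the same for all shifts by periods, and such a shift moves its
    spin by l N z; exactly one of these points lies in the cell. *)
Lemma fund_unique t : occupied t -> exists! z, fund (translate (z *+ N) t).
Proof.
rewrite occupiedE => -[i0 _ /= i0N].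
have [i iN imin] : exists2 i : 'I_n, tnth t i <> None & forall j : 'I_n, (j < i)%N -> tnth t j = None.
  case: (@arg_minnP _ i0 (fun i => tnth t i != None) (fun i => i : nat)); first exact/eqP.
  move=> i /eqP iN imin; exists i => // j ji; apply/eqP; apply: contraTT ji => /imin.
  by rewrite -leqNgt.
case ti : (tnth t i) iN => [c|//] _.
have lN0 : 0 < l * N%:R by rewrite mulr_gt0// ltr0n.
have P z : fund (translate (z *+ N) t) <-> Lambda (l * N%:R) (c + (l * N%:R)%:C%C * emb z).
  split=> [|cL x d xI].
    move=> /(_ (site_of i) (c + (l * N%:R)%:C%C * emb z) (site_of_IN i)); apply.
      by rewrite extend_period extend_site ti.
    move=> y yI; rewrite [in X in (_ < X)%N]/site_of index_uniq ?uniq_IN ?ltn_ord// => yi.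
    rewrite extend_period (_ : y = site_of (site_index y)) ?site_indexK ?(redK yI).1//.
    rewrite -[in ext t _](redK yI).1 -site_indexK extend_site imin//.
    by rewrite /= (redK yI).1.
  rewrite extend_period => xd xmin.
  have xE : x = site_of (site_index x) by rewrite site_indexK (redK xI).1.
  have xiE : index x (IN N) = site_index x by rewrite /= (redK xI).1.
  suff ix : site_index x = i.
    by move: xd; rewrite xE ix extend_site ti /= => -[<-].
  apply/val_inj/eqP; rewrite eqn_leq; apply/andP; split.
    rewrite leqNgt; apply/negP => ix.
    have := xmin (site_of i) (site_of_IN i); rewrite xiE.
    rewrite /site_of index_uniq ?uniq_IN ?ltn_ord// => /(_ ix).
    by rewrite -/(site_of i) extend_period extend_site ti.
  rewrite leqNgt; apply/negP => /imin xN.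
  by move: xd; rewrite xE extend_site xN.
have [z [zL zu]] := Lambda_translate c lN0.
by exists z; split=> [|y /P]; [exact/P|exact: zu].
Qed.

End translation.

(** * Volume of the regular configurations *)

Section spin_box.
Context {R : realType}.
Local Notation C := R[i].
Local Open Scope ereal_scope.

Definition spin_box (c : C) (r : R) : set (@spin R) :=
  [set s | if s is Some a then `|complex.Re a - complex.Re c| <= r /\
                               `|complex.Im a - complex.Im c| <= r else False]%R.

Let itv_measure (x r : R) : (0 <= r)%R ->
  lebesgue_measure [set y : measurableTypeR R | `|y - x| <= r]%R = (2 * r)%:E.
Proof.
move=> r0; rewrite (_ : [set y | _] = `[(x - r)%R, (x + r)%R]%classic).
  rewrite lebesgue_measure_itv /= lte_fin; case: ifPn => [_|].
    by rewrite -EFinD; congr EFin; ring.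
  rewrite -leNgt => h; congr EFin; lra.
by apply/seteqP; split=> y /=; rewrite in_itv /= ler_distl.
Qed.

Let itv_measurable (x r : R) : measurable [set y : measurableTypeR R | `|y - x| <= r]%R.
Proof.
rewrite (_ : [set y | _] = `[(x - r)%R, (x + r)%R]%classic)//.
by apply/seteqP; split=> y /=; rewrite in_itv /= ler_distl.
Qed.

Let spin_box_plane c r : of_plane @^-1` spin_box c r =
  [set y : measurableTypeR R | `|y - complex.Re c| <= r]%R `*`
  [set y : measurableTypeR R | `|y - complex.Im c| <= r]%R.
Proof. by []. Qed.

Lemma measurable_spin_box c r : measurable (spin_box c r).
Proof.
rewrite /measurable /= /spin_measurable /= spin_box_plane.
by apply: measurableX; exact: itv_measurable.
Qed.

Lemma spin_box_measure c r : (0 <= r)%R -> spin_measure (spin_box c r) = (4 * r ^+ 2)%:E.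
Proof.
move=> r0; rewrite /spin_measure /pushforward spin_box_plane product_measure1E//.
have E x := itv_measure x r0; rewrite /= in E.
rewrite [X in X * _]E [X in _ * X]E diracE memNset// adde0 -EFinM; congr EFin; ring.
Qed.

Lemma spin_hole_measure : spin_measure [set None : @spin R] = 1.
Proof.
rewrite /spin_measure /pushforward (_ : _ @^-1` _ = set0); last by apply/seteqP; split.
by rewrite measure0 add0e diracE mem_set.
Qed.

End spin_box.

Section chain.
Context {R : realType}.
Local Notation C := R[i].

(* Reading the sites of I_N one after the other, each occupied site lies, up to a
   translation, within a bounded distance of the previously read occupied one. *)
Fixpoint chain (L : R) (ss : seq C) (prev : option C) (ts : seq (@spin R)) : Prop :=
  match ss, ts with
  | s :: ss', Some a :: ts' =>
      (if prev is Some c then spin_box (c - s) 20 (Some a) else spin_box 0 L (Some a))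
      /\ chain L ss' (Some (a + s)) ts'
  | s :: ss', None :: ts' => chain L ss' prev ts'
  | _, _ => True
  end.

(* 1601 = 4 * 20 ^ 2 + 1: the area of the box of half-side 20 plus the mass of the
   hole. *)
Variables (K : R) (K1601 : 1601 <= K).

Let K1 : 1 <= K. Proof. by have h := K1601; lra. Qed.

Let Kn0 n : 0 <= K ^+ n.
Proof. by apply: exprn_ge0; have h := K1; lra. Qed.

Definition chain_bound (L : R) (prev : option C) (n : nat) : R :=
  (if prev is Some _ then 1 else 1 + 4 * L ^+ 2) * K ^+ n.

Lemma chain_bound_ge0 L prev n : 0 <= chain_bound L prev n.
Proof.
rewrite mulr_ge0 ?Kn0//; case: prev => //.
by have := sqr_ge0 L; lra.
Qed.

(** Fubini on the first spin: a hole has mass 1 and leaves [prev] unchanged, while an occupied spin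
    is confined to a box of area 1600, or 4 L^2 if it is the first one. Thus each site costs at most
    K, and the factor 1 + 4 L^2 is paid once, by whichever site comes first. *)
Lemma measure_chain L : 0 <= L -> forall n (ss : seq C) prev (D : set (n.-tuple (@spin R))),
  size ss = n -> measurable D -> (forall t, D t -> chain L ss prev t) ->
  (power_measure (@spin_measure R) n D <= (chain_bound L prev n)%:E)%E.
Proof.
move=> L0; elim=> [|n IH] ss prev D.
  move=> _ mD _ /=; apply: (@le_trans _ _ (\d_([tuple] : 0.-tuple (@spin R)) setT)).
    by apply: le_measure; rewrite ?inE.
  rewrite diracT lee_fin /chain_bound expr0 mulr1; case: prev => //.
  by have := sqr_ge0 L; lra.
case: ss => [//|s ss] [sn] mD Dch /=.
rewrite /pushforward /product_measure1.
set X := _ @^-1` D.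
have mX : measurable X.
  rewrite -[X in measurable X]setTI /X.
  exact: measurable_cons.
pose B : set (@spin R) :=
  [set x | if prev is Some c then spin_box (c - s) 20 x else spin_box 0 L x].
have mB : measurable B by rewrite /B; case: prev {Dch B} => [c|]; exact: measurable_spin_box.
pose g x : \bar R := ((chain_bound L prev n)%:E * (\1_[set None] x)%:E
  + (K ^+ n)%:E * (\1_B x)%:E)%E.
have secE x t : xsection X x t -> D [tuple of x :: t].
  by rewrite /xsection /= inE /X.
apply: (@le_trans _ _ (\int[spin_measure]_x g x)%E).
  apply: ge0_le_integral => //.
  - exact: measurable_fun_xsection.
  - by apply: emeasurable_funD; apply: measurable_funeM; apply/measurable_EFinP/measurable_indic => //; exact: measurable_hole.
  move=> x _; have mS : measurable (xsection X x) by exact: measurable_xsection.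
  rewrite /= /g !indicE; case: x mS secE => [a|] mS secE.
    rewrite memNset// mule0 add0e.
    have [aB|aB] := pselect (B (Some a)).
      rewrite mem_set// mule1; have := IH ss (Some (a + s)) (xsection X (Some a)) sn mS.
      rewrite /chain_bound mul1r; apply=> t /secE /Dch /=.
      by case.
    rewrite memNset// mule0.
    rewrite (_ : xsection X (Some a) = set0) ?measure0//.
    apply/seteqP; split=> t // /secE /Dch /= [aB' _]; exact: (aB aB').
  rewrite mem_set// memNset; last by rewrite /B /=; destruct prev => -[].
  rewrite mule1 mule0 adde0; by apply: (IH ss prev _ sn mS) => t /secE /Dch.
rewrite ge0_integralD//; last 4 first.
- by move=> x _; rewrite mule_ge0 ?lee_fin ?chain_bound_ge0.
- by apply: measurable_funeM; apply/measurable_EFinP/measurable_indic => //; exact: measurable_hole.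
- by move=> x _; rewrite mule_ge0 ?lee_fin ?Kn0.
- by apply: measurable_funeM; apply/measurable_EFinP/measurable_indic.
have indZ (A : set (@spin R)) (k : R) : measurable A -> 0 <= k ->
    (\int[spin_measure]_x (k%:E * (\1_A x)%:E) = k%:E * spin_measure A)%E.
  move=> mA k0; rewrite ge0_integralZl//; last exact/measurable_EFinP/measurable_indic.
  by rewrite integral_indic// setIT.
rewrite (indZ _ _ (@measurable_hole R) (chain_bound_ge0 L prev n)) (indZ _ _ mB (Kn0 n)).
rewrite spin_hole_measure mule1.
have -> : spin_measure B = (if prev is Some _ then 1600 else 4 * L ^+ 2)%:E.
  by rewrite /B; case: (prev) => [c|]; rewrite spin_box_measure//; congr EFin; ring.
rewrite -EFinM -EFinD lee_fin /chain_bound [K ^+ n.+1]exprS.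
have p0 : 0 <= K ^+ n by exact: Kn0.
have L2 := sqr_ge0 L.
have K1601' := K1601.
case: prev {Dch B mB g secE} => [_|]; first by rewrite !mul1r; move: (K ^+ n) p0 => p p0; nra.
move: (K ^+ n) (L ^+ 2) p0 L2 => p q p0 q0.
have : 0 <= (1 + 4 * q) * p * (K - 2) by rewrite !mulr_ge0//; lra.
have : 0 <= p * q by rewrite mulr_ge0.
by move=> *; nra.
Qed.

End chain.

Definition nb_rel (x y : A2) : bool := y - x \in nbrs.

(* The sites of I_N, moved by multiples of N so that consecutive ones become
   neighbours: the k-th one is moved to the site with coordinates (k / N, k) in
   the basis (1, tau ^ 2). *)
Definition unroll (N : nat) (e : A2) : A2 := e + site 0 (e.1 + e.2) *+ N.

Lemma site_pair (a b : int) : site a b = (a - b, b).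
Proof. by apply/eqP; rewrite /site /mul_tau xpair_eqE /=; lia. Qed.

Lemma site_mulrn (a b : int) n : site a b *+ n = site (a * n%:Z) (b * n%:Z).
Proof.
elim: n => [|n IH]; first by rewrite mulr0n !mulr0.
rewrite mulrS IH !site_pair; apply/eqP; rewrite xpair_eqE /=.
by apply/andP; split; apply/eqP; rewrite -addn1 PoszD; ring.
Qed.

Lemma unroll_site N (x y : int) : unroll N (site x y) = site x (y + x * N%:Z).
Proof.
rewrite /unroll site_mulrn !site_pair /=; apply/eqP; rewrite xpair_eqE /=.
by apply/andP; split; apply/eqP; ring.
Qed.

Lemma unroll_rows N m : (0 < N)%N ->
  map (unroll N) [seq site x%:Z y%:Z | x <- iota 0 m, y <- iota 0 N] =
  [seq site (k %/ N)%N%:Z k%:Z | k <- iota 0 (m * N)%N].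
Proof.
move=> N0; elim: m => [|m IH]; first by [].
rewrite -[in LHS]addn1 iotaD allpairs_cat map_cat IH mulSnr iotaD map_cat.
congr (_ ++ _); rewrite /= cats0 ?add0n ?addn0.
have -> : iota (m * N)%N N = map (addn (m * N)%N) (iota 0 N) by rewrite -iotaDl addn0.
rewrite -!map_comp.
apply/eq_in_map => y; rewrite mem_iota add0n /= => yN.
rewrite unroll_site divnMDl// divn_small// addn0 PoszD PoszM; congr site; lia.
Qed.

Lemma unroll_INE N : (0 < N)%N -> map (unroll N) (IN N) =
  [seq site (k %/ N)%N%:Z k%:Z | k <- iota 0 (N * N)%N].
Proof. exact: unroll_rows. Qed.

(** Consecutive unrolled sites differ by tau^2 within a row and by 1 + tau^2 = tau at the end of a
    row; both are unit vectors. *)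
Lemma unroll_sorted N : (0 < N)%N -> sorted nb_rel (map (unroll N) (IN N)).
Proof.
move=> N0; rewrite unroll_INE//.
apply/(sortedP 0) => i; rewrite size_map size_iota => iN.
rewrite !(nth_map 0%N) ?size_iota ?(ltnW iN)// !nth_iota ?(ltnW iN)// !add0n.
have : (i.+1 %/ N = i %/ N \/ i.+1 %/ N = (i %/ N).+1)%N.
  by rewrite divnS//; case: (_ %| _)%N; [right|left].
rewrite /nb_rel nbrsE !inE !site_pair; move=> [] -> /=; rewrite !xpair_eqE /=; lia.
Qed.

Section regular_chain.
Context {R : realType}.
Local Notation C := R[i].
Variables (alpha l : R) (N : nat) (w : @config R).
Hypotheses (wr : regular alpha l N w) (a2 : alpha <= 1 / 2) (N0 : (0 < N)%N).

Definition unroll_shift (e : A2) : C := (l * N%:R)%:C%C * emb (site 0 (e.1 + e.2)).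

Lemma unrollE e : w (unroll N e) = omap (fun a => a + unroll_shift e) (w e).
Proof. by have [wO _ _ _] := wr; rewrite /unroll wO /unroll_shift; case: (w e). Qed.

Let unroll_nbE q e : nb_rel q (unroll N e) -> unroll N e = q + (unroll N e - q).
Proof. by rewrite [RHS]addrC subrK. Qed.

(** Invariant of the reading: since holes are isolated, the last occupied spin read sits at the
    current site q, or at a neighbour of q if q is a hole. *)
Definition last_occ (q : A2) (c : C) : Prop :=
  w q = Some c \/ (w q = None /\ exists2 z, z \in nbrs & w (q + z) = Some c).

Let spin_box_of (a c s : C) :
  `|complex.Re (a + s - c)| <= 20 /\ `|complex.Im (a + s - c)| <= 20 ->
  spin_box (c - s) 20 (Some a).
Proof.
rewrite /spin_box; case: a c s => [a1 a2'] [c1 c2] [s1 s2] /= [h1 h2].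
rewrite (_ : a1 - (c1 - s1) = a1 + s1 - c1); last by ring.
by rewrite (_ : a2' - (c2 - s2) = a2' + s2 - c2); last by ring.
Qed.

Lemma chain_occ L es q c : last_occ q c -> path nb_rel q (map (unroll N) es) ->
  chain L (map unroll_shift es) (Some c) (map w es).
Proof.
elim: es q c => [//|e es IH] q c qc /= /andP[qe pe].
have eE := unroll_nbE qe; have wue := unrollE e.
case we : (w e) wue => [a|] /= wue; last first.
  case: qc => [wq|[wq _]]; last first.
    by exfalso; apply: (hole_nbr wr wq qe); rewrite -eE.
  apply: IH pe; right; split=> //; exists (q - unroll N e).
    by rewrite -opprB nbrsN.
  by rewrite [_ + (_ - _)]addrC subrK.
split; last by apply: IH pe; left.
apply: spin_box_of; case: qc => [wq|[wq [z zn wz]]].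
  have := hat0_edge_occ wr a2 (adj_nbrs q qe).
  rewrite -eE (hat0_occ wq) (hat0_occ wue) wq wue => /(_ ltac:(done) ltac:(done)) /andP[_ d2].
  have /sqn_dist_lt[] : dist c (a + unroll_shift e) < 3 by lra.
  case: (a + _) {d2 wue} => b1 b2; case: c {wq} => c1 c2 /= h1 h2.
  by rewrite ![`|b1 - _|]distrC ![`|b2 - _|]distrC; split; lra.
(* Both occupied sites are neighbours of the hole q; passing through its interpolated position gives
   20 = 10 + 10. *)
have [] := hat0_edge_hole wr a2 wq qe; rewrite -eE (hat0_occ wue).
have [] := hat0_edge_hole wr a2 wq zn; rewrite (hat0_occ wz).
case: (a + _) {wue} => b1 b2; case: c {wz} => c1 c2; case: (hat0 w q) => d1 d2 /=.
rewrite !ler_norml => /andP[? ?] /andP[? ?] /andP[? ?] /andP[? ?].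
by split; apply/andP; split; lra.
Qed.

Lemma chain_start L es : uniq es -> sorted nb_rel (map (unroll N) es) ->
  (forall e c, e \in es -> w e = Some c ->
    (forall y, y \in es -> (index y es < index e es)%N -> w y = None) ->
    spin_box 0 L (Some c)) ->
  chain L (map unroll_shift es) None (map w es).
Proof.
elim: es => [//|e es IH] /= /andP[ees ues] pe H.
have wue := unrollE e.
case we : (w e) wue => [a|] /= wue.
  split; last by apply: (@chain_occ L es (unroll N e)) => //; left.
  apply: (H e) => //; first by rewrite mem_head.
  by move=> y _; rewrite eqxx.
apply: IH => //; first exact: path_sorted pe.
move=> e' c e'es we' H'; apply: (H e') => //; first by rewrite inE e'es orbT.
move=> y; rewrite inE => /orP[/eqP ->//|yes].
have ne z : z \in es -> e == z = false by move=> zes; apply: contraNF ees => /eqP ->.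
by rewrite !ne// ltnS; exact: H'.
Qed.

End regular_chain.

Lemma Lambda_box {R : realType} (L : R) (c : R[i]) : 0 <= L -> Lambda L c ->
  spin_box 0 L (Some c).
Proof.
move=> L0 [s [t [/andP[s0 sL] /andP[t0 tL] ->]]].
rewrite tau2 /spin_box /= !(mul0r, mulr0, subr0, addr0, add0r).
have h := sin_le1 (pi / 3 : R); have h0 := @sin_pi3_gt0 R.
by rewrite !ler_norml; split; apply/andP; split; nra.
Qed.

Lemma measure_fund_regular {R : realType} (alpha l : R) (N : nat)
    (D : set ((size (IN N)).-tuple (@spin R))) (K : R) :
  1601 <= K -> alpha <= 1 / 2 -> 0 < l -> (0 < N)%N -> measurable D ->
  (forall t, D t -> fund l t /\ regular alpha l N (extend l N t)) ->
  (power_measure (@spin_measure R) (size (IN N)) D <=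
   ((1 + 4 * (l * N%:R) ^+ 2) * K ^+ (N * N))%:E)%E.
Proof.
move=> K1 a2 l0 N0 mD DP.
have L0 : 0 <= l * N%:R by rewrite mulr_ge0 ?ler0n// ltW.
have := @measure_chain R K K1 (l * N%:R) L0 (size (IN N)) (map (unroll_shift l N) (IN N)) None D.
rewrite -(size_IN N) /chain_bound; apply; rewrite ?size_map// => t /DP[tF tr].
rewrite -[tval t](extend_restr l); apply: (chain_start tr a2) => //.
- exact: uniq_IN.
- exact: unroll_sorted.
by move=> e c eI ec emin; apply: Lambda_box => //; exact: (tF e).
Qed.

(** * The averaged estimate *)

Section spin_functions.
Context {R : realType}.
Local Notation C := R[i].
Implicit Types s : @spin R.

(** Together with [spin_re] and [spin_im] this gives real coordinates on spins. The energy and the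
    interpolation are real expressions in them, from which measurability follows. *)
Definition spin_occ s : R := if s is Some _ then 1 else 0.
Definition spin_re s : R := if s is Some c then complex.Re c else 0.
Definition spin_im s : R := if s is Some c then complex.Im c else 0.

Lemma measurable_spin_fun (f : @spin R -> R) :
  measurable_fun setT (f \o of_plane) -> measurable_fun setT f.
Proof.
move=> mf _ A mA; rewrite setTI /measurable /= /spin_measurable /=.
by have := mf measurableT A mA; rewrite setTI.
Qed.

Lemma measurable_spin_occ : measurable_fun setT spin_occ.
Proof.
apply: measurable_spin_fun; have -> : spin_occ \o of_plane = cst 1 :> (_ -> R) by [].
exact: measurable_cst.
Qed.

Lemma measurable_spin_re : measurable_fun setT spin_re.
Proof.
apply: measurable_spin_fun; have -> : spin_re \o of_plane = fst :> (_ -> R) by [].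
exact: measurable_fst.
Qed.

Lemma measurable_spin_im : measurable_fun setT spin_im.
Proof.
apply: measurable_spin_fun; have -> : spin_im \o of_plane = snd :> (_ -> R) by [].
exact: measurable_snd.
Qed.

End spin_functions.

Section measurable_energy.
Context {R : realType}.
Local Notation C := R[i].
Variables (l : R) (N : nat).
Hypothesis N0 : (0 < N)%N.
Local Notation restr := ((size (IN N)).-tuple (@spin R)).
Local Notation ext := (extend l N).

Lemma measurable_extend (f : @spin R -> R) x : measurable_fun setT f ->
  measurable_fun setT (fun t : restr => f (ext t x)).
Proof.
move=> mf; have -> : (fun t : restr => f (ext t x)) =
    f \o (shift_spin ((l * N%:R)%:C%C * emb (quo N x)) \o (fun t : restr => tnth t (site_index N0 x))).
  by apply/funext => t /=; rewrite extendE.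
apply: (measurableT_comp mf); apply: (measurableT_comp (measurable_shift_spin _)).
exact: measurable_tnth.
Qed.

Let m_occ x := measurable_extend x (@measurable_spin_occ R).
Let m_re x := measurable_extend x (@measurable_spin_re R).
Let m_im x := measurable_extend x (@measurable_spin_im R).

Lemma measurable_hole_ext x : measurable_fun setT (fun t : restr => hole (ext t) x).
Proof.
rewrite (_ : (fun t => _) = fun t : restr => 1 - spin_occ (ext t x)).
  by apply: measurable_funB => //; exact: m_occ.
by apply/funext => t; rewrite /hole /spin_occ; case: (ext t x) => /= *; rewrite ?subrr ?subr0.
Qed.

Lemma measurable_pair_energy (V : R -> R) x y : measurable_fun setT V ->
  measurable_fun setT (fun t : restr => pair_energy V (ext t x) (ext t y)).
Proof.
move=> mV; rewrite (_ : (fun t => _) = fun t : restr =>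
    spin_occ (ext t x) * spin_occ (ext t y) * V (Num.sqrt
      ((spin_re (ext t x) - spin_re (ext t y)) ^+ 2 +
       (spin_im (ext t x) - spin_im (ext t y)) ^+ 2))).
  apply: measurable_funM; first by apply: measurable_funM; exact: m_occ.
  apply: (measurableT_comp mV).
  apply: (measurableT_comp (continuous_measurable_fun (@sqrt_continuous R))).
  apply: measurable_funD; apply: measurable_funX.
    by apply: measurable_funB; exact: m_re.
  by apply: measurable_funB; exact: m_im.
apply/funext => t; rewrite /pair_energy /spin_occ /spin_re /spin_im.
case: (ext t x) => [c|]; last by rewrite !mul0r.
case: (ext t y) => [d|]; last by rewrite mulr0 mul0r.
by rewrite !mul1r distE; case: c d => a b [a' b'].
Qed.

Lemma measurable_hamiltonian (V : R -> R) (m : R) : measurable_fun setT V ->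
  measurable_fun setT (fun t : restr => hamiltonian V m N (ext t)).
Proof.
move=> mV; rewrite (_ : (fun t => _) = fun t : restr =>
  2^-1 * (\sum_(x <- IN N) \sum_(z <- nbrs) pair_energy V (ext t x) (ext t (x + z)))
  + m * \sum_(x <- IN N) hole (ext t) x); last by apply/funext => t; rewrite hamiltonianE.
apply: measurable_funD; apply: measurable_funM => //.
  apply: measurable_sum => x; apply: measurable_sum => z; exact: measurable_pair_energy.
by apply: measurable_sum => x; exact: measurable_hole_ext.
Qed.

Let hat_re (w : @config R) x : R := spin_re (w x) +
  (1 - spin_occ (w x)) * (6^-1 * \sum_(z <- nbrs) spin_re (w (x + z))).
Let hat_im (w : @config R) x : R := spin_im (w x) +
  (1 - spin_occ (w x)) * (6^-1 * \sum_(z <- nbrs) spin_im (w (x + z))).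

Let hat0_reim (w : @config R) x : hat0 w x = (hat_re w x +i* hat_im w x)%C.
Proof.
rewrite /hat0 /hat_re /hat_im /spin_occ.
case: (w x) => [[a b]|] /=; first by rewrite subrr !mul0r !addr0.
rewrite subr0 !mul1r !add0r.
have -> : (6^-1 : C) = (6^-1 : R)%:C%C by rewrite fmorphV rmorph_nat.
rewrite (_ : \sum_(z <- nbrs) odflt 0 (w (x + z)) =
  ((\sum_(z <- nbrs) spin_re (w (x + z))) +i* (\sum_(z <- nbrs) spin_im (w (x + z))))%C).
  by apply/eqP; rewrite eq_complex /= !mul0r subr0 addr0 !eqxx.
rewrite !sum_nbrs /spin_re /spin_im.
by do 6![case: (w _) => [[? ?]|]] => /=; apply/eqP; rewrite eq_complex /= ?addr0 ?add0r !eqxx.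
Qed.

Lemma measurable_sqn_displacement x z : measurable_fun setT
  (fun t : restr => sqn (displacement l (ext t) (x + z) - displacement l (ext t) x)).
Proof.
have mre y : measurable_fun setT (fun t : restr => hat_re (ext t) y).
  apply: measurable_funD; first exact: m_re.
  apply: measurable_funM; first by apply: measurable_funB => //; exact: m_occ.
  by apply: measurable_funM => //; apply: measurable_sum => k; exact: m_re.
have mim y : measurable_fun setT (fun t : restr => hat_im (ext t) y).
  apply: measurable_funD; first exact: m_im.
  apply: measurable_funM; first by apply: measurable_funB => //; exact: m_occ.
  by apply: measurable_funM => //; apply: measurable_sum => k; exact: m_im.
rewrite (_ : (fun t => _) = fun t : restr =>
    (hat_re (ext t) (x + z) - hat_re (ext t) x - l * complex.Re (emb z : C)) ^+ 2 +
    (hat_im (ext t) (x + z) - hat_im (ext t) x - l * complex.Im (emb z : C)) ^+ 2).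
  apply: measurable_funD; apply: measurable_funX; apply: measurable_funB => //.
    by apply: measurable_funB; exact: mre.
  by apply: measurable_funB; exact: mim.
apply/funext => t; rewrite displacementB !hat0_reim /sqn; case: (emb z) => a b /=.
by rewrite !mul0r subr0 addr0.
Qed.

End measurable_energy.

(** * Translation invariance of energy and regularity *)

Section translation_invariance.
Context {R : realType}.
Local Notation C := R[i].
Variables (l : R) (N : nat).
Hypothesis N0 : (0 < N)%N.
Implicit Types (w : @config R) (v : A2).

Definition shift_config v w : @config R := fun x => w (x + v).

Lemma hat0_shift_config v w x : hat0 (shift_config v w) x = hat0 w (x + v).
Proof.
rewrite /hat0 /shift_config; case: (w _) => [//|].
by congr (_ * _); rewrite !sum_nbrs /= ![x + _ + v]addrAC.
Qed.

Lemma hamiltonian_shift_config V m v w : Omega_star l N w ->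
  hamiltonian V m N (shift_config v w) = hamiltonian V m N w.
Proof.
move=> wO; rewrite !hamiltonianE; congr (_ * _ + _ * _).
  pose f x z := pair_energy V (w x) (w (x + z)).
  rewrite -[RHS](@sum_IN_nbrs_shift _ N f (fun=> v) N0).
    apply: eq_bigr => x _; apply: eq_bigr => z _.
    by rewrite /f /shift_config addrAC.
  move=> z x y; rewrite /f addrAC !wO; case: (w x) => [c|//]; case: (w (x + z)) => [d|//] /=.
  by congr V; rewrite /dist; congr Normc.normc; ring.
rewrite -[RHS](@sum_IN_shift _ N _ v N0)//.
by move=> x y; rewrite /hole wO; case: (w x).
Qed.

Lemma regular_shift_config alpha v w : regular alpha l N w ->
  regular alpha l N (shift_config v w).
Proof.
have adjD x y : adj (R := R) x y -> adj (R := R) (x + v) (y + v).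
  by move=> /adjE xy; apply/adjE; rewrite opprD addrACA subrr addr0.
move=> [w0 w1 w2 w4]; split.
- by move=> x z; rewrite /shift_config addrAC w0.
- by move=> x y c d /adjD; exact: w1.
- move=> x y wx wy; have [/addIr|] := w2 _ _ wx wy; first by left.
  by rewrite !distE -!embB opprD addrACA subrr addr0; right.
- move=> x z zn; rewrite !hat0_shift_config.
  by have := w4 (x + v) z zn; rewrite ![x + v + _]addrAC.
Qed.

Lemma hat_shift_config v w p : hat (shift_config v w) p = hat w (p + emb v).
Proof.
have l1 : lat1 (p + emb v) = lat1 p + v.1%:~R.
  have s0 := @sin_pi3_gt0 R; have sn : sin (pi / 3) != 0 :> R by rewrite gt_eqF.
  have RC (k : int) : k%:~R = (k%:~R : R)%:C%C :> C by rewrite (rmorph_int (real_complex R)).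
  by rewrite /lat1 /emb !RC /tau cos_pi3; case: p => a b /=; field.
have l2 : lat2 (p + emb v) = lat2 p + v.2%:~R.
  have s0 := @sin_pi3_gt0 R; have sn : sin (pi / 3) != 0 :> R by rewrite gt_eqF.
  have RC (k : int) : k%:~R = (k%:~R : R)%:C%C :> C by rewrite (rmorph_int (real_complex R)).
  by rewrite /lat2 /emb !RC /tau; case: p {l1} => a b /=; field.
have fl (a : R) (k : int) : Num.floor (a + k%:~R) = Num.floor a + k.
  have /andP[h1 h2] := floor_itv a; rewrite rmorphD /= in h2.
  by apply: floor_def; rewrite !rmorphD /=; apply/andP; split; lra.
have fr (a : R) (k : int) : fractional (a + k%:~R) = fractional a.
  by rewrite /fractional fl rmorphD /=; ring.
rewrite !hat_tent_sum l1 l2 !tent_sumE !fl !fr /= !hat0_shift_config.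
case: v {l1 l2} => i j /=.
have -> : (Num.floor (lat1 p), Num.floor (lat2 p)) + (i, j) = (Num.floor (lat1 p) + i, Num.floor (lat2 p) + j) by [].
have -> : (Num.floor (lat1 p) + 1, Num.floor (lat2 p)) + (i, j) = (Num.floor (lat1 p) + i + 1, Num.floor (lat2 p) + j).
  by congr pair; rewrite /= addrAC.
have -> : (Num.floor (lat1 p), Num.floor (lat2 p) + 1) + (i, j) = (Num.floor (lat1 p) + i, Num.floor (lat2 p) + j + 1).
  by congr pair; rewrite /= addrAC.
by have -> : (Num.floor (lat1 p) + 1, Num.floor (lat2 p) + 1) + (i, j) = (Num.floor (lat1 p) + i + 1, Num.floor (lat2 p) + j + 1); first by congr pair; rewrite /= addrAC.
Qed.

Lemma bijective_shift_config v w : bijective (hat w) -> bijective (hat (shift_config v w)).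
Proof.
have -> : hat (shift_config v w) = hat w \o (fun p => p + emb v).
  by apply/funext => p; exact: hat_shift_config.
move=> bw; apply: bij_comp bw _.
by exists (fun p => p - emb v) => p; rewrite ?addrK ?subrK.
Qed.

Lemma displacement_shift_config v w x z :
  displacement l (shift_config v w) (x + z) - displacement l (shift_config v w) x =
  displacement l w (x + v + z) - displacement l w (x + v).
Proof. by rewrite !displacementB !hat0_shift_config [x + z + v]addrAC. Qed.

Lemma extend_shift_config v (t : (size (IN N)).-tuple (@spin R)) :
  extend l N (translate l v t) = shift_config v (extend l N t).
Proof. by apply/funext => x; rewrite extend_translate. Qed.

End translation_invariance.

(** exp (y / 2) is at least (1 + y / 4)^2, which exceeds y by (1 - y / 4)^2. *)
Lemma mul_expR_le1 {R : realType} (y : R) : 0 <= y -> y * expR (- (y / 2)) <= 1.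
Proof.
move=> y0; rewrite expRN ler_pdivrMr ?expR_gt0// mul1r.
have -> : y / 2 = y / 4 + y / 4 by field.
have := expR_ge1Dx (y / 4); rewrite expRD; move: (expR _) => e y1.
have : (1 + y / 4) * (1 + y / 4) <= e * e by apply: ler_pM => //; lra.
by apply: le_trans; have := sqr_ge0 (1 - y / 4); nra.
Qed.

(* Splits according to whether the energy excess K is at most A or not. *)
Lemma expR_mul_le {R : realType} (b A K : R) : 0 < b -> 0 <= A ->
  K * expR (- (b * K)) <= A * expR (- (b * K)) + b^-1 * expR (- (b * A / 2)).
Proof.
move=> b0 A0; have e0 := expR_ge0 (- (b * K)); have e1 := expR_ge0 (- (b * A / 2)).
have bi : 0 < b^-1 by rewrite invr_gt0.
have [KA|AK] := leP K A.
  apply: le_trans (ler_wpM2r e0 KA) _; rewrite lerDl mulr_ge0// ltW//.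
have K0 : 0 <= K by lra.
have h1 : b * K * expR (- (b * K / 2)) <= 1.
  by apply: mul_expR_le1; rewrite mulr_ge0// ltW.
have h2 : expR (- (b * K / 2)) <= expR (- (b * A / 2)).
  by rewrite ler_expR lerN2 ler_pM2r// ler_pM2l// ltW.
have -> : - (b * K) = - (b * K / 2) + - (b * K / 2) by lra.
rewrite expRD; move: (expR _) h1 h2 (expR_ge0 (- (b * K / 2))) => e h1 h2 e2.
rewrite -[leLHS]add0r; apply: lerD; first by rewrite !mulr_ge0.
rewrite (_ : K * (e * e) = b^-1 * (b * K * e * e)); last by field; rewrite gt_eqF.
rewrite ler_pM2l//; apply: le_trans h2.
by rewrite ler_piMl.
Qed.

(* V is only known near 1; replacing it by the measurable function Vp does not
   change the energy of regular configurations. *)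
Section averaging.
Context {R : realType}.
Variables (V Vp : R -> R) (alpha l m beta : R) (N : nat).
Hypotheses (N0 : (0 < N)%N) (l0 : 0 < l) (beta0 : 0 < beta).
Hypothesis mVp : measurable_fun setT Vp.
Hypothesis VpE : forall r, 1 - alpha < r < 1 + alpha -> Vp r = V r.
Local Notation restr := ((size (IN N)).-tuple (@spin R)).
Local Notation ext := (extend l N).
Local Notation mu := (power_measure (@spin_measure R) (size (IN N))).

Definition gibbs_weight (t : restr) : R := expR (- (beta * hamiltonian Vp m N (ext t))).

Lemma measurable_gibbs_weight : measurable_fun setT gibbs_weight.
Proof.
apply: (measurableT_comp (@measurable_expR R)).
apply: measurable_funN; apply: measurable_funM => //.
exact: measurable_hamiltonian.
Qed.

Lemma hamiltonian_patch w : regular alpha l N w -> hamiltonian Vp m N w = hamiltonian V m N w.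
Proof.
move=> [_ w1 _ _]; rewrite !hamiltonianE; congr (_ * _ + _).
apply: eq_bigr => x _; apply: eq_big_seq => z zn.
rewrite /pair_energy; case wx : (w x) => [c|//]; case wz : (w (x + z)) => [d|//].
by rewrite VpE//; apply: (w1 _ _ _ _ (adj_nbrs x zn)).
Qed.

Lemma gibbs_weight_translate v t : gibbs_weight (translate l v t) = gibbs_weight t.
Proof.
rewrite /gibbs_weight (extend_shift_config l N0 v).
by rewrite (hamiltonian_shift_config N0 _ _ _ (extend_Omega_star l t N0)).
Qed.

Lemma regular_occupied t : regular alpha l N (ext t) -> occupied l t.
Proof.
move=> tr; case t0 : (ext t 0) => [c|]; first by exists 0; rewrite t0.
exists (0 + one2); exact: (hole_nbr tr t0).
Qed.

Variable B : set restr.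
Hypotheses (mB : measurable B) (Breg : forall t, B t -> regular alpha l N (ext t)).
Hypothesis Binv : forall v t, B (translate l v t) <-> B t.
Variables (z : A2).
Hypothesis zn : z \in nbrs.

Local Open Scope ereal_scope.

Let Y (x : A2) (t : restr) : R :=
  (sqn (displacement l (ext t) (x + z)%R - displacement l (ext t) x) * gibbs_weight t * \1_B t)%R.

Let Y0 x t : (0 <= Y x t)%R.
Proof. by rewrite /Y !mulr_ge0 ?sqn_ge0 ?expR_ge0. Qed.

Let mY x : measurable_fun setT (EFin \o Y x).
Proof.
apply/measurable_EFinP; apply: measurable_funM; last exact: measurable_indic.
apply: measurable_funM; last exact: measurable_gibbs_weight.
exact: measurable_sqn_displacement.
Qed.

Let indicB v t : \1_B (translate l v t) = \1_B t :> R.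
Proof.
have E : (translate l v t \in B) = (t \in B) by apply/idP/idP; rewrite !inE => /Binv.
by rewrite !indicE E.
Qed.

Let Y_translate x v t : Y x (translate l v t) = Y (x + v)%R t.
Proof.
rewrite /Y gibbs_weight_translate indicB extend_shift_config//.
by rewrite displacement_shift_config.
Qed.

Let Y_period x y t : Y (x + y *+ N)%R t = Y x t.
Proof.
rewrite /Y indicE; have [tB|tB] := pselect (B t); last by rewrite memNset// !mulr0.
have uP := displacement_periodic (Breg tB).
by rewrite [(x + _ + z)%R]addrAC !uP.
Qed.

Let translateK t x y : @translate R l N x (@translate R l N y t) = @translate R l N (x + y)%R t.
Proof. exact: translateD. Qed.

Let fund_shift v : fundamental (fun y => @translate R l N (y *+ N)%R) (@occupied R l N)
  (@translate R l N v @^-1` @fund R l N).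
Proof.
split.
  rewrite -[X in measurable X]setTI; apply: measurable_translate => //.
  exact: measurable_fund.
move=> t tO; have [y [yF yu]] := fund_unique N0 l0 ((occupied_translate l N0 v t).2 tO).
exists y; split=> [|y' /= h]; first by rewrite /= translateK addrC -translateK.
by apply: yu; move: h; rewrite translateK addrC -translateK.
Qed.

(** The translation by v preserves the measure but replaces [fund] by another fundamental domain for
    the shifts by periods. The integrand is periodic on regular configurations and vanishes
    elsewhere, so unfolding leads back to [fund]. *)
Lemma integral_translate x v :
  \int[mu]_(t in @fund R l N) (Y x t)%:E = \int[mu]_(t in @fund R l N) (Y (x + v)%R t)%:E.
Proof.
rewrite -(@integral_preserving _ _ _ mu (@translate R l N v) (@fund R l N) (EFin \o Y x))//; last first.
- by move=> t; rewrite lee_fin.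
- exact: measurable_fund.
- by move=> A mA; exact: measure_translate.
- exact: measurable_translate.
under eq_integral do rewrite /= Y_translate.
apply: (@integral_fundamental _ _ _ mu (fun y => @translate R l N (y *+ N)%R) _ _ _ (@occupied R l N)
   (EFin \o Y (x + v)%R)).
- by move=> y; exact: measurable_translate.
- by move=> y A mA; exact: measure_translate.
- by move=> y t; rewrite translateK -mulrnDl subrr mul0rn translate0.
- exact: measurable_occupied.
- by move=> y t; exact: occupied_translate.
- exact: mY.
- by move=> t; rewrite lee_fin.
- by move=> y t /=; rewrite Y_translate Y_period.
- move=> t tO /=; rewrite /Y indicE memNset ?mulr0// => /Breg /regular_occupied; exact: tO.
- exact: fund_shift.
have := fund_shift 0%R; rewrite (_ : @translate R l N 0%R @^-1` @fund R l N = @fund R l N)//.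
by apply/seteqP; split=> t /=; rewrite translate0.
Qed.

Variables (c0 A bnd : R).
Hypotheses (c00 : (0 < c0)%R) (A0 : (0 <= A)%R).
Hypothesis energy : forall w, regular alpha l N w ->
  (c0 * dirichlet l N w <= hamiltonian V m N w - 3 * (N * N)%:R * V l)%R.
Hypothesis volume : mu (@fund R l N `&` B) <= bnd%:E.

Let H0 : R := (3 * (N * N)%:R * V l)%R.

(** By [integral_translate] the left side is a sum over all base points, whose integrand is at most
    the Dirichlet sum times the weight, hence at most the energy excess times the weight over c0.
    [expR_mul_le] with threshold A then separates a multiple of the weight from a constant, and the
    constant is integrated against the volume bound. *)
Lemma integral_displacement_le x :
  (N * N)%:R%:E * \int[mu]_(t in @fund R l N) (Y x t)%:E <=
  (c0^-1)%:E * (A%:E * \int[mu]_(t in @fund R l N `&` B) (gibbs_weight t)%:E +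
    (beta^-1 * expR (- (beta * A / 2)) * expR (- (beta * H0)) * bnd)%:E).
Proof.
pose c1 := (beta^-1 * expR (- (beta * A / 2)) * expR (- (beta * H0)))%R.
have c10 : (0 <= c1)%R by rewrite !mulr_ge0 ?expR_ge0// invr_ge0 ltW.
have mF := measurable_fund l N0.
have mW : measurable_fun setT (fun t => (gibbs_weight t)%:E).
  by apply/measurable_EFinP; exact: measurable_gibbs_weight.
have -> : (N * N)%:R%:E * \int[mu]_(t in @fund R l N) (Y x t)%:E =
    \sum_(v <- IN N) \int[mu]_(t in @fund R l N) (Y v t)%:E.
  rewrite (eq_bigr (fun=> \int[mu]_(t in @fund R l N) (Y x t)%:E)); last first.
    move=> v _; rewrite (integral_translate v (x - v)%R).
    by rewrite [(v + _)%R]addrC subrK.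
  move: (\int[mu]_(t in _) _) => J.
  by rewrite big_const_seq count_predT size_IN iter_addr addr0 mule_natl.
rewrite -ge0_integral_sum//; last 2 first.
- by move=> v; apply: measurable_funS (mY v).
- by move=> v t _; rewrite lee_fin.
apply: (@le_trans _ _ (\int[mu]_(t in @fund R l N `&` B)
    ((c0^-1)%:E * (A%:E * (gibbs_weight t)%:E + c1%:E)))).
  rewrite integral_mkcond [leRHS]integral_mkcond; apply: ge0_le_integral => //.
  - by move=> t _; rewrite patchE; case: ifP => // _; apply: sume_ge0 => v _; rewrite lee_fin.
  - apply/(measurable_restrictT _ _).1 => //; apply: measurable_funS (measurableT) _ _ => //.
    by apply: emeasurable_sum => v; exact: mY.
  - apply/(measurable_restrictT _ _).1; first exact: measurableI.
    apply: measurable_funS (measurableT) _ _ => //.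
    apply: measurable_funeM; apply: emeasurable_funD => //; exact: measurable_funeM.
  move=> t _; rewrite !patchE in_setI; case: ifPn => //= tF.
  rewrite sumEFin; case: ifPn => [|] tB; last first.
    rewrite lee_fin big1// => v _; rewrite /Y indicE.
    by rewrite (negbTE tB) mulr0.
  rewrite inE in tB; have tr := Breg tB.
  change ((\sum_(v <- IN N) Y v t)%:E <= (c0^-1 * (A * gibbs_weight t + c1))%:E); rewrite lee_fin.
  rewrite (eq_bigr (fun v => sqn (displacement l (ext t) (v + z)%R - displacement l (ext t) v) * gibbs_weight t)%R); last first.
    by move=> v _; rewrite /Y indicE mem_set// mulr1.
  rewrite -mulr_suml.
  have W0 : (0 <= gibbs_weight t)%R by exact: expR_ge0.
  have SD : (\sum_(v <- IN N) sqn (displacement l (ext t) (v + z) - displacement l (ext t) v) <=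
      dirichlet l N (ext t))%R.
    apply: ler_sum => v _; rewrite (big_rem z)//= lerDl.
    by apply: sumr_ge0 => y _; exact: sqn_ge0.
  set K := (hamiltonian V m N (ext t) - H0)%R.
  have SK : (\sum_(v <- IN N) sqn (displacement l (ext t) (v + z) - displacement l (ext t) v) <= c0^-1 * K)%R.
    by rewrite ler_pdivlMl//; apply: le_trans (energy tr); rewrite ler_pM2l.
  apply: le_trans (ler_wpM2r W0 SK) _; rewrite -mulrA ler_pM2l ?invr_gt0//.
  have WE : gibbs_weight t = (expR (- (beta * K)) * expR (- (beta * H0)))%R.
    rewrite /gibbs_weight hamiltonian_patch// -expRD; congr expR; rewrite /K; ring.
  rewrite WE /c1; have := expR_mul_le K beta0 A0.
  have := expR_ge0 (- (beta * H0)); move: (expR (- (beta * H0))) (expR (- (beta * K))) => e1 e2 e10 h.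
  by rewrite !mulrA -mulrDl ler_wpM2r.
have mFB : measurable (@fund R l N `&` B) by exact: measurableI.
have mWD := measurable_funS measurableT (@subsetT _ (@fund R l N `&` B)) mW.
have W0 (t : restr) : 0 <= (gibbs_weight t)%:E by rewrite lee_fin expR_ge0.
have mAW : measurable_fun (@fund R l N `&` B) (fun t => A%:E * (gibbs_weight t)%:E).
  exact: measurable_funeM.
rewrite (ge0_integralZl mu mFB (f := fun t => A%:E * (gibbs_weight t)%:E + c1%:E)); first last.
- by rewrite lee_fin invr_ge0 ltW.
- by move=> t _; apply: adde_ge0; [apply: mule_ge0 => //; rewrite lee_fin|rewrite lee_fin].
- exact: emeasurable_funD.
rewrite lee_wpmul2l ?lee_fin ?invr_ge0 ?(ltW c00)//.
rewrite (ge0_integralD mu mFB (f1 := fun t => A%:E * (gibbs_weight t)%:E) (f2 := cst c1%:E))//; last first.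
  by move=> t _; apply: mule_ge0 => //; rewrite lee_fin.
rewrite (ge0_integralZl mu mFB (f := fun t => (gibbs_weight t)%:E))//.
rewrite leeD2l// integral_cst//.
by rewrite (EFinM c1) lee_wpmul2l ?lee_fin.
Qed.

End averaging.

(** * The Gibbs measure *)

Section set_function_integral.
Context {d : measure_display} {T : measurableType d} {R : realType}.
Import HBNNSimple.
Local Open Scope ereal_scope.
Variable phi : set T -> \bar R.
Hypothesis phi0 : phi set0 = 0.

Let sintegral_cst0 : sintegral phi (cst 0%R) = 0.
Proof.
rewrite /sintegral fsbig1// => r _; have [->|r0] := eqVneq r 0%R; first by rewrite mul0e.
rewrite (_ : _ @^-1` _ = set0) ?phi0 ?mule0//; apply/seteqP; split=> // x /= r0'.
by rewrite -r0' eqxx in r0.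
Qed.

(* The set function need not be a measure. *)
Lemma ge0_integral_set_function (D : set T) (f : T -> \bar R) : (forall x, 0 <= f x) ->
  \int[phi]_(x in D) f x =
  ereal_sup [set sintegral phi h |
    h in [set h : {nnsfun T >-> R} | forall x, (h x)%:E <= (f \_ D) x]].
Proof.
move=> f0; rewrite /integral funeneg_restrict funepos_restrict.
have /eq_restrictP-> := ge0_funeposE (fun x (_ : D x) => f0 x).
have /eq_restrictP-> := ge0_funenegE (fun x (_ : D x) => f0 x).
rewrite erestrict0 -[RHS]sube0; congr (_ - _).
apply/eqP; rewrite eq_le; apply/andP; split; last first.
  by apply/ereal_sup_ubound; exists nnsfun0.
apply/ge_ereal_sup => /= x [h /= h0 <-].
rewrite (_ : HBNNSimple.NonNegSimpleFun.sort h = cst 0%R :> (_ -> _)) ?sintegral_cst0//.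
by apply/funext => y; apply/eqP; rewrite eq_le -2!lee_fin h0 lee_fin /=.
Qed.

Lemma ge0_integral_set_function_ge0 (D : set T) (f : T -> \bar R) : (forall x, 0 <= f x) ->
  0 <= \int[phi]_(x in D) f x.
Proof.
move=> f0; rewrite ge0_integral_set_function//; apply: ereal_sup_ubound.
exists nnsfun0 => //= x; rewrite patchE; case: ifP => // _; exact: f0.
Qed.

(** The level set of 0 is multiplied by 0, so [phi] has to be known only on the levels y != 0. This
    matters because the zero level may meet the allowed set in a set that is not known to be
    measurable. *)
Lemma sintegral_density (mu : {measure set T -> \bar R}) (w : T -> R) (c : \bar R)
    (h : {nnsfun T >-> R}) : measurable_fun setT w -> (forall x, (0 <= w x)%R) -> 0 <= c ->
  (forall y, y != 0%R -> phi (h @^-1` [set y]) = c * \int[mu]_(x in h @^-1` [set y]) (w x)%:E) ->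
  sintegral phi h = c * \int[mu]_x (h x * w x)%:E.
Proof.
move=> mw w0 c0 phiE.
have mh (y : R) : measurable (h @^-1` [set y]) by exact: measurable_sfunP.
have T0 (y : R) x : (0 <= y * \1_(h @^-1` [set y]) x * w x)%R.
  rewrite mulr_ge0// indicE; case: (boolP (x \in _)) => [|_]; last by rewrite mulr0.
  by rewrite inE /= => <-; rewrite mulr1.
have mT (y : R) : measurable_fun setT (fun x => (y * \1_(h @^-1` [set y]) x * w x)%:E).
  by apply/measurable_EFinP; apply: measurable_funM => //; apply: measurable_funM.
under eq_integral do rewrite fimfunE mulr_fsuml -fsumEFin//.
rewrite ge0_integral_fsum//; last by move=> y x _; rewrite lee_fin.
rewrite ge0_mule_fsumr; last by move=> y; apply: integral_ge0 => x _; rewrite lee_fin.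
transitivity (\sum_(y \in range h) y%:E * phi (h @^-1` [set y])).
  rewrite (fsbig_widen (range h) setT)//= => y [_ yh] /=.
  by rewrite preimage10// phi0 mule0.
apply: eq_fsbigr => y; rewrite inE => -[x _ xy].
have y0 : (0 <= y)%R by rewrite -xy.
have [->|yn] := eqVneq y 0%R.
  by rewrite mul0e; under eq_integral do rewrite !mul0r; rewrite integral0 mule0.
rewrite phiE// muleCA; congr (_ * _).
rewrite integral_mkcond -ge0_integralZl//; last 2 first.
- by apply/(measurable_restrictT _ _).1 => //; apply/measurable_EFinP; exact: measurable_funTS.
- by move=> t _; rewrite patchE; case: ifP; rewrite ?lee_fin.
apply: eq_integral => t _; rewrite patchE indicE.
by case: (t \in _) => /=; [rewrite mulr1 EFinM|rewrite mulr0 mul0r mule0].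
Qed.

End set_function_integral.

(** Both integrals are suprema over simple functions, and every simple function below the first
    integrand is below the second; no measurability enters. *)
Lemma ge0_le_integral_subset {d : measure_display} {T : measurableType d} {R : realType}
    (mu : {measure set T -> \bar R}) (A D : set T) (f g : T -> \bar R) :
  A `<=` D -> (forall x, 0 <= f x)%E -> (forall x, 0 <= g x)%E ->
  (forall x, A x -> f x <= g x)%E ->
  (\int[mu]_(x in A) f x <= \int[mu]_(x in D) g x)%E.
Proof.
move=> AD f0 g0 fg; rewrite !ge0_integral_set_function//.
apply: le_ereal_sup => _ [h /= hf <-]; exists h => //= x; apply: le_trans (hf x) _.
rewrite !patchE; case: ifPn => [xA|_]; last by case: ifP.
by move: xA; rewrite inE => xA; rewrite mem_set; [exact: fg|exact: AD].
Qed.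

Section gibbs_bound.
Context {R : realType}.
Variables (V Vp : R -> R) (alpha l m beta : R) (N : nat).
Hypotheses (N0 : (0 < N)%N) (l0 : 0 < l) (beta0 : 0 < beta).
Hypothesis mVp : measurable_fun setT Vp.
Hypothesis VpE : forall r, 1 - alpha < r < 1 + alpha -> Vp r = V r.
Local Notation restr := ((size (IN N)).-tuple (@spin R)).
Local Notation ext := (extend l N).
Local Notation mu := (power_measure (@spin_measure R) (size (IN N))).
Local Notation W := (@gibbs_weight R Vp l m beta N).
Local Notation Z := (partition_function V alpha l beta m N).
Local Notation all := (@allowed R alpha l N).

Lemma allowedE (t : restr) : all t <->
  [/\ fund l t, regular alpha l N (ext t) & bijective (hat (ext t))].
Proof.
split; first by move=> [[h1 h2] h3 h4 h5 h6]; split.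
by move=> [h2 [h1 h3 h4 h6] h5]; split.
Qed.

Lemma weight_patch (t : restr) : all t -> weight V l beta m t = W t.
Proof.
by move=> /allowedE[_ tr _]; rewrite /weight /gibbs_weight (hamiltonian_patch m VpE tr).
Qed.

Local Open Scope ereal_scope.

Lemma partition_function_ge (A : set restr) : A `<=` all ->
  \int[mu]_(t in A) (W t)%:E <= Z.
Proof.
move=> Aall; apply: (ge0_le_integral_subset mu) => // t; rewrite ?lee_fin ?expR_ge0//.
by move=> /Aall /weight_patch ->.
Qed.

Lemma partition_function_ge0 : 0 <= Z.
Proof. by apply: (@integral_ge0 _ _ _ mu) => t _; rewrite lee_fin expR_ge0. Qed.

Lemma gibbs_set0 : gibbs V alpha l beta m (N := N) set0 = 0.
Proof. by rewrite /gibbs set0I /mu_prod (@integral_set0 _ _ _ mu) mule0. Qed.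


Import HBNNSimple.

(** On a nonzero level of h the intersection with the allowed set is the level itself, a measurable
    set, and there the weight of V agrees with that of the measurable [Vp]. *)
Lemma gibbs_density (h : {nnsfun restr >-> R}) : (forall t, h t != 0%R -> all t) ->
  sintegral (gibbs V alpha l beta m (N := N)) h =
  ((fine Z)^-1)%:E * \int[mu]_t (h t * W t)%:E.
Proof.
move=> hall; apply: (sintegral_density gibbs_set0).
- exact: measurable_gibbs_weight.
- by move=> t; exact: expR_ge0.
- by rewrite lee_fin invr_ge0 fine_ge0// partition_function_ge0.
move=> y y0; have hy t : h t = y -> all t by move=> ht; apply: hall; rewrite ht.
rewrite /gibbs (_ : _ `&` all = h @^-1` [set y]); last first.
  by apply/seteqP; split=> [t []//|t /= ht]; split=> //; exact: hy.
apply: (congr1 (mule _)).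
apply: (@eq_integral _ _ _ mu) => t /set_mem ht.
by rewrite weight_patch//; exact: hy.
Qed.

(** For z infinite or zero, [(fine z)^-1] is 0 and the left side vanishes; for finite positive z the
    inequality is divided by z. *)
Lemma fine_inv_mule_le (z J : \bar R) (e : R) : 0 <= z -> (0 <= e)%R -> 0 <= J ->
  J <= e%:E * z -> ((fine z)^-1)%:E * J <= e%:E.
Proof.
case: z => [z||] //= z0 e0 J0 Jz; last by rewrite invr0 mul0e lee_fin.
move: z0; rewrite lee_fin le_eqVlt => /orP[/eqP <-|z0]; first by rewrite invr0 mul0e lee_fin.
rewrite -EFinM in Jz; case: J Jz J0 => [r|//|//] Jz J0; rewrite lee_fin in Jz.
have : (z^-1 * r <= e)%R by rewrite ler_pdivrMl// [leRHS]mulrC.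
by rewrite -lee_fin EFinM.
Qed.

(* [allowed] may fail to be measurable, because of the bijectivity required in
   [Omega]; the saturation of a measurable subset of it is measurable, invariant
   under translations and still made of regular configurations. *)
Definition saturation (A : set restr) : set restr := \bigcup_(v in [set: A2]) (@translate R l N v @^-1` A).

Lemma measurable_saturation A : measurable A -> measurable (saturation A).
Proof.
move=> mA; apply: countable_bigcupT_measurable => [|v]; first exact: countableP.
by rewrite -[X in measurable X]setTI; exact: measurable_translate.
Qed.

Lemma saturation_translate A v t : saturation A (translate l v t) <-> saturation A t.
Proof.
split=> -[u _ /=]; rewrite /saturation.
  by rewrite translateD// => ?; exists (u + v)%R.
move=> h; exists (u - v)%R => //=.
by rewrite translateD// subrK.
Qed.

Lemma saturation_sub A t : A t -> saturation A t.
Proof. by move=> At; exists 0%R; rewrite //= translate0. Qed.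

Lemma saturation_allowed A t : A `<=` all -> saturation A t ->
  regular alpha l N (ext t) /\ bijective (hat (ext t)).
Proof.
move=> Aall [v _ /= /Aall /allowedE[_]]; rewrite extend_shift_config// => h1 h2.
have E : shift_config (- v)%R (shift_config v (ext t)) = ext t.
  by apply/funext => x; rewrite /shift_config subrK.
split; first by rewrite -E; exact: regular_shift_config.
by rewrite -E; exact: bijective_shift_config.
Qed.

Variables (X : @config R -> R) (x z1 z2 : A2) (K c0 a bnd : R).
Hypotheses (z1n : z1 \in nbrs) (z2n : z2 \in nbrs).
Hypotheses (K0 : (0 <= K)%R) (c00 : (0 < c0)%R) (a0 : (0 <= a)%R).
Hypothesis X0 : forall w, (0 <= X w)%R.
Hypothesis XK : forall w, (X w <= K * (sqn (displacement l w (x + z1) - displacement l w x) +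
  sqn (displacement l w (x + z2) - displacement l w x)))%R.
Hypothesis energy : forall w, regular alpha l N w ->
  (c0 * dirichlet l N w <= hamiltonian V m N w - 3 * (N * N)%:R * V l)%R.
Hypothesis volume : forall D : set restr, measurable D ->
  (forall t, D t -> fund l t /\ regular alpha l N (ext t)) -> mu D <= bnd%:E.
Hypothesis lower : (expR (- (beta * (a * (N * N)%:R) / 2)) *
  expR (- (beta * (3 * (N * N)%:R * V l))) * bnd)%:E <= Z.

Let Y z A t : R :=
  (sqn (displacement l (ext t) (x + z)%R - displacement l (ext t) x) * W t * \1_(saturation A) t)%R.

Let integral_Y_le z A : z \in nbrs -> measurable A -> A `<=` all ->
  \int[mu]_(t in @fund R l N) (Y z A t)%:E <= (c0^-1 * (a + beta^-1))%:E * Z.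
Proof.
move=> zn mA Aall; pose n2 : R := (N * N)%:R.
have n21 : (1 <= n2)%R by rewrite ler1n muln_gt0 N0.
have n20 : (0 < n2)%R by exact: lt_le_trans n21.
have mB := measurable_saturation mA.
have Breg t : saturation A t -> regular alpha l N (ext t).
  by move=> /(saturation_allowed Aall)[].
have vol : mu (@fund R l N `&` saturation A) <= bnd%:E.
  apply: volume => [|t [tF /Breg tr]]; last by split.
  by apply: measurableI => //; exact: measurable_fund.
have A0 : (0 <= a * n2)%R by rewrite mulr_ge0// ltW.
have := integral_displacement_le N0 l0 beta0 mVp VpE mB Breg (@saturation_translate A) zn c00 A0 energy vol x.
rewrite -[X in X <= _ -> _]/(n2%:E * \int[mu]_(t in @fund R l N) (Y z A t)%:E) => h.
rewrite -(@lee_pmul2l _ n2%:E)//; apply: le_trans h _.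
have b0 : (0 <= beta^-1)%R by rewrite invr_ge0 ltW.
have c0i : (0 <= c0^-1)%R by rewrite invr_ge0 ltW.
have Z0 := partition_function_ge0.
apply: (@le_trans _ _ ((c0^-1)%:E * ((a * n2)%:E * Z + (beta^-1)%:E * Z))).
  rewrite lee_wpmul2l ?lee_fin//; apply: leeD.
    (* Translations preserve regularity and bijectivity, so inside [fund] the saturation consists of
       allowed configurations and its total weight is at most Z. *)
    have Ball : @fund R l N `&` saturation A `<=` all.
      by move=> t [tF /(saturation_allowed Aall)[tr tb]]; apply/allowedE.
    have ZB := partition_function_ge Ball.
    by rewrite lee_wpmul2l ?lee_fin.
  rewrite -!mulrA EFinM lee_wpmul2l ?lee_fin//.
  by move: lower; rewrite !mulrA.
rewrite -ge0_muleDl ?lee_fin// muleA -EFinD -EFinM muleA -EFinM lee_wpmul2r// lee_fin.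
rewrite [leRHS]mulrC -mulrA ler_wpM2l// mulrDl lerD2l ler_peMr//.
Qed.

(** Any simple function h below the integrand has a measurable support inside the allowed set. On it
    h is bounded by two squared increments of the displacement, so the estimate on the saturation of
    this support applies; it depends on h no further, and the supremum may be taken. *)
Lemma gibbs_expectation_le :
  gibbs_expectation V alpha l beta m N X <= (K * (2 * (c0^-1 * (a + beta^-1))))%:E.
Proof.
have Z0 := partition_function_ge0.
rewrite /gibbs_expectation ge0_integral_set_function ?gibbs_set0//; last first.
  by move=> t; rewrite lee_fin.
apply/ge_ereal_sup => /= _ [h /= hX <-].
have hall t : h t != 0%R -> all t.
  move=> ht; apply: contrapT => tall; have := hX t.
  by rewrite patchE memNset// lee_fin => h1; move: ht; rewrite eq_le h1 /=; have h2 : (0 <= h t)%R by []; rewrite h2.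
pose A := h @^-1` (~` [set 0%R]).
have mA : measurable A by apply: measurable_sfunP; exact: measurableC.
have Aall : A `<=` all by move=> t /eqP; exact: hall.
have hW0 t : (0 <= h t * W t)%R by rewrite mulr_ge0 ?expR_ge0.
rewrite gibbs_density//; apply: fine_inv_mule_le => //.
- by rewrite !mulr_ge0 ?addr_ge0 ?invr_ge0 ?(ltW c00) ?(ltW beta0).
- by apply: integral_ge0 => t _; rewrite lee_fin.
pose I z := \int[mu]_(t in @fund R l N) (Y z A t)%:E.
have Y0 z t : (0 <= Y z A t)%R by rewrite /Y !mulr_ge0 ?sqn_ge0 ?expR_ge0.
have mF : measurable (@fund R l N) by exact: measurable_fund.
have mY z : measurable_fun (@fund R l N) (fun t => (Y z A t)%:E).
  apply: measurable_funTS; apply/measurable_EFinP; apply: measurable_funM; last first.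
    by apply: measurable_indic; exact: measurable_saturation.
  apply: measurable_funM; last exact: measurable_gibbs_weight.
  exact: measurable_sqn_displacement.
apply: (@le_trans _ _ (K%:E * (I z1 + I z2))).
  rewrite -ge0_integralD//; last 2 first.
  - by move=> t _; rewrite lee_fin.
  - by move=> t _; rewrite lee_fin.
  rewrite -ge0_integralZl//; last 2 first.
  - exact: emeasurable_funD.
  - by move=> t _; rewrite adde_ge0 ?lee_fin.
  rewrite (_ : \int[mu]_t _ = \int[mu]_(t in @fund R l N) (h t * W t)%:E); last first.
    rewrite [RHS]integral_mkcond; apply: (@eq_integral _ _ _ mu) => t _; rewrite patchE.
    case: ifPn => // tF; have [->|/hall/allowedE[tF' _ _]] := eqVneq (h t) 0%R; first by rewrite mul0r.
    by rewrite mem_set in tF.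
  apply: (ge0_le_integral_subset mu) => // [t|t tF].
    by rewrite mule_ge0 ?adde_ge0 ?lee_fin.
  have W0 : (0 <= W t)%R by exact: expR_ge0.
  have [ht|ht] := eqVneq (h t) 0%R.
    by rewrite ht mul0r mule_ge0 ?adde_ge0 ?lee_fin.
  have Bt : saturation A t by apply: saturation_sub; apply/eqP.
  rewrite /Y indicE mem_set// !mulr1 -EFinD -EFinM lee_fin -mulrDl mulrA ler_wpM2r//.
  apply: le_trans (XK (ext t)).
  by have := hX t; rewrite patchE mem_set ?lee_fin//; exact: hall.
rewrite EFinM -muleA lee_wpmul2l ?lee_fin//.
apply: le_trans (leeD (integral_Y_le z1n mA Aall) (integral_Y_le z2n mA Aall)) _.
have cb : (0 <= c0^-1 * (a + beta^-1))%R.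
  by rewrite mulr_ge0 ?addr_ge0 ?invr_ge0 ?(ltW c00) ?(ltW beta0).
rewrite -ge0_muleDl ?lee_fin//.
rewrite -EFinD lee_wpmul2r// lee_fin. lra.
Qed.

End gibbs_bound.

(** * Lower bound for the partition function *)

Section partition_lower_bound.
Context {R : realType}.
Variables (V : R -> R) (alpha l m beta r : R) (N : nat).
Hypotheses (N5 : (5 <= N)%N) (beta0 : 0 <= beta) (r0 : 0 <= r) (r1 : r <= 1 / 16).
Hypotheses (rl : 64 * r < l) (ra : 20 * r < alpha) (la : `|l - 1| < alpha / 2) (l12 : 1 / 2 <= l).
Hypothesis VL : forall s, `|s - 1| <= alpha -> `|V s - V l| <= `|s - l|.
Local Notation restr := ((size (IN N)).-tuple (@spin R)).
Local Notation ext := (extend l N).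
Local Notation mu := (power_measure (@spin_measure R) (size (IN N))).

Definition near_standard_box : set restr :=
  box (fun i => spin_box (l%:C%C * emb (site_of i) + tau) r).

Lemma near_standard_boxP t : near_standard_box t -> exists2 g : A2 -> R[i],
  forall x, ext t x = Some (l%:C%C * emb x + tau + g x) &
  forall x, `|complex.Re (g x)| <= r /\ `|complex.Im (g x)| <= r.
Proof.
move=> tG; have N0 : (0 < N)%N by exact: leq_trans N5.
pose g x := if ext t (red N x) is Some c then c - (l%:C%C * emb (red N x) + tau) else 0.
have gP x : exists2 c, ext t (red N x) = Some c & g x = c - (l%:C%C * emb (red N x) + tau) /\
    (`|complex.Re (g x)| <= r /\ `|complex.Im (g x)| <= r).
  have := tG (site_index N0 x); rewrite -(extend_site l N0) site_indexK /g /spin_box /=.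
  case: (ext t (red N x)) => [c|//] h; exists c => //; split=> //.
  by move: h; move: (_ + tau) => [d e]; case: c.
exists g => x; have [c cE [gE gr]] := gP x => //.
rewrite gE {1}(red_quo N x) (extend_Omega_star l t N0) cE; congr Some.
have E : emb x = emb (red N x) + N%:R * emb (quo N x) :> R[i].
  by rewrite {1}(red_quo N x) embD embMn mulr_natl.
rewrite E rmorphM /= rmorph_nat; ring.
Qed.

Lemma partition_function_lower :
  ((expR (- (beta * ((N * N)%:R * (3 * V l + 30 * r)))) * (4 * r ^+ 2) ^+ (N * N))%:E
   <= partition_function V alpha l beta m N)%E.
Proof.
have N0 : (0 < N)%N by exact: leq_trans N5.
have mG : measurable near_standard_box.
  by apply: measurable_box => i; exact: measurable_spin_box.
have muG : mu near_standard_box = ((4 * r ^+ 2) ^+ (N * N))%:E.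
  transitivity (\prod_(i < size (IN N)) spin_measure (spin_box (l%:C%C * emb (site_of i) + tau)%R r))%E.
    by apply: power_measure_box => i; exact: measurable_spin_box.
  rewrite (eq_bigr (fun=> (4 * r ^+ 2)%:E)) => [|i _]; last exact: spin_box_measure.
  rewrite -(size_IN N); elim: (size _) => [|n IH]; first by rewrite big_ord0.
  by rewrite big_ord_recr/= IH (exprSr (4 * r ^+ 2)) EFinM.
rewrite EFinM -muG -(@integral_cst _ _ _ mu)//.
apply: (ge0_le_integral_subset mu) => [t /near_standard_boxP[g gE gr]|t|t|t /near_standard_boxP[g gE gr]].
- by apply: (near_standard_Omega gE gr) => //; exact: extend_Omega_star.
- by rewrite lee_fin expR_ge0.
- by rewrite lee_fin expR_ge0.
rewrite lee_fin ler_expR lerN2 ler_wpM2l//.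
exact: (hamiltonian_near_standard N gE gr r0 rl ra la m VL).
Qed.

End partition_lower_bound.

(** * The limit *)

(** With x = b a / 6 the right side is exp (3 x) >= (1 + x)^3 >= x^3; the constant 216 is 6^3. *)
Lemma sqr_le_expR {R : realType} (M a b : R) : 0 < a -> 0 < b -> 216 * M / a ^+ 3 <= b ->
  M * b ^+ 2 <= expR (b * a / 2).
Proof.
move=> a0 b0; rewrite ler_pdivrMr ?exprn_gt0// => h.
have -> : b * a / 2 = b * a / 6 * 3%:R by field.
rewrite expRM_natr.
have x0 : 0 <= b * a / 6 by rewrite divr_ge0 ?mulr_ge0// ltW.
apply: (@le_trans _ _ ((b * a / 6) ^+ 3)).
  have -> : (b * a / 6) ^+ 3 = b ^+ 2 * (b * a ^+ 3 / 216) by field.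
  rewrite mulrC; apply: ler_wpM2l; first exact: sqr_ge0.
  by lra.
by rewrite lerXn2r ?nnegrE ?expR_ge0//; have := expR_ge1Dx (b * a / 6); lra.
Qed.

(** The quadratic factor, which comes from the free position of the first occupied site, is absorbed
    into a constant per site by Bernoulli's inequality with 17 = 1 + 16. *)
Lemma quadratic_le_exp {R : realType} (l : R) (N : nat) : 0 < l <= 2 ->
  1 + 4 * (l * N%:R) ^+ 2 <= 17 ^+ (N * N).
Proof.
move=> lP; apply: (@le_trans _ _ (1 + 16 * (N * N)%:R)).
  rewrite natrM; have : l ^+ 2 <= 4 by nra.
  have := ler0n R N; move: (N%:R) => x x0 l4.
  have : l ^+ 2 * x ^+ 2 <= 4 * x ^+ 2 by rewrite ler_wpM2r ?sqr_ge0.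
  rewrite exprMn; lra.
elim: (N * N)%N => [|n IH]; first by rewrite expr0; lra.
by rewrite exprS -addn1 natrD; have := ler0n R n; lra.
Qed.

(** Apart from the common factor exp (- 3 beta n v), both sides are n-th powers or bounded by one,
    so a single inequality per site suffices. This makes the threshold on beta uniform in N. *)
Lemma weight_ratio {R : realType} (n : nat) (beta a v K B : R) : 0 < beta ->
  expR (- (beta * a / 2)) * K <= expR (- 30) * (4 * beta^-1 ^+ 2) -> 0 <= K -> B <= K ^+ n ->
  expR (- (beta * (a * n%:R) / 2)) * expR (- (beta * (3 * n%:R * v))) * B <=
  expR (- (beta * (n%:R * (3 * v + 30 * beta^-1)))) * (4 * beta^-1 ^+ 2) ^+ n.
Proof.
move=> b0 base K0 BK.
have -> : - (beta * (n%:R * (3 * v + 30 * beta^-1))) = n%:R * (- 30) + - (beta * (3 * n%:R * v)).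
  by field; rewrite gt_eqF.
have -> : - (beta * (a * n%:R) / 2) = n%:R * (- (beta * a / 2)) by field.
rewrite expRD ![n%:R * _]mulrC !expRM_natr.
have := expR_ge0 (- (beta * (3 * n%:R * v))); move: (expR (- (beta * (3 * n%:R * v)))) => e e0.
move: base; set p := expR _; set s := expR _; set t := 4 * _ => base.
have p0 : 0 <= p by exact: expR_ge0.
have h : p ^+ n * B <= (s * t) ^+ n.
  apply: (@le_trans _ _ ((p * K) ^+ n)); first by rewrite exprMn ler_wpM2l// exprn_ge0.
  have pK : 0 <= p * K by rewrite mulr_ge0.
  by rewrite lerXn2r ?nnegrE//; exact: le_trans base.
rewrite (_ : p ^+ n * e * B = e * (p ^+ n * B)); last by ring.
rewrite (_ : s ^+ n * e * t ^+ n = e * (s ^+ n * t ^+ n)); last by ring.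
by rewrite -exprMn ler_wpM2l.
Qed.

Lemma cvge0_near {R : realType} (E : R -> \bar R) :
  (forall e : R, 0 < e -> \forall b \near +oo, (0 <= E b <= e%:E)%E) -> E b @[b --> +oo] --> 0%E.
Proof.
move=> H A [e /= e0 eA]; have e2 : 0 < e / 2 by rewrite divr_gt0.
apply: filterS (H _ e2) => b h; change (A (E b)).
case: (E b) h => [r||] /andP[]//; rewrite !lee_fin => r0 re.
by apply: eA; rewrite /= sub0r normrN ger0_norm//; lra.
Qed.

Lemma measurable_potential_patch {R : realType} (I : set R) (V : R -> R) (alpha : R) :
  potential I V -> `]1 - alpha, 1 + alpha[ `<=` I ->
  measurable_fun setT (V \_ `]1 - alpha, 1 + alpha[).
Proof.
move=> [_ dV _ _ _] sub; apply/(measurable_restrictT _ _).1 => //.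
apply: open_continuous_measurable_fun; first exact: interval_open.
move=> x; rewrite inE => /sub /dV /derivable1_diffP; exact: differentiable_continuous.
Qed.

(** The box around the standard configuration gets radius r = 1 / beta: its energy cost 30 beta r
    per site is then the constant 30, and its volume decays only polynomially in beta, so the
    exponential gain exp (- beta a / 2) per site prevails. *)
Lemma gibbs_expectation_small {R : realType} (V : R -> R) (k alpha l dVl : R) (nrm : 'M[R]_2 -> R) :
  is_norm nrm -> 0 < alpha <= 1 / 2 -> `|l - 1| < alpha / 2 -> 0 < k ->
  (forall r, `|r - 1| <= alpha -> V l + dVl * (r - l) + k * (r - l) ^+ 2 <= V r) ->
  `|dVl| <= 1 -> `|dVl| <= k / 688 ->
  (forall r, `|r - 1| <= alpha -> `|V r - V l| <= `|r - l|) ->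
  measurable_fun setT (V \_ `]1 - alpha, 1 + alpha[) ->
  forall e, 0 < e -> \forall beta \near +oo, forall (N : nat) (m : R) D,
    (5 <= N)%N -> 6 * (`|V l| + 204) + 14 * k <= m -> triangle D ->
    (gibbs_expectation V alpha l beta m N (fun w => nrm (grad w D - l%:M) ^+ 2)%R <= e%:E)%E.
Proof.
move=> /gradB_le[K K0 gradK] /andP[alpha0 alpha2] la k0 convex dV1 dVk lip mVp e e0.
have lP : 1 / 2 < l < 3 / 2.
  by move: la; rewrite ltr_norml => /andP[]; lra.
have [c0 c00 energy] : exists2 c0 : R, 0 < c0 & forall N m w, (0 < N)%N ->
    6 * (`|V l| + 204) + 14 * k <= m -> regular alpha l N w ->
    c0 * dirichlet l N w <= hamiltonian V m N w - 3 * (N * N)%:R * V l.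
  exists (k / 1376) => [|N m w N0 mP wr]; first by apply: (divr_gt0 k0); rewrite ltr0n.
  by apply: (energy_lower wr N0 alpha2 _ k0 convex dV1 dVk mP); clear -lP; lra.
have [K1 K10 volume] : exists2 K1 : R, 0 <= K1 & forall N (B : set ((size (IN N)).-tuple (@spin R))),
    (0 < N)%N -> measurable B -> (forall t, B t -> fund l t /\ regular alpha l N (extend l N t)) ->
    (power_measure (@spin_measure R) (size (IN N)) B <=
      ((1 + 4 * (l * N%:R) ^+ 2) * K1 ^+ (N * N))%:E)%E.
  exists 1601 => [|N B N0 mB BP]; first exact: ler0n.
  by apply: (measure_fund_regular (lexx _) alpha2 _ N0 mB BP); clear -lP; lra.
clear convex dV1 dVk.
pose d := K * (2 * c0^-1).
have d0 : 0 <= d by rewrite !mulr_ge0// invr_ge0 ltW.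
(* The final bound is d (a + 1 / beta) <= 2 d a once 1 / beta <= a; the denominator d + 1 also
   covers d = 0. *)
pose a := e / (2 * (d + 1)).
have a0 : 0 < a by rewrite divr_gt0// mulr_gt0//; lra.
(* The inequality per site in [weight_ratio], with constant 17 K1 and r = 1 / beta, reads M beta^2
   <= exp (beta a / 2) for this M. *)
have [M ME] : exists M : R, M = 17 * K1 * expR 30 / 4 by exists (17 * K1 * expR 30 / 4).
near=> beta => N m D N5 mP tD.
have N0 : (0 < N)%N by exact: leq_trans N5.
(* As l > 1 / 2, this ensures the condition 64 r < l for r = 1 / beta, and also r <= 1 / 16. *)
have b129 : 129 < beta by near: beta; apply: nbhs_pinfty_gt; rewrite num_real.
have b0 : 0 < beta by clear -b129; lra.
have ba : a^-1 < beta by near: beta; apply: nbhs_pinfty_gt; rewrite num_real.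
have balpha : 20 / alpha < beta by near: beta; apply: nbhs_pinfty_gt; rewrite num_real.
have bM : 216 * M / a ^+ 3 < beta by near: beta; apply: nbhs_pinfty_gt; rewrite num_real.
have bi0 : 0 < beta^-1 by rewrite invr_gt0.
have bi129 : 129 * beta^-1 < 1 by rewrite -ltr_pdivlMr// invrK mul1r.
have bia : beta^-1 <= a by rewrite -[a]invrK lef_pV2 ?posrE ?invr_gt0// ltW.
have bialpha : 20 * beta^-1 < alpha by rewrite -ltr_pdivlMr// invrK mulrC -ltr_pdivrMr.
have VpE r : 1 - alpha < r < 1 + alpha -> (V \_ `]1 - alpha, 1 + alpha[) r = V r.
  by move=> rP; rewrite patchE mem_set//= in_itv.
have l0 : 0 < l by clear -lP; lra.
have z1n := triangle_nbrs tD.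
have z2n : mul_tau D.2 \in nbrs by rewrite nbrs_tau.
have lower := @partition_function_lower R V alpha l m beta beta^-1 N N5 (ltW b0) (ltW bi0).
apply: le_trans (gibbs_expectation_le N0 l0 b0 mVp VpE (x := D.1) (z1 := D.2) (z2 := mul_tau D.2)
  (c0 := c0) (a := a) (bnd := (1 + 4 * (l * N%:R) ^+ 2) * K1 ^+ (N * N)) z1n z2n K0 c00 (ltW a0) _ _ _ _ _) _.
- by move=> w; exact: sqr_ge0.
- by move=> w; exact: gradK.
- by move=> w; exact: energy.
- by move=> B; exact: volume.
- apply: le_trans (lower _ _ _ la _ lip); [|clear -lP bi129 bialpha bi0; lra..].
  rewrite lee_fin; apply: (@weight_ratio _ _ _ _ _ (17 * K1)) => //.
  + have := sqr_le_expR a0 b0 (ltW bM); rewrite ME !expRN.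
    have := expR_gt0 (beta * a / 2); move: (expR (beta * a / 2)) => E E0.
    have := expR_gt0 (30 : R); move: (expR 30) => F F0 h.
    rewrite ler_pdivrMl//.
    apply: le_trans (ler_wpM2r _ h); last by rewrite !mulr_ge0 ?invr_ge0 ?exprn_ge0// ltW.
    by rewrite le_eqVlt; apply/orP; left; apply/eqP; field; rewrite !gt_eqF.
  + by rewrite mulr_ge0.
  + rewrite [leRHS]exprMn ler_wpM2r ?exprn_ge0//; apply: quadratic_le_exp; clear -lP; lra.
rewrite lee_fin (_ : _ * _ = d * (a + beta^-1)); last by rewrite /d; ring.
apply: (@le_trans _ _ (d * (2 * a))); first by rewrite ler_wpM2l//; clear -bia; lra.
rewrite /a (_ : d * _ = e * (d / (d + 1))); last by field; rewrite gt_eqF//; clear -d0; lra.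
by rewrite ler_piMr ?(ltW e0)// ler_pdivrMr; clear -d0; lra.
Unshelve. all: by end_near. Qed.

Theorem theorem1p3 (R : realType) (I : set R) (V : R -> R)
    (hV : potential I V) :
  exists alpha0 m0 : R, 0 < alpha0 /\
  forall alpha : R, 0 < alpha < alpha0 ->
  [/\ alpha < 1, `[1 - alpha, 1 + alpha] `<=` I &
      forall l : R, 1 - alpha / 2 < l < 1 + alpha / 2 ->
      forall nrm : 'M[R]_2 -> R, is_norm nrm ->
      ereal_sup [set
        ereal_sup [set
          ereal_sup [set
            gibbs_expectation V alpha l beta m N
              (fun w => nrm (grad w D - l%:M) ^+ 2)
          | D in triangleN N]
        | m in [set m : R | m0 <= m]]
      | N in [set N : nat | (5 <= N)%N]] @[beta --> +oo%R] --> 0%E].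
Proof.
have [k k0 near1] := potential_near1 hV.
(* The bound k / 688 on V'(l) is the one asked for by [energy_lower]; the bound 1 makes V
   1-Lipschitz near 1. *)
have [b b0 bk] : exists2 b : R, 0 < b & b <= k / 688.
  by exists (k / 688); [apply: (divr_gt0 k0); rewrite ltr0n|exact: lexx].
have [a a0 [aI [dV aV]]] := near1 (Num.min 1 b) (ltac:(by rewrite lt_min ltr01)).
(* As V is 1-Lipschitz near 1, |V(l)| <= |V(1)| + 1, which frees the threshold on m from l and
   alpha. *)
exists (Num.min a (1 / 2)), (6 * (`|V 1| + 1 + 204) + 14 * k); split.
  by rewrite lt_min a0 divr_gt0.
move=> alpha /andP[alpha0]; rewrite lt_min => /andP[alphaa alpha12].
have in_I r : `|r - 1| <= alpha -> `|r - 1| <= a by move=> /le_trans; apply; exact: ltW.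
have subI : `[1 - alpha, 1 + alpha] `<=` I.
  move=> r /=; rewrite in_itv /= => rP; apply/aI/in_I.
  by rewrite ler_norml; clear -rP; lra.
split; [by clear -alpha12; lra|exact: subI|].
move=> l lP nrm nrmP.
have la : `|l - 1| < alpha / 2 by rewrite ltr_norml; clear -lP; lra.
have la' : `|l - 1| <= a by apply: in_I; apply: le_trans (ltW la) _; clear -alpha0; lra.
have lip r s : `|r - 1| <= alpha -> `|s - 1| <= a -> `|V r - V s| <= `|r - s|.
  move=> ra sa; have [_ _] := aV s r sa (in_I r ra).
  by move=> /le_trans; apply; rewrite ler_piMl// ge_min lexx.
have [dVl _ _] := aV l l la' la'; have [dV1 dVb] : `|dV l| <= 1 /\ `|dV l| <= b.
  by move: dVl; rewrite le_min => /andP.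
have dVk := le_trans dVb bk.
have mVp : measurable_fun setT (V \_ `]1 - alpha, 1 + alpha[).
  apply: (measurable_potential_patch hV) => r /=; rewrite in_itv /= => rP.
  by apply: subI; rewrite /= in_itv /=; clear -rP; lra.
have Vl : `|V l| <= `|V 1| + 1.
  rewrite -lerBlDl; apply: le_trans (lerB_dist _ _) _.
  apply: le_trans (lip _ _ _ _) _; rewrite ?subrr ?normr0 ?(ltW a0)//.
    by apply: ltW; apply: lt_le_trans la _; clear -alpha0; lra.
  by apply: ltW; apply: lt_trans la _; clear -alpha12; lra.
apply: cvge0_near => e e0.
have alphaP : 0 < alpha <= 1 / 2 by rewrite alpha0 ltW.
have small := gibbs_expectation_small nrmP alphaP la k0
  (fun r ra => let: And3 _ h _ := aV l r la' (in_I r ra) in h) dV1 dVk (fun r ra => lip r l ra la') mVp e0.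
apply: filterS small => beta small; apply/andP; split.
  (* A supremum over an empty family would be -oo, so nonnegativity is read off one term: N = 5, the
     least admissible m, and a triangle at the origin. *)
  set m0 := 6 * (`|V 1| + 1 + 204) + 14 * k.
  pose D0 : A2 * A2 := (0, one2).
  have D0N : triangleN 5 D0.
    by split; [left|apply/allpairsP; exists (0%N, 0%N)].
  have X0 : (0 <= gibbs_expectation V alpha l beta m0 5
      (fun w => nrm (grad w D0 - l%:M) ^+ 2)%R)%E.
    apply: ge0_integral_set_function_ge0 => [|t]; first exact: gibbs_set0.
    by rewrite lee_fin sqr_ge0.
  apply: (le_trans X0); apply: le_ereal_sup_tmp; eexists; first by exists 5%N.
  apply: le_ereal_sup_tmp; eexists; first by exists m0; [exact: lexx|].
  by apply: ereal_sup_ubound; exists D0.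
apply: ge_ereal_sup => _ [N /= N5 <-]; apply: ge_ereal_sup => _ [m /= mP <-].
apply: ge_ereal_sup => _ [D [tD _] <-]; apply: small => //.
by apply: le_trans mP; clear -Vl; lra.
Qed.
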